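(* The following are equivalent over $\mathsf{RCA}_0$: (i) The reals are connected, i.e., there are no open sets $U_0,U_1\neq\emptyset$ such that $U_0\cup U_1=\mathbb R$ and $U_0\cap U_1=\emptyset$. (ii) The infinite pigeonhole principle $\mathsf{IPP}$.
   Context: $\mathsf{RCA}_0$ is the usual base system of second-order arithmetic (basic arithmetic axioms, $\Sigma^0_1$-induction, $\Delta^0_1$-comprehension). ''Equivalent over $\mathsf{RCA}_0$'' means that the equivalence, formalized in second-order arithmetic, is provable in $\mathsf{RCA}_0$. Reals. A real is a Cauchy sequence $x=(x_n)_{n\in\mathbb N}$ of rationals with no rate of convergence given: for each rational $\varepsilon>0$ there is an $N\in\mathbb N$ with $|x_m-x_n|<\varepsilon$ for all $m,n\geq N$. For reals $x,y$: $x\leq y$ means that for each rational $\varepsilon>0$ there is an $N$ with $x_n\leq y_n+\varepsilon$ for all $n\geq N$; $x=y$ means $x\leq y$ and $y\leq x$; $x<y$ means $x\leq y$ but not $x=y$. Addition, multiplication and absolute value are defined pointwise; rationals are identified with constant sequences. Put $B_\delta(y)=\{z\in\mathbb R:|y-z|<\delta\}$. Open sets. A code for an open set is a set $U\subseteq\mathbb N\times\mathbb Q\times\mathbb Q_{>0}$. For a real $x$, write $x\in U$ if there are $N\in\mathbb N$ and $(a,r)\in\mathbb Q\times\mathbb Q_{>0}$ such that $x\in B_r(a)$ and $(n,a,r)\in U$ for all $n\geq N$. Set-theoretic statements about open sets refer to this membership relation for reals (e.g. $U\neq\emptyset$ means that some real $x$ satisfies $x\in U$). $\mathsf{IPP}$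 (infinite pigeonhole principle): for any $N\in\mathbb N$ and any $c\colon\mathbb N\to\{0,\ldots,N\}$ there is an $n\leq N$ such that $\{i\in\mathbb N:c(i)=n\}$ is infinite. *)

(* Defs.v *)
(* Second-order arithmetic as a formal theory: syntax, classical natural
   deduction, the axioms of RCA_0, and the formalization inside this language of
   rationals, reals, open sets, connectedness and the infinite pigeonhole
   principle. *)
From Stdlib Require Import List.
Import ListNotations.

(** * Language *)

(* Variables are de Bruijn indices, with separate index spaces for the number
   variables (bound by [fAllN]) and the set variables (bound by [fAllS]). *)

Inductive term : Type :=
| tVar (i : nat)
| tZero
| tOne
| tAdd (s t : term)
| tMul (s t : term).

Inductive form : Type :=
| fBot
| fEq (s t : term)
| fLt (s t : term)
| fIn (t : term) (X : nat)
| fImp (A B : form)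
| fAllN (A : form)
| fAllS (A : form).

Definition fNot (A : form) : form := fImp A fBot.
Definition fAnd (A B : form) : form := fNot (fImp A (fNot B)).
Definition fOr (A B : form) : form := fImp (fNot A) B.
Definition fIff (A B : form) : form := fAnd (fImp A B) (fImp B A).
Definition fExN (A : form) : form := fNot (fAllN (fNot A)).
Definition fExS (A : form) : form := fNot (fAllS (fNot A)).

Definition scons {T : Type} (x : T) (s : nat -> T) (i : nat) : T :=
  match i with O => x | S j => s j end.

Fixpoint tsubst (s : nat -> term) (t : term) : term :=
  match t with
  | tVar i => s i
  | tZero => tZero
  | tOne => tOne
  | tAdd a b => tAdd (tsubst s a) (tsubst s b)
  | tMul a b => tMul (tsubst s a) (tsubst s b)
  end.

Definition tshift : term -> term := tsubst (fun i => tVar (S i)).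

Fixpoint nsubst (s : nat -> term) (A : form) : form :=
  match A with
  | fBot => fBot
  | fEq a b => fEq (tsubst s a) (tsubst s b)
  | fLt a b => fLt (tsubst s a) (tsubst s b)
  | fIn a X => fIn (tsubst s a) X
  | fImp B C => fImp (nsubst s B) (nsubst s C)
  | fAllN B => fAllN (nsubst (scons (tVar 0) (fun i => tshift (s i))) B)
  | fAllS B => fAllS (nsubst s B)
  end.

Fixpoint srename (r : nat -> nat) (A : form) : form :=
  match A with
  | fBot => fBot
  | fEq a b => fEq a b
  | fLt a b => fLt a b
  | fIn a X => fIn a (r X)
  | fImp B C => fImp (srename r B) (srename r C)
  | fAllN B => fAllN (srename r B)
  | fAllS B => fAllS (srename (scons 0 (fun i => S (r i))) B)
  end.

Definition nshift : form -> form := nsubst (fun i => tVar (S i)).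
Definition sshift : form -> form := srename S.
Definition ninst (t : term) : form -> form := nsubst (scons t tVar).
Definition sinst (X : nat) : form -> form := srename (scons X (fun i => i)).

(** * Classical two-sorted natural deduction with equality of numbers *)

(* [Gamma] is the list of open assumptions.  The axioms in [T] may contain free
   variables; since [d_ax] ignores [Gamma], they can always be generalized, that
   is, they stand for their universal closures. *)
Inductive derives (T : form -> Prop) : list form -> form -> Prop :=
| d_ax Gamma A : T A -> derives T Gamma A
| d_hyp Gamma A : In A Gamma -> derives T Gamma A
| d_impI Gamma A B : derives T (A :: Gamma) B -> derives T Gamma (fImp A B)
| d_impE Gamma A B :
    derives T Gamma (fImp A B) -> derives T Gamma A -> derives T Gamma B
| d_raa Gamma A : derives T (fNot A :: Gamma) fBot -> derives T Gamma A
| d_allNI Gamma A : derives T (map nshift Gamma) A -> derives T Gamma (fAllN A)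
| d_allNE Gamma A t : derives T Gamma (fAllN A) -> derives T Gamma (ninst t A)
| d_allSI Gamma A : derives T (map sshift Gamma) A -> derives T Gamma (fAllS A)
| d_allSE Gamma A X : derives T Gamma (fAllS A) -> derives T Gamma (sinst X A)
| d_eqI Gamma t : derives T Gamma (fEq t t)
| d_eqE Gamma A s t :
    derives T Gamma (fEq s t) -> derives T Gamma (ninst s A) ->
    derives T Gamma (ninst t A).

Definition provable (T : form -> Prop) (A : form) : Prop := derives T [] A.

(** * The theory RCA_0 *)

(* Formulas with bounded number quantifiers only; set parameters are allowed. *)
Inductive bounded : form -> Prop :=
| b_bot : bounded fBot
| b_eq s t : bounded (fEq s t)
| b_lt s t : bounded (fLt s t)
| b_in t X : bounded (fIn t X)
| b_imp A B : bounded A -> bounded B -> bounded (fImp A B)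
| b_all t A : bounded A -> bounded (fAllN (fImp (fLt (tVar 0) (tshift t)) A))
| b_ex t A : bounded A -> bounded (fExN (fAnd (fLt (tVar 0) (tshift t)) A)).

Inductive Sigma01 : form -> Prop :=
| sigma01_ex A : bounded A -> Sigma01 (fExN A).

Inductive Pi01 : form -> Prop :=
| pi01_all A : bounded A -> Pi01 (fAllN A).

Definition tSucc (t : term) : term := tAdd t tOne.

Definition induction_axiom (A : form) : form :=
  fImp (ninst tZero A)
    (fImp (fAllN (fImp A (nsubst (scons (tSucc (tVar 0)) (fun i => tVar (S i))) A)))
       (fAllN A)).

Definition comprehension_axiom (A B : form) : form :=
  fImp (fAllN (fIff A B)) (fExS (fAllN (fIff (fIn (tVar 0) 0) (sshift A)))).

Inductive RCA0 : form -> Prop :=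
| ax_succ_neq0 : RCA0 (fNot (fEq (tSucc (tVar 0)) tZero))
| ax_succ_inj :
    RCA0 (fImp (fEq (tSucc (tVar 0)) (tSucc (tVar 1))) (fEq (tVar 0) (tVar 1)))
| ax_add0 : RCA0 (fEq (tAdd (tVar 0) tZero) (tVar 0))
| ax_addS :
    RCA0 (fEq (tAdd (tVar 0) (tSucc (tVar 1))) (tSucc (tAdd (tVar 0) (tVar 1))))
| ax_mul0 : RCA0 (fEq (tMul (tVar 0) tZero) tZero)
| ax_mulS :
    RCA0 (fEq (tMul (tVar 0) (tSucc (tVar 1)))
              (tAdd (tMul (tVar 0) (tVar 1)) (tVar 0)))
| ax_lt0 : RCA0 (fNot (fLt (tVar 0) tZero))
| ax_ltS :
    RCA0 (fIff (fLt (tVar 0) (tSucc (tVar 1)))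
               (fOr (fLt (tVar 0) (tVar 1)) (fEq (tVar 0) (tVar 1))))
| ax_Sigma01_induction A : Sigma01 A -> RCA0 (induction_axiom A)
| ax_Delta01_comprehension A B :
    Sigma01 A -> Pi01 B -> RCA0 (comprehension_axiom A B).

(** * Named variables *)

(* To write concrete formulas with named bound variables, a number, set or
   formula is given as a function of the number of binders (of its sort, resp.
   of both sorts) above its occurrence.  A variable bound at depth [d] has index
   [d' - S d] at depth [d'].  [sentence] turns a closed expression into a formula. *)

Definition nexp : Type := nat -> term.
Definition sexp : Type := nat -> nat.
Definition fexp : Type := nat -> nat -> form.

Definition sentence (A : fexp) : form := A 0 0.

Definition nZero : nexp := fun _ => tZero.
Definition nOne : nexp := fun _ => tOne.
Definition nAdd (a b : nexp) : nexp := fun d => tAdd (a d) (b d).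
Definition nMul (a b : nexp) : nexp := fun d => tMul (a d) (b d).

Definition xEq (a b : nexp) : fexp := fun d _ => fEq (a d) (b d).
Definition xLt (a b : nexp) : fexp := fun d _ => fLt (a d) (b d).
Definition xIn (a : nexp) (X : sexp) : fexp := fun d e => fIn (a d) (X e).
Definition xNot (A : fexp) : fexp := fun d e => fNot (A d e).
Definition xImp (A B : fexp) : fexp := fun d e => fImp (A d e) (B d e).
Definition xAnd (A B : fexp) : fexp := fun d e => fAnd (A d e) (B d e).
Definition xOr (A B : fexp) : fexp := fun d e => fOr (A d e) (B d e).
Definition xIff (A B : fexp) : fexp := fun d e => fIff (A d e) (B d e).
Definition allN (F : nexp -> fexp) : fexp :=
  fun d e => fAllN (F (fun d' => tVar (d' - S d)) (S d) e).
Definition exN (F : nexp -> fexp) : fexp :=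
  fun d e => fExN (F (fun d' => tVar (d' - S d)) (S d) e).
Definition allS (F : sexp -> fexp) : fexp :=
  fun d e => fAllS (F (fun e' => e' - S e) d (S e)).
Definition exS (F : sexp -> fexp) : fexp :=
  fun d e => fExS (F (fun e' => e' - S e) d (S e)).

Declare Scope arith_scope.
Local Open Scope arith_scope.
Local Notation "0" := nZero : arith_scope.
Local Notation "a + b" := (nAdd a b) : arith_scope.
Local Notation "a * b" := (nMul a b) : arith_scope.
Local Notation "a == b" := (xEq a b) (at level 70) : arith_scope.
Local Notation "a < b" := (xLt a b) : arith_scope.
Local Notation "a <= b" := (xOr (xLt a b) (xEq a b)) : arith_scope.
Local Notation "a ∈ X" := (xIn a X) (at level 70) : arith_scope.
Local Notation "~ A" := (xNot A) : arith_scope.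
Local Notation "A /\ B" := (xAnd A B) : arith_scope.
Local Notation "A \/ B" := (xOr A B) : arith_scope.
Local Notation "A ==> B" := (xImp A B) (at level 90, right associativity) : arith_scope.
Local Notation "A <==> B" := (xIff A B) (at level 95) : arith_scope.
Local Notation "∀ x .. y , A" := (allN (fun x => .. (allN (fun y => A)) ..))
  (at level 200, x binder, y binder, right associativity) : arith_scope.
Local Notation "∃ x .. y , A" := (exN (fun x => .. (exN (fun y => A)) ..))
  (at level 200, x binder, y binder, right associativity) : arith_scope.
Local Notation "∀2 X .. Y , A" := (allS (fun X => .. (allS (fun Y => A)) ..))
  (at level 200, X binder, Y binder, right associativity) : arith_scope.
Local Notation "∃2 X .. Y , A" := (exS (fun X => .. (exS (fun Y => A)) ..))
  (at level 200, X binder, Y binder, right associativity) : arith_scope.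

(* The pairing function (i, j) |-> (i + j)^2 + i; it is injective. *)
Definition npair (i j : nexp) : nexp := (i + j) * (i + j) + i.

(* F is (the graph of) a function from N to { k | P k }. *)
Definition is_function (F : sexp) (P : nexp -> fexp) : fexp :=
  (∀ m, m ∈ F ==> ∃ i k, P k /\ m == npair i k) /\
  (∀ i, ∃ k, npair i k ∈ F /\ ∀ l, npair i l ∈ F ==> l == k).

(** * Rational numbers *)

(* A fraction (p, m, d) with d > 0 denotes the rational (p - m) / d.  A rational
   number is identified with the representing fraction of least code, so
   that every rational has exactly one code. *)
Record frac : Type := Frac { fpos : nexp; fneg : nexp; fden : nexp }.

Definition code (x : frac) : nexp := npair (npair (fpos x) (fneg x)) (fden x).

Definition qzero : frac := Frac nZero nZero nOne.
Definition qopp (x : frac) : frac := Frac (fneg x) (fpos x) (fden x).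
Definition qadd (x y : frac) : frac :=
  Frac (fpos x * fden y + fpos y * fden x)
       (fneg x * fden y + fneg y * fden x)
       (fden x * fden y).
Definition qsub (x y : frac) : frac := qadd x (qopp y).

Definition qeq (x y : frac) : fexp :=
  fpos x * fden y + fneg y * fden x == fpos y * fden x + fneg x * fden y.
Definition qlt (x y : frac) : fexp :=
  fpos x * fden y + fneg y * fden x < fpos y * fden x + fneg x * fden y.
Definition qle (x y : frac) : fexp := qlt x y \/ qeq x y.

(* y = |x| *)
Definition qabs (x y : frac) : fexp :=
  (qle qzero x /\ qeq y x) \/ (qlt x qzero /\ qeq y (qopp x)).

Definition canonical (x : frac) : fexp :=
  0 < fden x /\
  ∀ p m d, 0 < d /\ qeq (Frac p m d) x ==> code x <= code (Frac p m d).

Definition allQ (F : frac -> fexp) : fexp :=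
  ∀ p m d, canonical (Frac p m d) ==> F (Frac p m d).
Definition exQ (F : frac -> fexp) : fexp :=
  ∃ p m d, canonical (Frac p m d) /\ F (Frac p m d).

Local Notation "∀q x .. y , A" := (allQ (fun x => .. (allQ (fun y => A)) ..))
  (at level 200, x binder, y binder, right associativity) : arith_scope.
Local Notation "∃q x .. y , A" := (exQ (fun x => .. (exQ (fun y => A)) ..))
  (at level 200, x binder, y binder, right associativity) : arith_scope.

(** * Real numbers *)

Definition is_real (X : sexp) : fexp :=
  is_function X (fun k => ∃q x, k == code x) /\
  (∀q e, qlt qzero e ==>
     ∃ N, ∀ m n, N <= m /\ N <= n ==>
       ∀q x y, npair m (code x) ∈ X /\ npair n (code y) ∈ X ==>
         ∃q z, qabs (qsub x y) z /\ qlt z e).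

(* Besides set variables, sequences of rationals such as |a - x| occur; they are
   given by their graphs: [x n p] says that the n-th entry of x is p. *)
Definition qseq : Type := nexp -> frac -> fexp.

Definition seq_of (X : sexp) : qseq := fun n p => npair n (code p) ∈ X.
Definition seq_const (a : frac) : qseq := fun _ p => qeq p a.
Definition seq_sub (x y : qseq) : qseq :=
  fun n p => ∃q u v, x n u /\ y n v /\ qeq p (qsub u v).
Definition seq_abs (x : qseq) : qseq := fun n p => ∃q u, x n u /\ qabs u p.

Definition real_le (x y : qseq) : fexp :=
  ∀q e, qlt qzero e ==>
    ∃ N, ∀ n, N <= n ==>
      ∀q p q, x n p /\ y n q ==> qle p (qadd q e).
Definition real_eq (x y : qseq) : fexp := real_le x y /\ real_le y x.
Definition real_lt (x y : qseq) : fexp := real_le x y /\ ~ real_eq x y.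

(* x lies in the ball of radius r around a *)
Definition in_ball (x : qseq) (a r : frac) : fexp :=
  real_lt (seq_abs (seq_sub (seq_const a) x)) (seq_const r).

(** * Open sets and the two principles *)

Definition triple (n : nexp) (a r : frac) : nexp := npair n (npair (code a) (code r)).

Definition is_open_code (U : sexp) : fexp :=
  ∀ m, m ∈ U ==> ∃ n, ∃q a r, qlt qzero r /\ m == triple n a r.

Definition in_open (X U : sexp) : fexp :=
  ∃ N, ∃q a r, qlt qzero r /\ in_ball (seq_of X) a r /\
    ∀ n, N <= n ==> triple n a r ∈ U.

Definition nonempty (U : sexp) : fexp := ∃2 X, is_real X /\ in_open X U.

Definition reals_connected : fexp :=
  ~ ∃2 U0 U1,
      is_open_code U0 /\ is_open_code U1 /\ nonempty U0 /\ nonempty U1 /\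
      (∀2 X, is_real X ==> in_open X U0 \/ in_open X U1) /\
      ~ ∃2 X, is_real X /\ in_open X U0 /\ in_open X U1.

Definition IPP : fexp :=
  ∀ N, ∀2 C, is_function C (fun k => k <= N) ==>
    ∃ n, n <= N /\ ∀ m, ∃ i, m < i /\ npair i n ∈ C.

(* Main.v *)
(* By the completeness theorem it suffices to prove the equivalence in every
   (possibly nonstandard) model of RCA_0.

   Assume IPP, and suppose that disjoint open sets U0 and U1 cover the reals, with
   rationals q0 in U0 and q1 in U1.  For every rational, the set containing it can
   be guessed at every stage so that the guess is eventually correct.  At stage s
   bisect [q0, q1] s times following the guesses of that stage.  By IPP the guesses
   for the finitely many points of a grid become constant simultaneously, so the
   left ends of the final intervals form a Cauchy sequence.  Its limit lies in U0
   or U1, but it is arbitrarily close to rationals of both.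

   Conversely, let every colour of c : N -> {0, ..., n} occur only finitely often.
   List the colours by their last occurrence before stage t and read the list as a
   number z_t in base n + 1.  The rationals eventually below z_t and those
   eventually above z_t form disjoint open sets.  They cover the reals since no
   number m is a limit of z_t: the true last occurrences fix the leading digits of
   z_t at a proper cut of the n + 1 positions, all colours occur among these digits,
   and if m agreed with them, overspill would make its next digit equal to an
   earlier one, although these are distinct. *)

From HB Require Import structures.
From Stdlib Require List.
From mathcomp Require Import all_boot all_order all_algebra.
From mathcomp Require Import boolp.
From mathcomp Require Import ring lra.
Require Import Defs.

Set Implicit Arguments.
Unset Strict Implicit.
Unset Printing Implicit Defensive.

(** * Henkin semantics and completeness *)

Arguments d_impI {T Gamma A B}.
Arguments d_impE {T Gamma A B}.
Arguments d_raa {T Gamma A}.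
Arguments d_allNE {T Gamma A} t.
Arguments d_allSE {T Gamma A} X.
Arguments d_eqE {T Gamma A s t}.

(** A model of [RCA0] offers only Sigma_1 induction and Delta_1 comprehension, so each induction
    formula and each sequence has to be of low complexity. Membership of a rational in an open set
    is Sigma_2 and cannot steer a bisection; a guess at a fixed stage is decidable and can. The
    limit is therefore the diagonal, whose entry at [t] is the [t]-th left end at stage [t]. For a
    single rational the guesses settle without [IPP]; a common stage for a nonstandard number of
    grid points is a collection principle that Sigma_1 induction does not give, and this is the only
    use of [IPP]. In the converse, a failure of [IPP] needs a nonstandard number of colours. Being a
    last occurrence is Pi_1, so final positions cannot be counted by recursion. What is known about
    them is moved to the digits of one fixed number, where it becomes Delta_1 and a maximum exists.
    As the [z_t] are integers that avoid every limit, they eventually keep distance one from any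
    given rational, which leaves room for balls of radius one. *)

Record structure := Structure {
  dom : Type;
  sets : Type;
  szero : dom;
  sone : dom;
  sadd : dom -> dom -> dom;
  smul : dom -> dom -> dom;
  slt : dom -> dom -> Prop;
  sin : dom -> sets -> Prop }.

Fixpoint eval (M : structure) (rho : nat -> dom M) (t : term) : dom M :=
  match t with
  | tVar i => rho i
  | tZero => szero M
  | tOne => sone M
  | tAdd a b => sadd (eval rho a) (eval rho b)
  | tMul a b => smul (eval rho a) (eval rho b)
  end.

Fixpoint sat (M : structure) (rho : nat -> dom M) (sig : nat -> sets M)
    (A : form) : Prop :=
  match A with
  | fBot => False
  | fEq a b => eval rho a = eval rho b
  | fLt a b => slt (eval rho a) (eval rho b)
  | fIn a X => sin (eval rho a) (sig X)
  | fImp B C => sat rho sig B -> sat rho sig C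
  | fAllN B => forall x, sat (scons x rho) sig B
  | fAllS B => forall X, sat rho (scons X sig) B
  end.

Definition models (M : structure) (T : form -> Prop) :=
  forall A, T A -> forall (rho : nat -> dom M) sig, sat rho sig A.

(** * Substitution, renaming and derivability *)

Definition up (s : nat -> term) : nat -> term :=
  scons (tVar 0) (fun i => tshift (s i)).

Definition upr (r : nat -> nat) : nat -> nat := scons 0 (fun i => S (r i)).

Lemma tsubst_comp s s' t :
  tsubst s (tsubst s' t) = tsubst (fun i => tsubst s (s' i)) t.
Proof. by elim: t => //= a -> b ->. Qed.

Lemma tsubst_id t : tsubst tVar t = t.
Proof. by elim: t => //= a -> b ->. Qed.

Lemma up_comp s s' :
  (fun i => tsubst (up s) (up s' i)) = up (fun i => tsubst s (s' i)).
Proof.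
by apply: funext => -[|i] //=; rewrite /tshift !tsubst_comp; congr tsubst.
Qed.

Lemma up_id : up tVar = tVar.
Proof. by apply: funext => -[]. Qed.

Lemma nsubst_comp s s' A :
  nsubst s (nsubst s' A) = nsubst (fun i => tsubst s (s' i)) A.
Proof.
elim: A s s' => //= [a b|a b|a X|A IHA B IHB|A IH|A IH] s s';
  rewrite ?tsubst_comp ?IHA ?IHB ?IH //.
by rewrite -/(up s) -/(up s') up_comp.
Qed.

Lemma nsubst_id A : nsubst tVar A = A.
Proof.
by elim: A => //= [a b|a b|a X|A -> B ->|A IH|A ->] //;
  rewrite ?tsubst_id // -/(up _) up_id IH.
Qed.

Lemma srename_comp r r' A :
  srename r (srename r' A) = srename (fun i => r (r' i)) A.
Proof.
elim: A r r' => //= [A IHA B IHB|A IH|A IH] r r'; rewrite ?IHA ?IHB ?IH //.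
by congr (fAllS (srename _ _)); apply: funext => -[].
Qed.

Lemma srename_id A : srename (fun i => i) A = A.
Proof.
elim: A => //= [A -> B ->|A ->|A IH] //; rewrite -{2}IH.
by congr (fAllS (srename _ _)); apply: funext => -[].
Qed.

Lemma nsubst_srename s r A : nsubst s (srename r A) = srename r (nsubst s A).
Proof. by elim: A s r => //= [A IHA B IHB|A IH|A IH] s r; rewrite ?IHA ?IHB ?IH. Qed.

Section Derivations.
Variable T : form -> Prop.

Lemma weaken Gamma Gamma' A :
  derives T Gamma A -> List.incl Gamma Gamma' -> derives T Gamma' A.
Proof.
move=> d; elim: d Gamma' => {Gamma A}.
- by move=> Gamma A TA *; apply: d_ax.
- by move=> Gamma A inA G' sub; apply: d_hyp; apply: sub.
- move=> Gamma A B _ IH G' sub; apply: d_impI; apply: IH => C /= [->|]; first by left.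
  by move/sub; right.
- by move=> Gamma A B _ IH1 _ IH2 G' sub; apply: d_impE (IH1 _ sub) (IH2 _ sub).
- move=> Gamma A _ IH G' sub; apply: d_raa; apply: IH => C /= [->|]; first by left.
  by move/sub; right.
- by move=> Gamma A _ IH G' sub; apply: d_allNI; apply: IH; apply: List.incl_map.
- by move=> Gamma A t _ IH G' sub; apply: d_allNE; apply: IH.
- by move=> Gamma A _ IH G' sub; apply: d_allSI; apply: IH; apply: List.incl_map.
- by move=> Gamma A t _ IH G' sub; apply: d_allSE; apply: IH.
- by move=> *; apply: d_eqI.
- by move=> Gamma A s t _ IH1 _ IH2 G' sub; apply: d_eqE (IH1 _ sub) (IH2 _ sub).
Qed.

(** Expresses through the action of substitutions that the free number variables of [A] lie below
    [k], so that no set of free variables has to be computed. *)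
Definition bndN k A :=
  forall s s', (forall i, i < k -> s i = s' i) -> nsubst s A = nsubst s' A.

Definition bndS k A :=
  forall r r', (forall i, i < k -> r i = r' i) -> srename r A = srename r' A.

Lemma bndN_le k k' A : k <= k' -> bndN k A -> bndN k' A.
Proof. by move=> le b s s' h; apply: b => i lti; apply: h; apply: leq_trans le. Qed.

Lemma bndS_le k k' A : k <= k' -> bndS k A -> bndS k' A.
Proof. by move=> le b s s' h; apply: b => i lti; apply: h; apply: leq_trans le. Qed.

Lemma bnd_term t :
  exists k, forall s s', (forall i, i < k -> s i = s' i) -> tsubst s t = tsubst s' t.
Proof.
elim: t => [i|||a [k ha] b [l hb]|a [k ha] b [l hb]]; try by exists 0.
- by exists i.+1 => s s' h /=; apply: h.
- exists (maxn k l) => s s' h /=; congr tAdd; [apply: ha|apply: hb] => i lti;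
    by apply: h; rewrite leq_max lti ?orbT.
- exists (maxn k l) => s s' h /=; congr tMul; [apply: ha|apply: hb] => i lti;
    by apply: h; rewrite leq_max lti ?orbT.
Qed.

Lemma bnd_form A : exists k, bndN k A /\ bndS k A.
Proof.
elim: A => [|a b|a b|a X|A [k [nA sA]] B [l [nB sB]]|A [k [nA sA]]|A [k [nA sA]]].
- by exists 0.
- have [k ha] := bnd_term a; have [l hb] := bnd_term b.
  exists (maxn k l); split=> // s s' h /=; congr fEq; [apply: ha|apply: hb] => i lti;
    by apply: h; rewrite leq_max lti ?orbT.
- have [k ha] := bnd_term a; have [l hb] := bnd_term b.
  exists (maxn k l); split=> // s s' h /=; congr fLt; [apply: ha|apply: hb] => i lti;
    by apply: h; rewrite leq_max lti ?orbT.
- have [k ha] := bnd_term a; exists (maxn k X.+1); split=> s s' h /=; congr fIn.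
    by apply: ha => i lti; apply: h; rewrite leq_max lti.
  by apply: h; rewrite leq_max leqnn orbT.
- exists (maxn k l); split=> s s' h /=; congr fImp;
    [apply: nA|apply: nB|apply: sA|apply: sB] => i lti;
    by apply: h; rewrite leq_max lti ?orbT.
- exists k; split=> s s' h /=; congr fAllN; last exact: sA.
  by apply: nA => -[|i] //= lti; rewrite h // ltnW.
- exists k; split=> s s' h /=; congr fAllS; first exact: nA.
  by apply: sA => -[|i] //= lti; rewrite h // ltnW.
Qed.

Lemma bnd_list (L : list form) :
  exists k, forall A, List.In A L -> bndN k A /\ bndS k A.
Proof.
elim: L => [|B L [k hk]]; first by exists 0.
have [l [nB sB]] := bnd_form B; exists (maxn k l) => A /= [<-|inA].
  by split; [apply: bndN_le nB|apply: bndS_le sB]; apply: leq_maxr.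
have [nA sA] := hk A inA.
by split; [apply: bndN_le nA|apply: bndS_le sA]; apply: leq_maxl.
Qed.

Lemma provable_allN k A : derives T nil A -> derives T nil (iter k fAllN A).
Proof. by move=> d; elim: k => //= k IH; apply: d_allNI. Qed.

Lemma provable_allS k A : derives T nil A -> derives T nil (iter k fAllS A).
Proof. by move=> d; elim: k => //= k IH; apply: d_allSI. Qed.

Lemma inst_allN k A s :
  derives T nil (iter k fAllN A) -> (forall i, s (k + i) = tVar i) ->
  derives T nil (nsubst s A).
Proof.
elim: k A s => [|k IH] A s.
  by move=> d hs; rewrite (_ : s = tVar) ?nsubst_id //; apply: funext.
rewrite iterSr => d hs.
have {IH d} /(d_allNE (s 0)) := IH _ (fun i => s i.+1) d hs.
rewrite /ninst nsubst_comp; congr (derives T nil (nsubst _ A)).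
apply: funext => -[|i] //=.
by rewrite /tshift tsubst_comp /= tsubst_id.
Qed.

Lemma inst_allS k A r :
  derives T nil (iter k fAllS A) -> (forall i, r (k + i) = i) ->
  derives T nil (srename r A).
Proof.
elim: k A r => [|k IH] A r.
  by move=> d hr; rewrite (_ : r = (fun i => i)) ?srename_id //; apply: funext.
rewrite iterSr => d hr.
have {IH d} /(d_allSE (r 0)) := IH _ (fun i => r i.+1) d hr.
rewrite /sinst srename_comp; congr (derives T nil (srename _ A)).
by apply: funext => -[|i].
Qed.

(** The axioms in [T] may have free variables and need not be closed under substitution. Hence the
    finitely many variables below [k] are generalized and then instantiated; truncating [s] at [k]
    makes it a [k]-fold instantiation. *)
Lemma provable_nsubst s A : derives T nil A -> derives T nil (nsubst s A).
Proof.
move=> d; have [k [bA _]] := bnd_form A.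
rewrite (bA _ (fun i => if i < k then s i else tVar (i - k))).
  apply: (@inst_allN k); first exact: provable_allN.
  by move=> i; rewrite ltnNge leq_addr /= addKn.
by move=> i ->.
Qed.

Lemma provable_srename r A : derives T nil A -> derives T nil (srename r A).
Proof.
move=> d; have [k [_ bA]] := bnd_form A.
rewrite (bA _ (fun i => if i < k then r i else i - k)).
  apply: (@inst_allS k); first exact: provable_allS.
  by move=> i; rewrite ltnNge leq_addr /= addKn.
by move=> i ->.
Qed.

Lemma derives_nsubst Gamma A s :
  derives T Gamma A -> derives T (List.map (nsubst s) Gamma) (nsubst s A).
Proof.
move=> d; elim: d s => {Gamma A}.
- move=> Gamma A TA s; apply: (@weaken nil); last by move=> ? [].
  by apply: provable_nsubst; apply: d_ax.
- by move=> Gamma A inA s; apply: d_hyp; apply: List.in_map.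
- by move=> Gamma A B _ IH s; apply: d_impI; apply: IH.
- by move=> Gamma A B _ IH1 _ IH2 s; apply: d_impE (IH1 s) (IH2 s).
- by move=> Gamma A _ IH s; apply: d_raa; apply: IH.
- move=> Gamma A _ IH s; apply: d_allNI; move: (IH (up s)).
  rewrite !List.map_map; congr (derives T (List.map _ _)).
  by apply: funext => B; rewrite /nshift !nsubst_comp.
- move=> Gamma A t _ IH s; have /= /(d_allNE (tsubst s t)) := IH s.
  congr (derives T _); rewrite /ninst !nsubst_comp; congr nsubst.
  by apply: funext => -[|i] //=; rewrite /tshift tsubst_comp /= tsubst_id.
- move=> Gamma A _ IH s; apply: d_allSI; move: (IH s).
  rewrite !List.map_map; congr (derives T (List.map _ _)).
  by apply: funext => B; rewrite /sshift nsubst_srename.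
- move=> Gamma A X _ IH s; have /= /(d_allSE X) := IH s.
  by rewrite /sinst nsubst_srename.
- by move=> *; apply: d_eqI.
- move=> Gamma A t u _ IH1 _ IH2 s.
  have eq v : nsubst s (ninst v A) = ninst (tsubst s v) (nsubst (up s) A).
    rewrite /ninst !nsubst_comp; congr nsubst.
    by apply: funext => -[|i] //=; rewrite /tshift tsubst_comp /= tsubst_id.
  by rewrite eq; apply: d_eqE (IH1 s) _; rewrite -eq; apply: IH2.
Qed.

Lemma derives_srename Gamma A r :
  derives T Gamma A -> derives T (List.map (srename r) Gamma) (srename r A).
Proof.
move=> d; elim: d r => {Gamma A}.
- move=> Gamma A TA r; apply: (@weaken nil); last by move=> ? [].
  by apply: provable_srename; apply: d_ax.
- by move=> Gamma A inA r; apply: d_hyp; apply: List.in_map.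
- by move=> Gamma A B _ IH r; apply: d_impI; apply: IH.
- by move=> Gamma A B _ IH1 _ IH2 r; apply: d_impE (IH1 r) (IH2 r).
- by move=> Gamma A _ IH r; apply: d_raa; apply: IH.
- move=> Gamma A _ IH r; apply: d_allNI; move: (IH r).
  rewrite !List.map_map; congr (derives T (List.map _ _)).
  by apply: funext => B; rewrite /nshift nsubst_srename.
- move=> Gamma A t _ IH r; have /= /(d_allNE t) := IH r.
  by rewrite /ninst nsubst_srename.
- move=> Gamma A _ IH r; apply: d_allSI; move: (IH (upr r)).
  rewrite !List.map_map; congr (derives T (List.map _ _)).
  by apply: funext => B; rewrite /sshift !srename_comp.
- move=> Gamma A X _ IH r; have /= /(d_allSE (r X)) := IH r.
  congr (derives T _); rewrite /sinst !srename_comp; congr srename.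
  by apply: funext => -[|i].
- by move=> *; apply: d_eqI.
- move=> Gamma A t u _ IH1 _ IH2 r; rewrite /ninst -nsubst_srename.
  by apply: d_eqE (IH1 r) _; rewrite /ninst nsubst_srename; apply: IH2.
Qed.

(** The substitution sending [k] to [0] and any other [i] to [i + 1] acts on [Gamma] as [nshift],
    since [k] does not occur there, and it turns the instance at [k] back into the body below a
    binder. *)
Lemma generalizeN k Gamma B :
  (forall A, List.In A Gamma -> bndN k A) -> bndN k B ->
  derives T Gamma (ninst (tVar k) B) -> derives T Gamma (fAllN B).
Proof.
move=> bG /(bndN_le (leqnSn k)) bB d; apply: d_allNI.
have := derives_nsubst (fun i => if i == k then tVar 0 else tVar i.+1) d.
rewrite (_ : List.map _ _ = List.map nshift Gamma); last first.
  apply: List.map_ext_in => A /bG bA; apply: bA => i lti.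
  by rewrite (ltn_eqF lti).
congr (derives T _); rewrite /ninst nsubst_comp -[RHS]nsubst_id; apply: bB.
by case=> [|i] /=; rewrite ?eqxx // ltnS => lti; rewrite (ltn_eqF lti).
Qed.

Lemma generalizeS k Gamma B :
  (forall A, List.In A Gamma -> bndS k A) -> bndS k B ->
  derives T Gamma (sinst k B) -> derives T Gamma (fAllS B).
Proof.
move=> bG /(bndS_le (leqnSn k)) bB d; apply: d_allSI.
have := derives_srename (fun i => if i == k then 0 else i.+1) d.
rewrite (_ : List.map _ _ = List.map sshift Gamma); last first.
  apply: List.map_ext_in => A /bG bA; apply: bA => i lti.
  by rewrite (ltn_eqF lti).
congr (derives T _); rewrite /sinst srename_comp -[RHS]srename_id; apply: bB.
by case=> [|i] /=; rewrite ?eqxx // ltnS => lti; rewrite (ltn_eqF lti).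
Qed.

Lemma cut Gamma A B : derives T (A :: Gamma) B -> derives T Gamma A -> derives T Gamma B.
Proof. by move=> d1 d2; apply: d_impE d2; apply: d_impI. Qed.

End Derivations.

(** * Enumeration of the formulas *)

Fixpoint code_term (t : term) : GenTree.tree nat :=
  match t with
  | tVar i => GenTree.Leaf i
  | tZero => GenTree.Node 0 [::]
  | tOne => GenTree.Node 1 [::]
  | tAdd a b => GenTree.Node 2 [:: code_term a; code_term b]
  | tMul a b => GenTree.Node 3 [:: code_term a; code_term b]
  end.

Fixpoint decode_term (t : GenTree.tree nat) : term :=
  match t with
  | GenTree.Leaf i => tVar i
  | GenTree.Node 0 _ => tZero
  | GenTree.Node 2 [:: a; b] => tAdd (decode_term a) (decode_term b)
  | GenTree.Node 3 [:: a; b] => tMul (decode_term a) (decode_term b)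
  | _ => tOne
  end.

Lemma code_termK : cancel code_term decode_term.
Proof. by elim=> //= a -> b ->. Qed.

Fixpoint code_form (A : form) : GenTree.tree nat :=
  match A with
  | fBot => GenTree.Node 0 [::]
  | fEq a b => GenTree.Node 1 [:: code_term a; code_term b]
  | fLt a b => GenTree.Node 2 [:: code_term a; code_term b]
  | fIn a X => GenTree.Node 3 [:: code_term a; GenTree.Leaf X]
  | fImp B C => GenTree.Node 4 [:: code_form B; code_form C]
  | fAllN B => GenTree.Node 5 [:: code_form B]
  | fAllS B => GenTree.Node 6 [:: code_form B]
  end.

Fixpoint decode_form (t : GenTree.tree nat) : form :=
  match t with
  | GenTree.Node 1 [:: a; b] => fEq (decode_term a) (decode_term b)
  | GenTree.Node 2 [:: a; b] => fLt (decode_term a) (decode_term b)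
  | GenTree.Node 3 [:: a; GenTree.Leaf X] => fIn (decode_term a) X
  | GenTree.Node 4 [:: a; b] => fImp (decode_form a) (decode_form b)
  | GenTree.Node 5 [:: a] => fAllN (decode_form a)
  | GenTree.Node 6 [:: a] => fAllS (decode_form a)
  | _ => fBot
  end.

Lemma code_formK : cancel code_form decode_form.
Proof. by elim=> //= *; rewrite ?code_termK //; congruence. Qed.

Definition form_enum (n : nat) : form :=
  if unpickle n is Some t then decode_form t else fBot.

Lemma form_enum_surj A : exists n, form_enum n = A.
Proof. by exists (pickle (code_form A)); rewrite /form_enum pickleK code_formK. Qed.

(** * Maximal consistent set and term model *)

Section Henkin.
Variables (T : form -> Prop) (Gamma0 : list form).
Hypothesis consistent0 : ~ derives T Gamma0 fBot.

Definition fresh (L : list form) : nat := sval (cid (bnd_list L)).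

Lemma freshP L A : List.In A L -> bndN (fresh L) A /\ bndS (fresh L) A.
Proof. exact: (svalP (cid (bnd_list L))). Qed.

(* A universal formula that cannot be added gets a fresh variable as a
   counterexample. *)
Definition henkin_step (Gamma : list form) (A : form) : list form :=
  if `[< ~ derives T (A :: Gamma) fBot >] then A :: Gamma else
  match A with
  | fAllN B => fNot (ninst (tVar (fresh (B :: Gamma))) B) :: Gamma
  | fAllS B => fNot (sinst (fresh (B :: Gamma)) B) :: Gamma
  | _ => Gamma
  end.

Fixpoint henkin (n : nat) : list form :=
  if n is m.+1 then henkin_step (henkin m) (form_enum m) else Gamma0.

Definition Delta A := exists n, List.In A (henkin n).

Lemma henkin_step_sub Gamma A : List.incl Gamma (henkin_step Gamma A).
Proof.
rewrite /henkin_step; case: ifP => _; first exact/List.incl_tl/List.incl_refl.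
case: A => *; by [exact: List.incl_refl|exact/List.incl_tl/List.incl_refl].
Qed.

Lemma henkin_mono n m : n <= m -> List.incl (henkin n) (henkin m).
Proof.
move/subnK <-; elim: (m - n) => [|k IH]; first exact: List.incl_refl.
exact: List.incl_tran IH (@henkin_step_sub _ _).
Qed.

(** If a refused universal formula had an inconsistent negated fresh instance, that instance would
    be derivable, hence by generalization the formula itself; a cut would then make the previous
    stage inconsistent. *)
Lemma henkin_consistent n : ~ derives T (henkin n) fBot.
Proof.
elim: n => //= n IH; rewrite /henkin_step; case: asboolP => // /contrapT incons.
case: (form_enum n) incons => // B incons.
- move/d_raa => d; apply: IH; apply: cut incons _.
  apply: (generalizeN (k := fresh (B :: henkin n))) d => [A inA|].
    by have [] := @freshP (B :: henkin n) A (or_intror inA).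
  by have [] := @freshP (B :: henkin n) B (or_introl erefl).
- move/d_raa => d; apply: IH; apply: cut incons _.
  apply: (generalizeS (k := fresh (B :: henkin n))) d => [A inA|].
    by have [] := @freshP (B :: henkin n) A (or_intror inA).
  by have [] := @freshP (B :: henkin n) B (or_introl erefl).
Qed.

Lemma Delta_list (L : list form) : (forall A, List.In A L -> Delta A) ->
  exists n, List.incl L (henkin n).
Proof.
elim: L => [|A L IH] h; first by exists 0 => ? [].
have [n hn] := IH (fun B inB => h B (or_intror inB)).
have [m hm] := h A (or_introl erefl).
exists (maxn n m) => B /= [<-|inB].
  by apply: henkin_mono hm; apply: leq_maxr.
by apply: (henkin_mono (leq_maxl n m)); apply: hn.
Qed.

Lemma Delta_derives L A : (forall B, List.In B L -> Delta B) -> derives T L A -> Delta A.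
Proof.
move=> /Delta_list [n hn] d; have [m hm] := form_enum_surj A.
case: (pselect (derives T (A :: henkin m) fBot)) => [incons|cons]; last first.
  by exists m.+1; rewrite /= /henkin_step hm; case: asboolP => // _; left.
exfalso; apply: (@henkin_consistent (maxn n m)).
apply: (@cut _ _ A).
  apply: weaken incons _ => B /= [<-|inB]; first by left.
  by right; apply: henkin_mono inB; apply: leq_maxr.
by apply: weaken d _ => B /hn; apply: henkin_mono; apply: leq_maxl.
Qed.

Lemma Delta_bot : ~ Delta fBot.
Proof. by move=> [n inn]; apply: (@henkin_consistent n); apply: d_hyp. Qed.

Lemma Delta_not A : ~ Delta A -> Delta (fNot A).
Proof.
move=> nA; have [m hm] := form_enum_surj A.
have incons : derives T (A :: henkin m) fBot.
  apply: contrapT => cons; apply: nA; exists m.+1.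
  by rewrite /= /henkin_step hm; case: asboolP => // _; left.
by apply: (Delta_derives (L := henkin m)) (d_impI incons) => B inB; exists m.
Qed.

Lemma Delta_hyp2 A B C : Delta A -> Delta B -> derives T [:: A; B] C -> Delta C.
Proof. by move=> DA DB; apply: Delta_derives => D /= [<-|[<-|[]]]. Qed.

Lemma Delta_hyp1 A C : Delta A -> derives T [:: A] C -> Delta C.
Proof. by move=> DA; apply: Delta_derives => D /= [<-|[]]. Qed.

Lemma Delta_thm C : derives T [::] C -> Delta C.
Proof. exact: Delta_derives. Qed.

Lemma Delta_imp A B : Delta (fImp A B) <-> (Delta A -> Delta B).
Proof.
split=> [DAB DA|h].
  by apply: (Delta_hyp2 DAB DA); apply: (@d_impE _ _ A _); apply: d_hyp; rewrite /=; tauto.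
case: (pselect (Delta A)) => [/h DB|/Delta_not DnA].
  by apply: (Delta_hyp1 DB); apply: d_impI; apply: d_hyp; rewrite /=; tauto.
apply: (Delta_hyp1 DnA); apply: d_impI; apply: d_raa.
by apply: (@d_impE _ _ A _); apply: d_hyp; rewrite /=; tauto.
Qed.

Lemma Delta_contra A : Delta A -> Delta (fNot A) -> False.
Proof. by move=> DA /Delta_imp /(_ DA) /Delta_bot. Qed.

(** From right to left: had the universal formula been refused at its turn, the negation of one of
    its instances would have entered instead. *)
Lemma Delta_allN B : Delta (fAllN B) <-> forall t, Delta (ninst t B).
Proof.
split=> [D t|h].
  by apply: (Delta_hyp1 D); apply: d_allNE; apply: d_hyp; left.
have [m hm] := form_enum_surj (fAllN B); exists m.+1.
rewrite /= /henkin_step hm; case: asboolP => [_|incons]; first by left.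
exfalso; apply: (Delta_contra (h (tVar (fresh (B :: henkin m))))).
by exists m.+1; rewrite /= /henkin_step hm; case: asboolP => // _; left.
Qed.

Lemma Delta_allS B : Delta (fAllS B) <-> forall X, Delta (sinst X B).
Proof.
split=> [D X|h].
  by apply: (Delta_hyp1 D); apply: d_allSE; apply: d_hyp; left.
have [m hm] := form_enum_surj (fAllS B); exists m.+1.
rewrite /= /henkin_step hm; case: asboolP => [_|incons]; first by left.
exfalso; apply: (Delta_contra (h (fresh (B :: henkin m)))).
by exists m.+1; rewrite /= /henkin_step hm; case: asboolP => // _; left.
Qed.

Lemma Delta_refl t : Delta (fEq t t).
Proof. by apply: Delta_thm; apply: d_eqI. Qed.

Lemma Delta_subst A t u : Delta (fEq t u) -> Delta (ninst t A) -> Delta (ninst u A).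
Proof.
move=> D1 D2; apply: (Delta_hyp2 D1 D2).
by apply: (@d_eqE _ _ A t); apply: d_hyp; rewrite /=; tauto.
Qed.

Lemma tinst_shift v t : tsubst (scons v tVar) (tshift t) = t.
Proof. by rewrite /tshift tsubst_comp /= tsubst_id. Qed.

Lemma Delta_sym t u : Delta (fEq t u) -> Delta (fEq u t).
Proof.
move=> D; have := @Delta_subst (fEq (tVar 0) (tshift t)) t u D.
by rewrite /ninst /= !tinst_shift; apply; apply: Delta_refl.
Qed.

Lemma Delta_trans t u v : Delta (fEq t u) -> Delta (fEq u v) -> Delta (fEq t v).
Proof.
move=> D1 D2; have := @Delta_subst (fEq (tshift t) (tVar 0)) u v D2.
by rewrite /ninst /= !tinst_shift; apply.
Qed.

Lemma Delta_cong (f : term -> term -> term) :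
  (forall s a b, tsubst s (f a b) = f (tsubst s a) (tsubst s b)) ->
  forall a a' b b', Delta (fEq a a') -> Delta (fEq b b') -> Delta (fEq (f a b) (f a' b')).
Proof.
move=> hf a a' b b' Da Db; apply: (@Delta_trans _ (f a' b)).
  have := @Delta_subst (fEq (tshift (f a b)) (f (tVar 0) (tshift b))) a a' Da.
  by rewrite /ninst /= !tinst_shift !hf /= !tinst_shift; apply; apply: Delta_refl.
have := @Delta_subst (fEq (tshift (f a' b)) (f (tshift a') (tVar 0))) b b' Db.
by rewrite /ninst /= !tinst_shift !hf /= !tinst_shift; apply; apply: Delta_refl.
Qed.

Lemma Delta_lt a a' b b' :
  Delta (fEq a a') -> Delta (fEq b b') -> Delta (fLt a b) -> Delta (fLt a' b').
Proof.
move=> Da Db D.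
have := @Delta_subst (fLt (tVar 0) (tshift b)) a a' Da.
rewrite /ninst /= !tinst_shift => /(_ D) D'.
have := @Delta_subst (fLt (tshift a') (tVar 0)) b b' Db.
by rewrite /ninst /= !tinst_shift; apply.
Qed.

Lemma Delta_in a a' X : Delta (fEq a a') -> Delta (fIn a X) -> Delta (fIn a' X).
Proof. by move=> Da; apply: (@Delta_subst (fIn (tVar 0) X)). Qed.

(** Since [sat] reads [fEq] as true equality, terms that [Delta] proves equal must be identified.
    Set variables need no quotient, as the language has no equality between sets. *)
Definition tclass := {P : term -> Prop | exists t, P = fun u => Delta (fEq t u)}.

Definition cls (t : term) : tclass := exist _ (fun u => Delta (fEq t u)) (ex_intro _ t erefl).

Definition repr (x : tclass) : term := sval (cid (svalP x)).

Lemma tclass_eq (x y : tclass) : sval x = sval y -> x = y.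
Proof.
case: x y => [P hP] [Q hQ] /= eqPQ; case: Q / eqPQ hQ => hQ.
by rewrite (Prop_irrelevance hP hQ).
Qed.

Lemma reprK x : cls (repr x) = x.
Proof.
apply: tclass_eq; rewrite /repr; case: cid => t /= ht.
by rewrite -ht.
Qed.

Lemma clsE t u : cls t = cls u <-> Delta (fEq t u).
Proof.
split=> [/(congr1 sval) /= /(congr1 (fun P => P u)) ->|D]; first exact: Delta_refl.
apply: tclass_eq; apply: funext => v; apply: propext; split.
  exact/Delta_trans/Delta_sym.
exact: Delta_trans.
Qed.

Lemma repr_cls t : Delta (fEq (repr (cls t)) t).
Proof. by apply/clsE; rewrite reprK. Qed.

Definition term_model : structure := {|
  dom := tclass; sets := nat;
  szero := cls tZero; sone := cls tOne;
  sadd := fun x y => cls (tAdd (repr x) (repr y));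
  smul := fun x y => cls (tMul (repr x) (repr y));
  slt := fun x y => Delta (fLt (repr x) (repr y));
  sin := fun x X => Delta (fIn (repr x) X) |}.

Lemma term_model_eval (s : nat -> term) t :
  eval (M := term_model) (fun i => cls (s i)) t = cls (tsubst s t).
Proof.
elim: t => //= a -> b ->; apply/clsE; apply: Delta_cong => //; exact: repr_cls.
Qed.

Lemma scons_cls t (s : nat -> term) :
  scons (cls t) (fun i => cls (s i)) = (fun i => cls (scons t s i)).
Proof. by apply: funext => -[]. Qed.

(** Arbitrary simultaneous assignments [s] and [r] are allowed so that the quantifier cases merely
    extend them by one value. *)
Lemma truth A (s : nat -> term) (r : nat -> nat) :
  sat (M := term_model) (fun i => cls (s i)) r A <-> Delta (nsubst s (srename r A)).
Proof.
elim: A s r => [|a b|a b|a X|A IHA B IHB|A IH|A IH] s r.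
- by split=> // /Delta_bot.
- by rewrite /= !term_model_eval; apply: clsE.
- rewrite /= !term_model_eval; split; apply: Delta_lt;
    by [exact: repr_cls|exact/Delta_sym/repr_cls].
- rewrite /= !term_model_eval; split; apply: Delta_in;
    by [exact: repr_cls|exact/Delta_sym/repr_cls].
- by rewrite /= IHA IHB Delta_imp.
- have E t : nsubst (scons t s) (srename r A) = ninst t (nsubst (up s) (srename r A)).
    rewrite /ninst nsubst_comp; congr nsubst; apply: funext => -[|i] //=.
    by rewrite tinst_shift.
  rewrite /= Delta_allN; split=> h t; move: (h).
    by move/(_ (cls t)); rewrite /= scons_cls IH E.
  by move/(_ (repr t)); rewrite -E -IH -scons_cls reprK.
- have E X : nsubst s (srename (scons X r) A) = sinst X (nsubst s (srename (upr r) A)).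
    rewrite /sinst -nsubst_srename srename_comp; congr (nsubst _ (srename _ _)).
    by apply: funext => -[|i].
  by rewrite /= Delta_allS; split=> h X; have := h X; rewrite IH E.
Qed.

Lemma term_model_theory : models term_model T.
Proof.
move=> A TA rho sig.
rewrite (_ : rho = (fun i => cls (repr (rho i)))); last first.
  by apply: funext => i; rewrite reprK.
apply/truth; apply: Delta_thm; apply: provable_nsubst; apply: provable_srename.
exact: d_ax.
Qed.

End Henkin.

Theorem completeness T A :
  (forall M : structure, models M T -> forall (rho : nat -> dom M) sig, sat rho sig A) ->
  provable T A.
Proof.
move=> valid; apply: d_raa; apply: contrapT => cons.
have D : Delta T [:: fNot A] (fNot A) by exists 0; left.
(* Each variable is assigned its own class, so the truth lemma applies with the identity
   substitution. *)
have := valid _ (term_model_theory cons) (fun i => cls T [:: fNot A] (tVar i)) (fun i => i).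
move/(truth cons); rewrite srename_id nsubst_id => DA.
exact: (Delta_contra cons DA D).
Qed.
(** * Definable predicates in a model *)

(** The component [rca_set] makes the set sort nonempty; over an empty sort there are no assignments
    and [models] would hold vacuously. *)
Record rca := Rca {
  rca_struct :> structure;
  rcaP : models rca_struct RCA0;
  rca_set : sets rca_struct }.

Definition num (M : rca) : Type := dom M.

Lemma eval_tsubst (M : structure) (rho : nat -> dom M) s t :
  eval rho (tsubst s t) = eval (fun i => eval rho (s i)) t.
Proof. by elim: t => //= a -> b ->. Qed.

Lemma eval_tshift (M : structure) (rho : nat -> dom M) x t :
  eval (scons x rho) (tshift t) = eval rho t.
Proof. by rewrite /tshift eval_tsubst. Qed.

Lemma sat_nsubst (M : structure) A (rho : nat -> dom M) sig s :
  sat rho sig (nsubst s A) = sat (fun i => eval rho (s i)) sig A.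
Proof.
elim: A rho sig s => /= [|a b|a b|a X|A IHA B IHB|A IH|A IH] rho sig s;
  rewrite ?eval_tsubst ?IHA ?IHB //.
- have E x : (fun i => eval (scons x rho) (up s i)) = scons x (fun i => eval rho (s i)).
    by apply: funext => -[|i] //=; rewrite eval_tshift.
  by apply: propext; split=> h x; move: (h x); rewrite IH E.
- by apply: propext; split=> h x; move: (h x); rewrite IH.
Qed.

Lemma sat_srename (M : structure) A (rho : nat -> dom M) sig r :
  sat rho sig (srename r A) = sat rho (fun i => sig (r i)) A.
Proof.
elim: A rho sig r => /= [|a b|a b|a X|A IHA B IHB|A IH|A IH] rho sig r;
  rewrite ?IHA ?IHB //.
- by apply: propext; split=> h x; move: (h x); rewrite IH.
- have E X : (fun i => scons X sig (upr r i)) = scons X (fun i => sig (r i)).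
    by apply: funext => -[|i].
  by apply: propext; split=> h X; move: (h X); rewrite IH E.
Qed.

Lemma bounded_nsubst A s : bounded A -> bounded (nsubst s A).
Proof.
have E s' t : tsubst (up s') (tshift t) = tshift (tsubst s' t).
  by rewrite /tshift !tsubst_comp.
move=> b; elim: b s => {A} /= [|a b|a b|a X|A B _ IHA _ IHB|t A _ IH|t A _ IH] s;
  by rewrite -?/(up s) ?E; constructor.
Qed.

Lemma bounded_srename A r : bounded A -> bounded (srename r A).
Proof.
move=> b; elim: b r => {A} /= [|a b|a b|a X|A B _ IHA _ IHB|t A _ IH|t A _ IH] r;
  by constructor.
Qed.

(** Merges two parameter assignments on even and odd indices, so that formulas with separate
    parameters can be joined into one. *)
Definition interleave T (f g : nat -> T) (i : nat) : T :=
  if odd i then g i./2 else f i./2.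

Lemma interleave_even T (f g : nat -> T) i : interleave f g i.*2 = f i.
Proof. by rewrite /interleave odd_double doubleK. Qed.

Lemma interleave_odd T (f g : nat -> T) i : interleave f g i.*2.+1 = g i.
Proof. by rewrite /interleave /= odd_double uphalf_double. Qed.

Lemma interleave_evenE T (f g : nat -> T) : (fun i => interleave f g i.*2) = f.
Proof. by apply: funext => i; rewrite interleave_even. Qed.

Lemma interleave_oddE T (f g : nat -> T) : (fun i => interleave f g i.*2.+1) = g.
Proof. by apply: funext => i; rewrite interleave_odd. Qed.

Lemma not_forall_not T (P : T -> Prop) : (~ forall x, ~ P x) <-> exists x, P x.
Proof. by rewrite -existsNE; split=> -[x hx]; exists x; [exact: contrapT|move/(_ hx)]. Qed.

Lemma not_imp_not (P Q : Prop) : ~ (P -> ~ Q) <-> P /\ Q.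
Proof. by rewrite not_implyP notE. Qed.

Section Definable.
Variable M : rca.
Local Notation N := (num M).
Local Notation env := (nat -> N).

(* Each free number variable of a formula stands for an environment entry
   ([inl]) or for a parameter from the model ([inr]). *)
Definition val (s : nat -> nat + N) (e : env) (i : nat) : N :=
  match s i with inl j => e j | inr c => c end.

Definition Term (f : env -> N) :=
  exists t s, forall e, f e = eval (M := M) (val s e) t.

(* [D0], [S1], [R1] and [D1] stand for bounded and Sigma_1 predicates, functions
   with Sigma_1 graph and Delta_1 predicates of an environment, with parameters of
   both sorts from the model; [e i] is the i-th argument. *)
Definition D0 (P : env -> Prop) :=
  exists A s (sig : nat -> sets M), bounded A /\ forall e, P e <-> sat (val s e) sig A.

Definition S1 (P : env -> Prop) :=
  exists Q : env -> N -> Prop,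
    D0 (fun e => Q (fun i => e i.+1) (e 0)) /\ forall e, P e <-> exists x, Q e x.

Lemma val_even s1 s2 e : (fun i => val (interleave s1 s2) e i.*2) = val s1 e.
Proof. by apply: funext => i; rewrite /val interleave_even. Qed.

Lemma val_odd s1 s2 e : (fun i => val (interleave s1 s2) e i.*2.+1) = val s2 e.
Proof. by apply: funext => i; rewrite /val interleave_odd. Qed.

Lemma Term_var k : Term (fun e => e k).
Proof. by exists (tVar 0), (fun=> inl k). Qed.

Lemma Term_const c : Term (fun=> c).
Proof. by exists (tVar 0), (fun=> inr c). Qed.

Lemma Term_op (op : term -> term -> term) (sop : N -> N -> N) :
  (forall rho a b, eval (M := M) rho (op a b) = sop (eval rho a) (eval rho b)) ->
  (forall s a b, tsubst s (op a b) = op (tsubst s a) (tsubst s b)) ->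
  forall f g, Term f -> Term g -> Term (fun e => sop (f e) (g e)).
Proof.
move=> hop hsub f g [t [s hf]] [t' [s' hg]].
exists (op (tsubst (fun i => tVar i.*2) t) (tsubst (fun i => tVar i.*2.+1) t')).
exists (interleave s s') => e.
by rewrite hop !eval_tsubst /= val_even val_odd hf hg.
Qed.

Lemma D0_ext P Q : (forall e, P e <-> Q e) -> D0 P -> D0 Q.
Proof.
by move=> h [A [s [sig [b hA]]]]; exists A, s, sig; split=> // e; rewrite -h hA.
Qed.

Lemma D0_rel (R : term -> term -> form) (sR : N -> N -> Prop) :
  (forall rho sig a b, sat (M := M) rho sig (R a b) <-> sR (eval rho a) (eval rho b)) ->
  (forall a b, bounded (R a b)) ->
  forall f g, Term f -> Term g -> D0 (fun e => sR (f e) (g e)).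
Proof.
move=> hR bR f g [t [s hf]] [t' [s' hg]].
exists (R (tsubst (fun i => tVar i.*2) t) (tsubst (fun i => tVar i.*2.+1) t')).
exists (interleave s s'), (fun=> rca_set M); split=> // e.
by rewrite hR !eval_tsubst /= val_even val_odd hf hg.
Qed.

Lemma D0_in f X : Term f -> D0 (fun e => sin (s := M) (f e) X).
Proof.
by move=> [t [s hf]]; exists (fIn t 0), s, (fun=> X); split=> [|e]; [constructor|rewrite hf].
Qed.

Lemma D0_bot : D0 (fun=> False).
Proof. by exists fBot, (fun=> inl 0), (fun=> rca_set M); split=> //; constructor. Qed.

Lemma D0_imp P Q : D0 P -> D0 Q -> D0 (fun e => P e -> Q e).
Proof.
move=> [A [s [sig [bA hP]]]] [B [s' [sig' [bB hQ]]]].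
exists (fImp (nsubst (fun i => tVar i.*2) (srename (fun i => i.*2) A))
             (nsubst (fun i => tVar i.*2.+1) (srename (fun i => i.*2.+1) B))).
exists (interleave s s'), (interleave sig sig'); split=> [|e].
  by constructor; apply: bounded_nsubst; apply: bounded_srename.
by rewrite /= !sat_nsubst /= !sat_srename val_even val_odd hP hQ interleave_evenE
  interleave_oddE.
Qed.

Lemma D0_not P : D0 P -> D0 (fun e => ~ P e).
Proof. by move=> dP; apply: D0_imp dP D0_bot. Qed.

Lemma D0_and P Q : D0 P -> D0 Q -> D0 (fun e => P e /\ Q e).
Proof.
move=> dP dQ; apply: (D0_ext (P := fun e => ~ (P e -> ~ Q e))); last first.
  by apply/D0_not/D0_imp/D0_not.
by move=> e; rewrite not_implyP not_notE.
Qed.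

Lemma D0_or P Q : D0 P -> D0 Q -> D0 (fun e => P e \/ Q e).
Proof.
move=> dP dQ; apply: (D0_ext (P := fun e => ~ P e -> Q e)); last first.
  by apply: D0_imp dQ; apply: D0_not.
by move=> e; split=> [h|[]//]; case: (pselect (P e)) => [|/h]; [left|right].
Qed.

Lemma D0_val (r : nat -> nat + N) P : D0 P -> D0 (fun e => P (val r e)).
Proof.
move=> [A [s [sig [bA hP]]]].
pose s' i := match s i with inl j => r j | inr c => inr c end.
exists A, s', sig; split=> // e; rewrite hP.
suff -> : val s' e = val s (val r e) by [].
by apply: funext => i; rewrite /val /s'; case: (s i).
Qed.

Lemma D0_ren (r : nat -> nat) P : D0 P -> D0 (fun e => P (fun i => e (r i))).
Proof. exact: (@D0_val (fun i => inl (r i))). Qed.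

Lemma D0_ball f (P : env -> N -> Prop) :
  Term f -> D0 (fun e => P (fun i => e i.+1) (e 0)) ->
  D0 (fun e => forall x, slt (s := M) x (f e) -> P e x).
Proof.
move=> [t [s hf]] [A [s' [sig [bA hP]]]].
pose t' := tsubst (fun i => tVar i.*2) t.
(* Only the variables standing for the argument [e 0] become the bound variable; the others sit at
   the odd places of the merged assignment, read through one more binder. *)
pose r i := match s' i with inl 0 => tVar 0 | _ => tVar i.*2.+2 end.
pose s1 i := match s' i with inl 0 => inr (szero M) | inl j.+1 => inl j | inr c => inr c end.
exists (fAllN (fImp (fLt (tVar 0) (tshift t')) (nsubst r A))), (interleave s s1), sig.
split=> [|e]; first by constructor; apply: bounded_nsubst.
have ht x : eval (scons x (val (interleave s s1) e)) (tshift t') = f e.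
  by rewrite eval_tshift eval_tsubst /= val_even -hf.
have hA x : P e x <-> sat (scons x (val (interleave s s1) e)) sig (nsubst r A).
  rewrite sat_nsubst.
  suff -> : (fun i => eval (scons x (val (interleave s s1) e)) (r i)) = val s' (scons x e).
    exact: (hP (scons x e)).
  apply: funext => i; rewrite /val /r /=.
  case E: (s' i) => [[|j]|c] //=; by rewrite interleave_odd /s1 E.
by split=> h x; have := h x; rewrite /= ht hA.
Qed.

Lemma D0_bex f (P : env -> N -> Prop) :
  Term f -> D0 (fun e => P (fun i => e i.+1) (e 0)) ->
  D0 (fun e => exists x, slt (s := M) x (f e) /\ P e x).
Proof.
move=> tf dP.
apply: (D0_ext (P := fun e => ~ forall x, slt (s := M) x (f e) -> ~ P e x)).
  move=> e; rewrite -existsNE; split=> -[x hx]; exists x.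
    by apply: contrapT => n; apply: hx => lx px; apply: n.
  by case: hx => lx px /(_ lx).
by apply/D0_not/(D0_ball tf (P := fun e x => ~ P e x))/D0_not.
Qed.

(* The formula has only its two displayed variables in common with the
   environment; all its other variables are parameters. *)
Lemma D0_two (Q : N -> N -> Prop) :
  D0 (fun e => Q (e 1) (e 0)) ->
  exists A (rho : nat -> N) sig, bounded A /\
    forall x y, Q x y <-> sat (scons y (scons x rho)) sig A.
Proof.
move=> [A [s [sig [bA hQ]]]].
pose r i := match s i with
  inl 0 => tVar 0 | inl 1 => tVar 1 | inl _ => tZero | inr c => tVar i.+2 end.
exists (nsubst r A), (fun i => match s i with inl _ => szero M | inr c => c end), sig.
split=> [|x y]; first exact: bounded_nsubst.
rewrite sat_nsubst.
set rho := fun i => match s i with inl _ => _ | _ => _ end.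
suff -> : (fun i => eval (scons y (scons x rho)) (r i)) =
          val s (scons y (scons x (fun=> szero M))) by exact: (hQ (scons y (scons x _))).
by apply: funext => i; rewrite /val /r; case E: (s i) => [[|[|j]]|c] //=; rewrite /rho E.
Qed.

Lemma S1_two (P : N -> Prop) :
  S1 (fun e => P (e 0)) ->
  exists A (rho : nat -> N) sig, bounded A /\
    forall x, P x <-> exists y, sat (scons y (scons x rho)) sig A.
Proof.
move=> [Q [dQ hP]].
have [|A [rho [sig [bA hA]]]] := @D0_two (fun x y => Q (scons x (fun=> szero M)) y).
  have := D0_val (fun i => if i is i'.+2 then inr (szero M) else inl i) dQ.
  apply: D0_ext => e; rewrite (_ : (fun i => _) = scons (e 1) (fun=> szero M)) //.
  by apply: funext => -[].
exists A, rho, sig; split=> // x; rewrite (hP (scons x (fun=> szero M))).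
by split=> -[y hy]; exists y; apply/hA.
Qed.

Lemma sat_exN (rho : nat -> N) sig A :
  sat (M := M) rho sig (fExN A) <-> exists x, sat (scons x rho) sig A.
Proof. exact: not_forall_not. Qed.

Lemma sat_exS (rho : nat -> N) sig A :
  sat (M := M) rho sig (fExS A) <-> exists X, sat rho (scons X sig) A.
Proof. exact: not_forall_not. Qed.

Lemma sat_and (rho : nat -> N) sig A B :
  sat (M := M) rho sig (fAnd A B) <-> sat rho sig A /\ sat rho sig B.
Proof. exact: not_imp_not. Qed.

Lemma sat_or (rho : nat -> N) sig A B :
  sat (M := M) rho sig (fOr A B) <-> sat rho sig A \/ sat rho sig B.
Proof.
split=> /= [h|[a na|b _] //].
by case: (pselect (sat rho sig A)) => [|/h]; [left|right].
Qed.

Lemma sat_iff (rho : nat -> N) sig A B :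
  sat (M := M) rho sig (fIff A B) <-> (sat rho sig A <-> sat rho sig B).
Proof. exact: sat_and. Qed.

Lemma induction (P : N -> Prop) :
  S1 (fun e => P (e 0)) -> P (szero M) -> (forall x, P x -> P (sadd x (sone M))) ->
  forall x, P x.
Proof.
move=> /S1_two [A [rho [sig [bA hA]]]] P0 PS.
have [B SB hB] : exists2 B, Sigma01 B & forall x, P x <-> sat (scons x rho) sig B.
  by exists (fExN A) => [|x]; [constructor|rewrite sat_exN hA].
pose s := scons (tSucc (tVar 0)) (fun i => tVar i.+1).
have h : sat rho sig (ninst tZero B) ->
    (forall x, sat (scons x rho) sig B -> sat (scons x rho) sig (nsubst s B)) ->
    forall x, sat (scons x rho) sig B := rcaP (ax_Sigma01_induction _ SB) rho sig.
move=> x; apply/hB; apply: h => [|y /hB /PS /hB]; rewrite sat_nsubst.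
  by move/hB: P0; congr sat; apply: funext => -[].
by congr sat; apply: funext => -[].
Qed.

Lemma sat_comprehension (rho : nat -> N) sig A B :
  Sigma01 A -> Pi01 B ->
  (forall x, sat (M := M) (scons x rho) sig A <-> sat (scons x rho) sig B) ->
  exists X, forall x, sin x X <-> sat (scons x rho) sig A.
Proof.
move=> SA PB h.
have c : (forall x, sat (scons x rho) sig (fIff A B)) ->
    sat rho sig (fExS (fAllN (fIff (fIn (tVar 0) 0) (sshift A)))) :=
  rcaP (ax_Delta01_comprehension _ _ SA PB) rho sig.
have /sat_exS [X hX] := c (fun x => proj2 (sat_iff _ _ _ _) (h x)).
exists X => x; have : sat (scons x rho) (scons X sig) (fIff (fIn (tVar 0) 0) (sshift A)) := hX x.
by move/sat_iff; rewrite sat_srename.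
Qed.

Lemma comprehension (P : N -> Prop) :
  S1 (fun e => P (e 0)) -> S1 (fun e => ~ P (e 0)) ->
  exists X, forall x, sin (s := M) x X <-> P x.
Proof.
move=> /S1_two [A [rho [sig [bA hA]]]] /(@S1_two (fun x => ~ P x)).
move=> [B [rho' [sig' [bB hB]]]].
(* Variables 0 and 1, the witness and the argument, stay in place; the parameters of the two
   formulas move to disjoint places. *)
pose A1 := nsubst (fun i => if i is j.+2 then tVar j.*2.+2 else tVar i)
             (srename (fun i => i.*2) A).
pose B1 := fNot (nsubst (fun i => if i is j.+2 then tVar j.*2.+3 else tVar i)
             (srename (fun i => i.*2.+1) B)).
pose r := interleave rho rho'; pose sg := interleave sig sig'.
have E1 x : sat (scons x r) sg (fExN A1) <-> P x.
  rewrite sat_exN hA; split=> -[y hy]; exists y; move: hy;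
    rewrite /A1 sat_nsubst sat_srename interleave_evenE;
    rewrite (_ : (fun i => eval _ _) = scons y (scons x rho)) //;
    by apply: funext => -[|[|i]] //=; rewrite /r interleave_even.
have E2 x : sat (scons x r) sg (fAllN B1) <-> P x.
  have EB y : sat (scons y (scons x r)) sg B1 <-> ~ sat (scons y (scons x rho')) sig' B.
    rewrite /B1 /= sat_nsubst sat_srename interleave_oddE.
    rewrite (_ : (fun i => eval _ _) = scons y (scons x rho')) //.
    by apply: funext => -[|[|i]] //=; rewrite /r interleave_odd.
  split=> [h|Px y].
    by apply: contrapT => /hB [y]; apply/EB/(h y).
  by apply/EB => hy; have /hB : exists y, sat (scons y (scons x rho')) sig' B by exists y.
have bA1 : bounded A1 by apply: bounded_nsubst; apply: bounded_srename.
have bB1 : bounded B1.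
  by constructor; [apply: bounded_nsubst; apply: bounded_srename|constructor].
have [|X hX] := sat_comprehension (sigma01_ex _ bA1) (pi01_all _ bB1) (rho := r) (sig := sg).
  by move=> x; rewrite E1 E2.
by exists X => x; rewrite hX E1.
Qed.

End Definable.
(** * Arithmetic in a model *)

Section RawArithmetic.
Variable M : rca.
Local Notation N := (num M).
Local Notation "x + y" := (@sadd M x y).
Local Notation "x * y" := (@smul M x y).
Local Notation "0" := (szero M).
Local Notation "1" := (sone M).

Lemma S1_D0 (P : (nat -> N) -> Prop) : D0 P -> S1 P.
Proof.
move=> dP; exists (fun e _ => P e); split; first exact: (D0_ren (fun i => i.+1)).
by move=> e; split=> [Pe|[]//]; exists 0.
Qed.

Lemma Term_sadd (f g : (nat -> N) -> N) : Term f -> Term g -> Term (fun e => f e + g e).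
Proof. exact: (Term_op (op := tAdd) (sop := @sadd M)). Qed.

Lemma Term_smul (f g : (nat -> N) -> N) : Term f -> Term g -> Term (fun e => f e * g e).
Proof. exact: (Term_op (op := tMul) (sop := @smul M)). Qed.

Lemma D0_eq (f g : (nat -> N) -> N) : Term f -> Term g -> D0 (fun e => f e = g e).
Proof. by apply: (D0_rel (R := fEq)) => // a b; constructor. Qed.

Lemma D0_slt (f g : (nat -> N) -> N) : Term f -> Term g -> D0 (fun e => slt (s := M) (f e) (g e)).
Proof. by apply: (D0_rel (R := fLt)) => // a b; constructor. Qed.

Ltac raw_term := first
  [ apply: Term_var | apply: Term_const
  | apply: Term_sadd; raw_term | apply: Term_smul; raw_term ].

Ltac raw_D0 := first
  [ apply: D0_and; raw_D0 | apply: D0_or; raw_D0 | apply: D0_not; raw_D0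
  | apply: D0_eq; raw_term | apply: D0_slt; raw_term | apply: D0_imp; raw_D0 ].

Ltac raw_ind x := elim/induction: x; first by apply: S1_D0; raw_D0.

Let rho0 (x y : N) : nat -> N := scons x (scons y (fun=> 0)).
Let sig0 : nat -> sets M := fun=> rca_set M.

Lemma succ_neq0 (x : N) : x + 1 <> 0.
Proof. exact: (rcaP ax_succ_neq0 (rho0 x 0) sig0). Qed.

Lemma succ_inj (x y : N) : x + 1 = y + 1 -> x = y.
Proof. exact: (rcaP ax_succ_inj (rho0 x y) sig0). Qed.

Lemma addn0E (x : N) : x + 0 = x.
Proof. exact: (rcaP ax_add0 (rho0 x 0) sig0). Qed.

Lemma addnSE (x y : N) : x + (y + 1) = x + y + 1.
Proof. exact: (rcaP ax_addS (rho0 x y) sig0). Qed.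

Lemma muln0E (x : N) : x * 0 = 0.
Proof. exact: (rcaP ax_mul0 (rho0 x 0) sig0). Qed.

Lemma mulnSE (x y : N) : x * (y + 1) = x * y + x.
Proof. exact: (rcaP ax_mulS (rho0 x y) sig0). Qed.

Lemma slt0 (x : N) : ~ slt (s := M) x 0.
Proof. exact: (rcaP ax_lt0 (rho0 x 0) sig0). Qed.

Lemma sltS (x y : N) : slt (s := M) x (y + 1) <-> slt (s := M) x y \/ x = y.
Proof.
have h : sat (rho0 x y) sig0 (fIff (fLt (tVar 0) (tSucc (tVar 1)))
  (fOr (fLt (tVar 0) (tVar 1)) (fEq (tVar 0) (tVar 1)))) := rcaP ax_ltS _ _.
by move/sat_iff: h; rewrite sat_or.
Qed.

Lemma sadd0 (x : N) : 0 + x = x.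
Proof. by raw_ind x => [|x IH]; rewrite ?addn0E // addnSE IH. Qed.

Lemma saddS (x y : N) : x + 1 + y = x + y + 1.
Proof. by raw_ind y => [|y IH]; rewrite ?addn0E // !addnSE IH. Qed.

Lemma saddC (x y : N) : x + y = y + x.
Proof. by raw_ind y => [|y IH]; rewrite ?addn0E ?sadd0 // addnSE saddS IH. Qed.

Lemma saddA (x y z : N) : x + (y + z) = x + y + z.
Proof. by raw_ind z => [|z IH]; rewrite ?addn0E // !addnSE IH. Qed.

Lemma smul0 (x : N) : 0 * x = 0.
Proof. by raw_ind x => [|x IH]; rewrite ?muln0E // mulnSE IH addn0E. Qed.

Lemma smulS (x y : N) : (x + 1) * y = x * y + y.
Proof.
raw_ind y => [|y IH]; first by rewrite !muln0E addn0E.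
by rewrite !mulnSE IH -!saddA; congr (_ + _); rewrite !saddA [y + x]saddC.
Qed.

Lemma smulC (x y : N) : x * y = y * x.
Proof. by raw_ind y => [|y IH]; rewrite ?muln0E ?smul0 // mulnSE smulS IH. Qed.

Lemma smulDl (x y z : N) : (x + y) * z = x * z + y * z.
Proof.
raw_ind z => [|z IH]; first by rewrite !muln0E addn0E.
rewrite !mulnSE IH -!saddA; congr (_ + _).
by rewrite !saddA [y * z + x]saddC.
Qed.

Lemma smulA (x y z : N) : x * (y * z) = x * y * z.
Proof.
raw_ind z => [|z IH]; first by rewrite !muln0E.
by rewrite !mulnSE smulC smulDl [y * z * x]smulC IH; congr (_ + _); rewrite smulC.
Qed.

Lemma smul1 (x : N) : 1 * x = x.
Proof. by rewrite -[1]sadd0 smulS smul0 sadd0. Qed.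

Lemma sone_neq0 : 1 <> 0.
Proof. by rewrite -[1]sadd0; apply: succ_neq0. Qed.

End RawArithmetic.

HB.instance Definition _ (M : rca) := gen_eqMixin (num M).
HB.instance Definition _ (M : rca) := gen_choiceMixin (num M).
HB.instance Definition _ (M : rca) :=
  GRing.isNmodule.Build (num M) (@saddA M) (@saddC M) (@sadd0 M).

Lemma num_one_neq0 (M : rca) : sone M != 0%R :> num M.
Proof. by apply/eqP; apply: sone_neq0. Qed.

HB.instance Definition _ (M : rca) :=
  GRing.Nmodule_isComNzSemiRing.Build (num M) (@smulA M) (@smulC M) (@smul1 M)
    (@smulDl M) (@smul0 M) (num_one_neq0 M).

Definition nlt (M : rca) (x y : num M) : Prop := slt (s := M) x y.
Definition nle (M : rca) (x y : num M) : Prop := nlt x y \/ x = y.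

Notation "x ≺ y" := (nlt x y) (at level 70, no associativity).
Notation "x ≼ y" := (nle x y) (at level 70, no associativity).

Import Order.TTheory GRing.Theory Num.Theory.
Local Open Scope ring_scope.

Section Arithmetic.
Variable M : rca.
Local Notation N := (num M).
Local Notation env := (nat -> N).

Lemma Term_add (f g : env -> N) : Term f -> Term g -> Term (fun e => f e + g e).
Proof. exact: Term_sadd. Qed.

Lemma Term_mul (f g : env -> N) : Term f -> Term g -> Term (fun e => f e * g e).
Proof. exact: Term_smul. Qed.

Lemma D0_lt (f g : env -> N) : Term f -> Term g -> D0 (fun e => f e ≺ g e).
Proof. exact: D0_slt. Qed.

Lemma D0_le (f g : env -> N) : Term f -> Term g -> D0 (fun e => f e ≼ g e).
Proof. by move=> tf tg; apply: D0_or; [apply: D0_lt|apply: D0_eq]. Qed.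

Lemma nind (P : N -> Prop) :
  S1 (fun e => P (e 0%N)) -> P 0 -> (forall x, P x -> P (x + 1)) -> forall x, P x.
Proof. exact: induction. Qed.

End Arithmetic.

Ltac term := first
  [ apply: Term_var | apply: Term_const
  | apply: Term_add; term | apply: Term_mul; term ].

Ltac d0 := cbv beta; first
  [ assumption
  | apply: D0_and; d0 | apply: D0_or; d0 | apply: D0_not; d0
  | apply: D0_eq; term | apply: D0_lt; term | apply: D0_le; term
  | apply: D0_bex; [term|d0] | apply: D0_ball; [term|d0] | apply: D0_imp; d0 ].

Section Order.
Variable M : rca.
Local Notation N := (num M).
Local Notation env := (nat -> N).

Lemma S1_intro (Q : env -> N -> Prop) :
  D0 (fun e => Q (fun i => e i.+1) (e 0%N)) -> S1 (fun e => exists x, Q e x).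
Proof. by move=> dQ; exists Q. Qed.

Lemma addn1_neq0 (x : N) : x + 1 <> 0.
Proof. exact: succ_neq0. Qed.

Lemma naddI (z x y : N) : x + z = y + z -> x = y.
Proof.
elim/nind: z => [||z IH]; first by apply: S1_D0; d0.
  by rewrite !addr0.
by rewrite !addrA => /(@succ_inj M).
Qed.

Lemma ncase (x : N) : x = 0 \/ exists y, x = y + 1.
Proof.
(* The disjunction goes below the quantifier to give the induction formula the shape required by
   [S1_intro]. *)
suff [y] : exists y, x = 0 \/ x = y + 1 by case; [left|right; exists y].
elim/nind: x => [||x [y _]]; first by apply: S1_intro; d0.
  by exists 0; left.
by exists x; right.
Qed.

Lemma nlt0 (x : N) : ~ x ≺ 0.
Proof. exact: slt0. Qed.

Lemma nltS (x y : N) : x ≺ y + 1 <-> x ≼ y.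
Proof. exact: sltS. Qed.

Lemma nltP (x y : N) : x ≺ y <-> exists z, y = x + z + 1.
Proof.
split=> [|[z ->]].
  suff [z h] : exists z, x ≺ y -> y = x + z + 1 by move/h => ->; exists z.
  elim/nind: y => [||y [z IH]]; first by apply: S1_intro; d0.
    by exists 0 => /nlt0.
  case: (pselect (x ≺ y)) => [/IH ->|nlt].
    by exists (z + 1) => _; rewrite addrA.
  by exists 0 => /nltS [//|->]; rewrite addr0.
elim/nind: z => [||z IH]; first by apply: S1_D0; d0.
  by rewrite addr0; apply/nltS; right.
by apply/nltS; left; rewrite addrA.
Qed.

Lemma naddn0 (x y : N) : x + y = 0 -> x = 0 /\ y = 0.
Proof.
case: (ncase y) => [->|[z ->]]; first by rewrite addr0.
by rewrite addrA => /addn1_neq0.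
Qed.

Lemma nle0 (x : N) : 0 ≼ x.
Proof.
case: (ncase x) => [->|[y ->]]; first by right.
by left; apply/nltP; exists y; rewrite add0r.
Qed.

Lemma ntotal (x y : N) : x ≺ y \/ y ≼ x.
Proof.
elim/nind: y => [||y [xy|yx]]; first by apply: S1_D0; d0.
- by right; apply: nle0.
- by left; apply/nltS; left.
case: yx => [/nltP [z ->]|->]; last by left; apply/nltS; right.
case: (ncase z) => [->|[w ->]]; first by right; right; rewrite addr0.
by right; left; apply/nltP; exists w; ring.
Qed.

Lemma nltxx (x : N) : ~ x ≺ x.
Proof.
move=> /nltP [z]; rewrite -addrA -{1}[x]add0r [x + _]addrC => /naddI /esym.
exact: addn1_neq0.
Qed.

Lemma nlt_trans (x y z : N) : x ≺ y -> y ≺ z -> x ≺ z.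
Proof. by move=> /nltP [u ->] /nltP [v ->]; apply/nltP; exists (u + 1 + v); ring. Qed.

Lemma nle_refl (x : N) : x ≼ x.
Proof. by right. Qed.

Lemma nleP (x y : N) : x ≼ y <-> exists z, y = x + z.
Proof.
split=> [[/nltP [z ->]|->]|[z ->]].
- by exists (z + 1); rewrite addrA.
- by exists 0; rewrite addr0.
case: (ncase z) => [->|[w ->]]; first by right; rewrite addr0.
by left; apply/nltP; exists w; ring.
Qed.

Lemma nle_addr (x y : N) : x ≼ x + y.
Proof. by apply/nleP; exists y. Qed.

Lemma nle_addl (x y : N) : x ≼ y + x.
Proof. by rewrite addrC; apply: nle_addr. Qed.

Lemma nltSn (x : N) : x ≺ x + 1.
Proof. by apply/nltS; right. Qed.

Lemma nmulI (z x y : N) : z <> 0 -> x * z = y * z -> x = y.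
Proof.
move=> z0; wlog xy : x y / x ≼ y => [h e|].
  by case: (ntotal x y) => [?|/h h'];[apply: h => //; left|apply/esym/h'].
case: xy => [/nltP [w ->]|//]; rewrite -{1}[x * z]add0r -addrA mulrDl addrC.
by rewrite [X in _ = X]addrC => /esym/naddI; rewrite mulrDl mul1r => /naddn0 [].
Qed.

Lemma nmul_eq0 (x y : N) : x * y = 0 -> x = 0 \/ y = 0.
Proof.
move=> h; case: (pselect (y = 0)) => [|y0]; first by right.
by left; apply: (nmulI y0); rewrite h mul0r.
Qed.

Lemma nlt_neq0 (x : N) : 0 ≺ x <-> x <> 0.
Proof.
split=> [h x0|x0]; first by move: h; rewrite x0 => /nlt0.
by case: (nle0 x) => // /esym.
Qed.

End Order.
(** * Recursive predicates and functions *)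

Section Calculus.
Variable M : rca.
Local Notation N := (num M).
Local Notation env := (nat -> N).

Lemma S1_ext (P Q : env -> Prop) : (forall e, P e <-> Q e) -> S1 P -> S1 Q.
Proof. by move=> h [R [dR hP]]; exists R; split=> // e; rewrite -h. Qed.

Lemma S1_val (r : nat -> nat + N) (P : env -> Prop) : S1 P -> S1 (fun e => P (val r e)).
Proof.
move=> [Q [dQ hP]]; exists (fun e x => Q (val r e) x); split=> [|e]; last exact: hP.
pose r' i := if i is j.+1 then
  match r j with inl k => inl k.+1 | inr c => inr c end else inl 0%N.
have := D0_val r' dQ; apply: D0_ext => e.
suff -> : (fun i => val r' e i.+1) = val r (fun i => e i.+1) by [].
by apply: funext => i; rewrite /val /=; case: (r i).
Qed.

Lemma S1_ren (r : nat -> nat) (P : env -> Prop) : S1 P -> S1 (fun e => P (fun i => e (r i))).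
Proof. exact: (@S1_val (fun i => inl (r i))). Qed.

Lemma S1_and (P Q : env -> Prop) : S1 P -> S1 Q -> S1 (fun e => P e /\ Q e).
Proof.
move=> [A [dA hP]] [B [dB hQ]].
pose C e z := (exists x, x ≺ z /\ A e x) /\ (exists x, x ≺ z /\ B e x).
exists C; split=> [|e].
  apply: D0_and; apply: D0_bex; try term.
    exact: (D0_ren (fun i => if i is j.+1 then j.+2 else 0%N) dA).
  exact: (D0_ren (fun i => if i is j.+1 then j.+2 else 0%N) dB).
rewrite hP hQ /C; split=> [[[x Ax] [y By]]|[z [[x [_ Ax]] [y [_ By]]]]].
  exists (x + y + 1); split; [exists x|exists y]; split=> //; apply/nltS;
    by [apply: nle_addr|apply: nle_addl].
by split; [exists x|exists y].
Qed.

Lemma S1_or (P Q : env -> Prop) : S1 P -> S1 Q -> S1 (fun e => P e \/ Q e).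
Proof.
move=> [A [dA hP]] [B [dB hQ]]; exists (fun e x => A e x \/ B e x).
split=> [|e]; first by d0.
rewrite hP hQ; split=> [[[x Ax]|[x Bx]]|[x [Ax|Bx]]].
- by exists x; left.
- by exists x; right.
- by left; exists x.
- by right; exists x.
Qed.

(** Two unbounded quantifiers are contracted by a common bound on both witnesses, which works before
    unpairing is available. *)
Lemma S1_ex (P : env -> N -> Prop) :
  S1 (fun e => P (fun i => e i.+1) (e 0%N)) -> S1 (fun e => exists x, P e x).
Proof.
move=> [Q [dQ hP]].
exists (fun e z => exists x, x ≺ z /\ exists y, y ≺ z /\ Q (scons x e) y).
split=> [|e].
  apply: D0_bex; first by term.
  apply: D0_bex; first by term.
  have := D0_ren (fun i => if i is j.+2 then j.+3 else i) dQ.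
  apply: D0_ext => e; suff -> : scons (e 1%N) (fun i => e i.+3) =
    (fun i => e (if i is j.+1 then j.+3 else i.+1)) by [].
  by apply: funext => -[].
have hP' x : P e x <-> exists y, Q (scons x e) y by exact: (hP (scons x e)).
split=> [[x /hP' [y Qxy]]|[z [x [_ [y [_ Qxy]]]]]]; last by exists x; apply/hP'; exists y.
exists (x + y + 1); exists x; split; first by apply/nltS; apply: nle_addr.
by exists y; split=> //; apply/nltS; apply: nle_addl.
Qed.

(** Lets a bounded universal quantifier pass below an existential one; the closure of [S1] under
    bounded quantification rests on it. *)
Lemma D0_collection (Q : N -> N -> Prop) a :
  D0 (fun e => Q (e 1%N) (e 0%N)) -> (forall x, x ≺ a -> exists y, Q x y) ->
  exists z, forall x, x ≺ a -> exists y, y ≺ z /\ Q x y.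
Proof.
move=> dQ h.
(* The bound is doubled: one copy becomes the induction variable [u], the other keeps [x] where [Q]
   has witnesses. *)
suff [z hz] : exists z, forall x, x ≺ a -> x ≺ a -> exists y, y ≺ z /\ Q x y.
  by exists z => x xa; apply: hz.
move: {1}a => u; elim/nind: u => [||u [z hz]].
- apply: S1_ex; apply: S1_D0; apply: D0_ball; first by term.
  apply: D0_imp; first by d0.
  apply: D0_bex; first by term.
  exact: (D0_ren (fun i => i) dQ).
- by exists 0 => x /nlt0.
case: (pselect (u ≺ a)) => [ua|nua]; last first.
  by exists z => x /nltS [xu|-> //]; apply: hz.
have [y Quy] := h u ua; exists (z + y + 1) => x /nltS [xu xa|-> _].
  have [y' [y'z Qxy]] := hz x xu xa; exists y'; split=> //.
  by apply: (nlt_trans y'z); apply/nltS; apply: nle_addr.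
by exists y; split=> //; apply/nltS; apply: nle_addl.
Qed.

Lemma S1_ball_term (f : env -> N) (P : env -> N -> Prop) :
  Term f -> S1 (fun e => P (fun i => e i.+1) (e 0%N)) ->
  S1 (fun e => forall x, x ≺ f e -> P e x).
Proof.
move=> [t [s hf]] [Q [dQ hP]].
have tf : Term f by exists t, s.
exists (fun e z => forall x, x ≺ f e -> exists y, y ≺ z /\ Q (scons x e) y).
split=> [|e].
  apply: D0_ball.
    exists t, (fun i => match s i with inl j => inl j.+1 | inr c => inr c end) => e.
    by rewrite hf; congr eval; apply: funext => i; rewrite /val; case: (s i).
  apply: D0_bex; first by term.
  have := D0_ren (fun i => if i is j.+2 then j.+3 else i) dQ.
  apply: D0_ext => e; suff -> : scons (e 1%N) (fun i => e i.+3) =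
    (fun i => e (if i is j.+1 then j.+3 else i.+1)) by [].
  by apply: funext => -[].
have hP' x : P e x <-> exists y, Q (scons x e) y by exact: (hP (scons x e)).
split=> [h|[z h] x /h [y [_ Qxy]]]; last by apply/hP'; exists y.
apply: (D0_collection (Q := fun x y => Q (scons x e) y)); last by move=> x /h /hP'.
pose r i := match i with
  | 0%N => inl 0%N | 1%N => inl 1%N | j.+2 => inr (e j) end.
have := D0_val r dQ; apply: D0_ext => e'.
suff -> : scons (e' 1%N) e = (fun i => val r e' i.+1) by [].
by apply: funext => -[].
Qed.

Definition R1 (f : env -> N) := S1 (fun e => e 0%N = f (fun i => e i.+1)).

Definition D1 (P : env -> Prop) := S1 P /\ S1 (fun e => ~ P e).

Lemma R1_Term (f : env -> N) : Term f -> R1 f.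
Proof.
move=> [t [s hf]]; apply: S1_D0; apply: D0_eq; first by term.
exists t, (fun i => match s i with inl j => inl j.+1 | inr c => inr c end) => e.
by rewrite hf; congr eval; apply: funext => i; rewrite /val; case: (s i).
Qed.

Lemma R1_var k : R1 (fun e => e k).
Proof. by apply: R1_Term; term. Qed.

Lemma R1_const c : R1 (fun=> c).
Proof. by apply: R1_Term; term. Qed.

Lemma S1_app (f : env -> N) (P : env -> N -> Prop) :
  R1 f -> S1 (fun e => P (fun i => e i.+1) (e 0%N)) -> S1 (fun e => P e (f e)).
Proof.
move=> rf sP; apply: (S1_ext (P := fun e => exists y, y = f e /\ P e y)).
  by move=> e; split=> [[y [-> //]]|h]; exists (f e).
by apply: S1_ex; apply: S1_and.
Qed.

(** As [f] is total, [P e (f e)] and its negation can both be stated by an existential quantifier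
    over the value; a Sigma_1 graph is therefore enough in [R1]. *)
Lemma D1_app (f : env -> N) (P : env -> N -> Prop) :
  R1 f -> D1 (fun e => P (fun i => e i.+1) (e 0%N)) -> D1 (fun e => P e (f e)).
Proof.
by move=> rf [sP sn]; split; [apply: S1_app|apply: (S1_app (P := fun e x => ~ P e x))].
Qed.

Lemma R1_ren (r : nat -> nat) (f : env -> N) : R1 f -> R1 (fun e => f (fun i => e (r i))).
Proof. by move/(S1_ren (fun i => if i is j.+1 then (r j).+1 else 0%N)). Qed.

Lemma R1_app (f : env -> N) (F : env -> N -> N) :
  R1 f -> R1 (fun e => F (fun i => e i.+1) (e 0%N)) -> R1 (fun e => F e (f e)).
Proof.
move=> rf rF.
apply: (S1_app (f := fun e => f (fun i => e i.+1))
               (P := fun e y => e 0%N = F (fun i => e i.+1) y)).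
  exact: R1_ren.
exact: (S1_ren (fun i => match i with 0 => 1 | 1 => 0 | _ => i end)%N rF).
Qed.

Lemma D1_D0 (P : env -> Prop) : D0 P -> D1 P.
Proof. by move=> dP; split; apply: S1_D0 => //; apply: D0_not. Qed.

Lemma D1_ext (P Q : env -> Prop) : (forall e, P e <-> Q e) -> D1 P -> D1 Q.
Proof.
by move=> h [s n]; split; [apply: S1_ext s|apply: S1_ext n] => e; rewrite h.
Qed.

Lemma D1_ren (r : nat -> nat) (P : env -> Prop) : D1 P -> D1 (fun e => P (fun i => e (r i))).
Proof. by move=> [s n]; split; [apply: S1_ren s|apply: S1_ren n]. Qed.

Lemma D1_not (P : env -> Prop) : D1 P -> D1 (fun e => ~ P e).
Proof. by move=> [s n]; split=> //; apply: S1_ext s => e; rewrite notE. Qed.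

Lemma D1_and (P Q : env -> Prop) : D1 P -> D1 Q -> D1 (fun e => P e /\ Q e).
Proof.
move=> [s n] [s' n']; split; first exact: S1_and.
by apply: S1_ext (S1_or n n') => e; rewrite -not_andE.
Qed.

Lemma D1_or (P Q : env -> Prop) : D1 P -> D1 Q -> D1 (fun e => P e \/ Q e).
Proof.
move=> [s n] [s' n']; split; first exact: S1_or.
by apply: S1_ext (S1_and n n') => e; rewrite -not_orE.
Qed.

Lemma D1_imp (P Q : env -> Prop) : D1 P -> D1 Q -> D1 (fun e => P e -> Q e).
Proof.
move=> dP dQ; apply: D1_ext (D1_or (D1_not dP) dQ) => e.
by rewrite implyE.
Qed.

Lemma D1_iff (P Q : env -> Prop) : D1 P -> D1 Q -> D1 (fun e => P e <-> Q e).
Proof. by move=> dP dQ; apply: D1_and; apply: D1_imp. Qed.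

Lemma S1_D1 (P : env -> Prop) : D1 P -> S1 P. Proof. by case. Qed.

Lemma S1_imp (P Q : env -> Prop) : D1 P -> S1 Q -> S1 (fun e => P e -> Q e).
Proof.
by move=> dP sQ; apply: S1_ext (S1_or (S1_D1 (D1_not dP)) sQ) => e; rewrite implyE.
Qed.

Lemma D1_rel2 (R : N -> N -> Prop) (f g : env -> N) :
  D1 (fun e => R (e 0%N) (e 1%N)) -> R1 f -> R1 g -> D1 (fun e => R (f e) (g e)).
Proof.
move=> dR rf rg; apply: (D1_app (P := fun e y => R y (g e))) => //.
apply: (D1_app (f := fun e => g (fun i => e i.+1)) (P := fun e y => R (e 0%N) y)).
  exact: R1_ren.
exact: (D1_ren (fun i => match i with 0 => 1 | 1 => 0 | _ => i end)%N dR).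
Qed.

Lemma R1_fun2 (G : N -> N -> N) (f g : env -> N) :
  R1 (fun e => G (e 0%N) (e 1%N)) -> R1 f -> R1 g -> R1 (fun e => G (f e) (g e)).
Proof.
move=> dR rf rg; apply: (R1_app (F := fun e y => G y (g e))) => //.
apply: (R1_app (f := fun e => g (fun i => e i.+1)) (F := fun e y => G (e 0%N) y)).
  exact: R1_ren.
exact: (R1_ren (fun i => match i with 0 => 1 | 1 => 0 | _ => i end)%N dR).
Qed.

Lemma D1_rel1 (P : N -> Prop) (f : env -> N) :
  D1 (fun e => P (e 0%N)) -> R1 f -> D1 (fun e => P (f e)).
Proof.
move=> dP rf; apply: (D1_app (P := fun e y => P y)) => //.
Qed.

Lemma R1_fun1 (G : N -> N) (f : env -> N) :
  R1 (fun e => G (e 0%N)) -> R1 f -> R1 (fun e => G (f e)).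
Proof. by move=> dG rf; apply: (R1_app (F := fun e y => G y)). Qed.

Lemma D1_rel3 (R : N -> N -> N -> Prop) (f g h : env -> N) :
  D1 (fun e => R (e 0%N) (e 1%N) (e 2%N)) -> R1 f -> R1 g -> R1 h ->
  D1 (fun e => R (f e) (g e) (h e)).
Proof.
move=> dR rf rg rh; apply: (D1_app (P := fun e y => R y (g e) (h e))) => //.
apply: (D1_app (f := fun e => g (fun i => e i.+1))
  (P := fun e y => R (e 0%N) y (h (fun i => e i.+1)))); first exact: R1_ren.
apply: (D1_app (f := fun e => h (fun i => e i.+2)) (P := fun e y => R (e 1%N) (e 0%N) y)).
  exact: R1_ren.
exact: (D1_ren (fun i => match i with 0 => 2 | 2 => 0 | _ => i end)%N dR).
Qed.

Lemma R1_fun3 (G : N -> N -> N -> N) (f g h : env -> N) :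
  R1 (fun e => G (e 0%N) (e 1%N) (e 2%N)) -> R1 f -> R1 g -> R1 h ->
  R1 (fun e => G (f e) (g e) (h e)).
Proof.
move=> dR rf rg rh; apply: (R1_app (F := fun e y => G y (g e) (h e))) => //.
apply: (R1_app (f := fun e => g (fun i => e i.+1))
  (F := fun e y => G (e 0%N) y (h (fun i => e i.+1)))); first exact: R1_ren.
apply: (R1_app (f := fun e => h (fun i => e i.+2)) (F := fun e y => G (e 1%N) (e 0%N) y)).
  exact: R1_ren.
exact: (R1_ren (fun i => match i with 0 => 2 | 2 => 0 | _ => i end)%N dR).
Qed.

Lemma R1_add (f g : env -> N) : R1 f -> R1 g -> R1 (fun e => f e + g e).
Proof. by apply: R1_fun2; apply: R1_Term; term. Qed.

Lemma R1_mul (f g : env -> N) : R1 f -> R1 g -> R1 (fun e => f e * g e).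
Proof. by apply: R1_fun2; apply: R1_Term; term. Qed.

Lemma D1_eq (f g : env -> N) : R1 f -> R1 g -> D1 (fun e => f e = g e).
Proof. by apply: D1_rel2; apply: D1_D0; d0. Qed.

Lemma D1_lt (f g : env -> N) : R1 f -> R1 g -> D1 (fun e => f e ≺ g e).
Proof. by apply: D1_rel2; apply: D1_D0; d0. Qed.

Lemma D1_le (f g : env -> N) : R1 f -> R1 g -> D1 (fun e => f e ≼ g e).
Proof. by apply: D1_rel2; apply: D1_D0; d0. Qed.

Lemma D1_in (f : env -> N) X : R1 f -> D1 (fun e => sin (s := M) (f e) X).
Proof. by apply: (D1_rel1 (P := fun x => sin x X)); apply: D1_D0; apply: D0_in; term. Qed.

Lemma S1_ball (f : env -> N) (P : env -> N -> Prop) :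
  R1 f -> S1 (fun e => P (fun i => e i.+1) (e 0%N)) ->
  S1 (fun e => forall x, x ≺ f e -> P e x).
Proof.
move=> rf sP; apply: (S1_app (P := fun e b => forall x, x ≺ b -> P e x)) => //.
apply: S1_ball_term; first by term.
exact: (S1_ren (fun i => if i is j.+1 then j.+2 else 0%N) sP).
Qed.

Lemma D1_ball (f : env -> N) (P : env -> N -> Prop) :
  R1 f -> D1 (fun e => P (fun i => e i.+1) (e 0%N)) ->
  D1 (fun e => forall x, x ≺ f e -> P e x).
Proof.
move=> rf [sP nP]; split; first exact: S1_ball.
apply: (S1_ext (P := fun e => exists x, x ≺ f e /\ ~ P e x)).
  move=> e; rewrite -existsNE; split=> -[x hx]; exists x; first by case: hx => xf n /(_ xf).
  by apply/not_imp_not => h; apply: hx => xf; apply: contrapT => /(h xf).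
apply: S1_ex; apply: S1_and => //; apply: S1_D1; apply: D1_lt; first exact: R1_var.
exact: R1_ren.
Qed.

Lemma D1_bex (f : env -> N) (P : env -> N -> Prop) :
  R1 f -> D1 (fun e => P (fun i => e i.+1) (e 0%N)) ->
  D1 (fun e => exists x, x ≺ f e /\ P e x).
Proof.
move=> rf dP; apply: (D1_ext (P := fun e => ~ forall x, x ≺ f e -> ~ P e x)).
  move=> e; rewrite -existsNE; split=> -[x hx]; exists x; first exact/not_imp_not.
  by case: hx => xf Px /(_ xf).
by apply/D1_not/(D1_ball (P := fun e x => ~ P e x))/D1_not.
Qed.

Lemma D1_balle (f : env -> N) (P : env -> N -> Prop) :
  R1 f -> D1 (fun e => P (fun i => e i.+1) (e 0%N)) ->
  D1 (fun e => forall x, x ≼ f e -> P e x).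
Proof.
move=> rf dP; apply: (D1_ext (P := fun e => forall x, x ≺ f e + 1 -> P e x)).
  by move=> e; split=> h x /nltS; apply: h.
by apply: D1_ball => //; apply: R1_add => //; apply: R1_const.
Qed.

Lemma D1_bexe (f : env -> N) (P : env -> N -> Prop) :
  R1 f -> D1 (fun e => P (fun i => e i.+1) (e 0%N)) ->
  D1 (fun e => exists x, x ≼ f e /\ P e x).
Proof.
move=> rf dP; apply: (D1_ext (P := fun e => exists x, x ≺ f e + 1 /\ P e x)).
  by move=> e; split=> -[x [/nltS xf Px]]; exists x.
by apply: D1_bex => //; apply: R1_add => //; apply: R1_const.
Qed.

Lemma S1_balle (f : env -> N) (P : env -> N -> Prop) :
  R1 f -> S1 (fun e => P (fun i => e i.+1) (e 0%N)) ->
  S1 (fun e => forall x, x ≼ f e -> P e x).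
Proof.
move=> rf dP; apply: (S1_ext (P := fun e => forall x, x ≺ f e + 1 -> P e x)).
  by move=> e; split=> h x /nltS; apply: h.
by apply: S1_ball => //; apply: R1_add => //; apply: R1_const.
Qed.

Lemma R1_graph (f : env -> N) (G : env -> N -> Prop) :
  (forall e y, y = f e <-> G e y) -> S1 (fun e => G (fun i => e i.+1) (e 0%N)) -> R1 f.
Proof. by move=> h; apply: S1_ext => e; rewrite h. Qed.

End Calculus.

Create HintDb df discriminated.
#[global] Hint Constants Opaque : df.
#[global] Hint Variables Opaque : df.

Ltac df_known := solve [eassumption | auto with df nocore].

(** Left open for the operations that are shown definable later, in particular those on
    rationals. *)
Ltac df_hook := fail.

Ltac df :=
  cbv beta zeta;
  first [ eassumption | lazymatch goal with
  | |- S1 (fun e => @?A e /\ @?B e) => apply: S1_and; df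
  | |- S1 (fun e => @?A e \/ @?B e) => apply: S1_or; df
  | |- S1 (fun e => exists x, @?P e x) => apply: S1_ex; df
  | |- S1 (fun e => forall x, x ≺ (@?f e) -> @?P e x) => apply: S1_ball; df
  | |- S1 (fun e => forall x, x ≼ (@?f e) -> @?P e x) => apply: S1_balle; df
  | |- S1 (fun e => ~ @?A e) => apply: S1_D1; df
  | |- S1 (fun e => @?A e -> @?B e) => apply: S1_imp; df
  | |- S1 _ => apply: S1_D1; df
  | |- D1 (fun e => @?A e /\ @?B e) => apply: D1_and; df
  | |- D1 (fun e => @?A e \/ @?B e) => apply: D1_or; df
  | |- D1 (fun e => @?A e <-> @?B e) => apply: D1_iff; df
  | |- D1 (fun e => exists x, x ≺ (@?f e) /\ @?P e x) => apply: D1_bex; df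
  | |- D1 (fun e => exists x, x ≼ (@?f e) /\ @?P e x) => apply: D1_bexe; df
  | |- D1 (fun e => forall x, x ≺ (@?f e) -> @?P e x) => apply: D1_ball; df
  | |- D1 (fun e => forall x, x ≼ (@?f e) -> @?P e x) => apply: D1_balle; df
  | |- D1 (fun e => ~ @?A e) => apply: D1_not; df
  | |- D1 (fun e => @?A e -> @?B e) => apply: D1_imp; df
  | |- D1 (fun e => (@?f e) ≺ (@?g e)) => apply: D1_lt; df
  | |- D1 (fun e => (@?f e) ≼ (@?g e)) => apply: D1_le; df
  | |- D1 (fun e => @eq _ (@?f e) (@?g e)) => first [apply: D1_eq; df | df_hook]
  | |- D1 (fun e => sin (@?f e) _) => apply: D1_in; df
  | |- D1 _ => first
      [ df_hook
      | apply: D1_rel3; [df_known|df|df|df]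
      | apply: D1_rel2; [df_known|df|df]
      | apply: D1_rel1; [df_known|df] ]
  | |- R1 (fun e => @GRing.add _ (@?f e) (@?g e)) => apply: R1_add; df
  | |- R1 (fun e => @GRing.mul _ (@?f e) (@?g e)) => apply: R1_mul; df
  | |- R1 _ => first
      [ apply: R1_var | apply: R1_const
      | df_hook
      | apply: R1_fun3; [df_known|df|df|df]
      | apply: R1_fun2; [df_known|df|df]
      | apply: R1_fun1; [df_known|df] ]
  | |- _ => df_hook
  end ].

(** * Induction, minimum and collection principles *)

Section Principles.
Variable M : rca.
Local Notation N := (num M).

(** A failure at [a] propagates downwards: by Sigma_1 induction on [x], some [y] with [y + x = a]
    fails as well, and [x = a] gives a failure at zero. *)
Lemma nind_pi (P : N -> Prop) :
  S1 (fun e => ~ P (e 0%N)) -> P 0 -> (forall x, P x -> P (x + 1)) -> forall x, P x.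
Proof.
move=> sP P0 PS a; apply: contrapT => nPa.
suff [y [ya nPy]] : exists y, y + a = a /\ ~ P y.
  move: ya; rewrite -{2}[a]add0r => /naddI y0; by rewrite y0 in nPy.
have := nle_refl a; move: {1 3}a => x; elim/nind: x => [||x IH xa].
- apply: S1_imp; first by df.
  by apply: S1_ex; apply: S1_and; [df|exact: (S1_ren (fun i => i) sP)].
- by move=> _; exists a; rewrite addr0.
have [y [ya nPy]] : exists y, y + x = a /\ ~ P y.
  by apply: IH; case/nleP: xa => z ->; rewrite -addrA; apply: nle_addr.
case: (ncase y) ya nPy => [-> ya //|[w ->] ya nPw].
by exists w; split; [rewrite -ya; ring|move/PS].
Qed.

Lemma least_sigma (P : N -> Prop) :
  S1 (fun e => P (e 0%N)) -> (exists x, P x) -> exists x, P x /\ forall y, y ≺ x -> ~ P y.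
Proof.
move=> sP [a Pa]; apply: contrapT => nleast.
suff h n : ~ exists y, y ≺ n /\ P y by apply: (h (a + 1)); exists a; split=> //; apply: nltSn.
elim/nind_pi: n => [||n IH].
- apply: (S1_ext (P := fun e => exists y, y ≺ e 0%N /\ P y)).
    by move=> e; rewrite notE.
  by apply: S1_ex; apply: S1_and; [df|exact: (S1_ren (fun i => i) sP)].
- by move=> [y [/nlt0]].
move=> [y [/nltS [yn Py|-> Pn]]]; first by apply: IH; exists y.
by apply: nleast; exists n; split=> // z zn Pz; apply: IH; exists z.
Qed.

Lemma least_pi (P : N -> Prop) :
  S1 (fun e => ~ P (e 0%N)) -> (exists x, P x) -> exists x, P x /\ forall y, y ≺ x -> ~ P y.
Proof.
move=> sP [a Pa]; apply: contrapT => nleast.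
suff h n : forall y, y ≺ n -> ~ P y by apply: (h (a + 1)) Pa; apply: nltSn.
elim/nind: n => [||n IH].
- by apply: S1_ball; [df|exact: (S1_ren (fun i => i) sP)].
- by move=> y /nlt0.
move=> y /nltS [|-> Pn]; first exact: IH.
by apply: nleast; exists n.
Qed.

(** The least complement [z] with [x + z = b] belongs to the greatest [x]. *)
Lemma greatest (P : N -> Prop) b :
  S1 (fun e => P (e 0%N)) -> (exists x, P x) -> (forall x, P x -> x ≼ b) ->
  exists x, P x /\ forall y, P y -> y ≼ x.
Proof.
move=> sP [a Pa] Pb.
have [||c [[x [xc Px]] hc]] := @least_sigma (fun z => exists x, x + z = b /\ P x).
- by apply: S1_ex; apply: S1_and; [df|exact: (S1_ren (fun i => i) sP)].
- by have /nleP [z ->] := Pb a Pa; exists z, a.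
exists x; split=> // y Py; case: (ntotal x y) => [|//] /nltP [w yE].
have /nleP [z bE] := Pb y Py.
exfalso; apply: (hc z); last by exists y.
move: xc; rewrite bE yE -!addrA ![x + _]addrC => /naddI ->.
by apply/nltP; exists w; ring.
Qed.

Lemma collection (P : N -> N -> Prop) a :
  S1 (fun e => P (e 0%N) (e 1%N)) -> (forall x, x ≺ a -> exists y, P x y) ->
  exists z, forall x, x ≺ a -> exists y, y ≺ z /\ P x y.
Proof.
move=> sP h.
suff [z hz] : exists z, forall x, x ≺ a -> x ≺ a -> exists y, y ≺ z /\ P x y.
  by exists z => x xa; apply: hz.
move: {1}a => u; elim/nind: u => [||u [z hz]].
- apply: S1_ex; apply: S1_ball; first by df.
  apply: S1_imp; first by df.
  apply: S1_ex; apply: S1_and; first by df.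
  exact: (S1_ren (fun i => if i is 0 then 1 else 0)%N sP).
- by exists 0 => x /nlt0.
case: (pselect (u ≺ a)) => [ua|nua]; last first.
  by exists z => x /nltS [xu|-> //]; apply: hz.
have [y Quy] := h u ua; exists (z + y + 1) => x /nltS [xu xa|-> _].
  have [y' [y'z Qxy]] := hz x xu xa; exists y'; split=> //.
  by apply: (nlt_trans y'z); apply/nltS; apply: nle_addr.
by exists y; split=> //; apply/nltS; apply: nle_addl.
Qed.

End Principles.
(** * The ordered field of rationals of a model *)

Section Pairing.
Variable M : rca.
Local Notation N := (num M).

Lemma nle_anti (x y : N) : x ≼ y -> y ≼ x -> x = y.
Proof. by move=> [xy [yx|//]|//]; case: (nltxx (nlt_trans xy yx)). Qed.

Lemma nlt_nle (x y : N) : ~ x ≺ y <-> y ≼ x.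
Proof.
split=> [n|[yx|->]]; first by case: (ntotal x y).
  by move/(nlt_trans yx)/nltxx.
exact: nltxx.
Qed.

Lemma nle_trans (x y z : N) : x ≼ y -> y ≼ z -> x ≼ z.
Proof. by move=> /nleP [u ->] /nleP [v ->]; rewrite -addrA; apply: nle_addr. Qed.

Lemma nlt_le_trans (x y z : N) : x ≺ y -> y ≼ z -> x ≺ z.
Proof. by move=> xy [/(nlt_trans xy)//|<-]. Qed.

Lemma nle_lt_trans (x y z : N) : x ≼ y -> y ≺ z -> x ≺ z.
Proof. by move=> [xy /(nlt_trans xy)//|->]. Qed.

Definition npr (i j : N) : N := (i + j) * (i + j) + i.

Lemma npr_lel i j : i ≼ npr i j.
Proof. exact: nle_addl. Qed.

Lemma npr_ler i j : j ≼ npr i j.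
Proof.
case: (ncase j) => [->|[w ->]]; first exact: nle0.
by apply/nleP; exists ((i + w) * (i + w + 1) + i + i); rewrite /npr; ring.
Qed.

(** A smaller sum gives a smaller code, because [(i + j)^2 + i] lies below [(i + j + 1)^2]; for
    equal sums the last summand decides. *)
Lemma npr_inj i j i' j' : npr i j = npr i' j' -> i = i' /\ j = j'.
Proof.
have sep a b c d : npr a b = npr c d -> ~ a + b ≺ c + d.
  rewrite /npr => + /nltP [w E]; rewrite E => e.
  suff : a ≺ a by apply: nltxx.
  apply/nltP; exists (a + b + b + (w + w) * (a + b) + w * w + w + w + c).
  apply: (@naddI _ ((a + b) * (a + b))); rewrite [LHS]addrC e; ring.
move=> e; have s : i + j = i' + j'.
  case: (ntotal (i + j) (i' + j')) => [/(sep _ _ _ _ e)//|[/(sep _ _ _ _ (esym e))//|//]].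
have ii : i = i' by move: e; rewrite /npr s ![_ + i]addrC ![_ + i']addrC => /naddI.
by move: s; rewrite ii ![i' + _]addrC => /naddI.
Qed.

End Pairing.

Record fr (M : rca) := Fr { fp : num M; fm : num M; fd : num M }.

Section Fractions.
Variable M : rca.
Local Notation N := (num M).
Local Notation fr := (fr M).
Implicit Types f g h : fr.

Definition fcode f : N := npr (npr (fp f) (fm f)) (fd f).

Definition feq f g := fp f * fd g + fm g * fd f = fp g * fd f + fm f * fd g.

Definition fcanon f :=
  0 ≺ fd f /\
  forall p m d, 0 ≺ d /\ feq (Fr p m d) f -> fcode f ≼ fcode (Fr p m d).

Definition fadd f g : fr :=
  Fr (fp f * fd g + fp g * fd f) (fm f * fd g + fm g * fd f) (fd f * fd g).

Definition fopp f : fr := Fr (fm f) (fp f) (fd f).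

Definition fmul f g : fr :=
  Fr (fp f * fp g + fm f * fm g) (fp f * fm g + fm f * fp g) (fd f * fd g).

Lemma fcode_inj f g : fcode f = fcode g -> f = g.
Proof. by case: f g => [p m d] [p' m' d'] /npr_inj [/npr_inj /= [-> ->] ->]. Qed.

Lemma feq_sym f g : feq f g -> feq g f.
Proof. by move=> e; apply/esym. Qed.

(** In the absence of subtraction, both sides are multiplied by [fd g] and padded with common terms
    until the hypotheses can be rewritten; cancellation does the rest. *)
Lemma feq_trans g f h : 0 ≺ fd g -> feq f g -> feq g h -> feq f h.
Proof.
rewrite /feq => /nlt_neq0 g0 e1 e2; apply: (nmulI g0).
apply: (@naddI _ (fm g * fd f * fd h + fp g * fd f * fd h)).
transitivity ((fp f * fd g + fm g * fd f) * fd h + (fp g * fd h + fm h * fd g) * fd f).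
  by ring.
by rewrite e1 e2; ring.
Qed.

Lemma nmul_gt0 (x y : N) : 0 ≺ x -> 0 ≺ y -> 0 ≺ x * y.
Proof. by move=> /nlt_neq0 x0 /nlt_neq0 y0; apply/nlt_neq0 => /nmul_eq0 []. Qed.

Lemma feq_add f f' g : feq f f' -> feq (fadd f g) (fadd f' g).
Proof.
rewrite /feq /= => e.
transitivity ((fp f * fd f' + fm f' * fd f) * (fd g * fd g) +
   (fp g * fd f * fd f' * fd g + fm g * fd f' * fd f * fd g)); first by ring.
by rewrite e; ring.
Qed.

Lemma feq_opp f f' : feq f f' -> feq (fopp f) (fopp f').
Proof. by rewrite /feq /= => e; rewrite addrC -e addrC. Qed.

Lemma feq_mul f f' g : feq f f' -> feq (fmul f g) (fmul f' g).
Proof.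
rewrite /feq /= => e.
transitivity ((fp f * fd f' + fm f' * fd f) * (fp g * fd g) +
   (fp f' * fd f + fm f * fd f') * (fm g * fd g)); first by ring.
transitivity ((fp f' * fd f + fm f * fd f') * (fp g * fd g) +
   (fp f * fd f' + fm f' * fd f) * (fm g * fd g)); first by rewrite e.
by ring.
Qed.

Lemma fcanon_unique f g : fcanon f -> fcanon g -> feq f g -> f = g.
Proof.
case: f g => [p m d] [p' m' d'] [f0 hf] [g0 hg] e; apply: fcode_inj; apply: nle_anti.
  by apply: hf; split=> //; apply: feq_sym.
exact: hg.
Qed.

Lemma fcanon_exists f : 0 ≺ fd f -> exists2 g, fcanon g & feq g f.
Proof.
move=> f0.
pose P z := exists p, exists m, exists d,
  z = npr (npr p m) d /\ (0 ≺ d /\ p * fd f + fm f * d = fp f * d + m * fd f).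
have [||z [[p [m [d [zE [d0 e]]]]] hz]] := @least_sigma _ P.
- rewrite /P /npr; df.
- by exists (fcode f), (fp f), (fm f), (fd f); split=> //; split=> //; rewrite addrC.
exists (Fr p m d) => //; split=> // p' m' d' [d0' e'].
apply/nlt_nle => lt; apply: (hz (fcode (Fr p' m' d'))); first by rewrite zE.
exists p', m', d'; split=> //; split=> //.
exact: (feq_trans (g := Fr p m d)) e' e.
Qed.

End Fractions.

Record krat (M : rca) := Krat { kfr : fr M; kcanon : fcanon kfr }.

Section Rationals.
Variable M : rca.
Local Notation N := (num M).
Local Notation K := (krat M).
Implicit Types (x y z : K) (f g : fr M).

Lemma krat_eq x y : feq (kfr x) (kfr y) -> x = y.
Proof.
case: x y => [f cf] [g cg] /= /(fcanon_unique cf cg) fg.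
by case: g / fg cg => cg; rewrite (Prop_irrelevance cf cg).
Qed.

Lemma one_gt0 : (0 : N) ≺ 1.
Proof. by apply/nlt_neq0/eqP; apply: oner_neq0. Qed.

(** The premise stands below the quantifier to make [kof] total; a zero denominator receives a
    default value. *)
Lemma norm_exists f : exists x : K, 0 ≺ fd f -> feq (kfr x) f.
Proof.
case: (pselect (0 ≺ fd f)) => [/fcanon_exists [g cg e]|n].
  by exists (Krat cg).
have [|g cg _] := @fcanon_exists M (Fr 0 0 1); first exact: one_gt0.
by exists (Krat cg).
Qed.

Definition kof f : K := sval (cid (norm_exists f)).

Lemma kofP f : 0 ≺ fd f -> feq (kfr (kof f)) f.
Proof. exact: (svalP (cid (norm_exists f))). Qed.

Lemma kfr_gt0 x : 0 ≺ fd (kfr x).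
Proof. by case: (kcanon x). Qed.

Lemma kof_eq f g : 0 ≺ fd f -> 0 ≺ fd g -> (kof f = kof g <-> feq f g).
Proof.
move=> f0 g0; split=> [e|e].
  apply: (feq_trans (g := kfr (kof f))); [exact: kfr_gt0|exact/feq_sym/kofP|].
  by rewrite e; apply: kofP.
apply: krat_eq; apply: (feq_trans f0 (kofP f0)).
by apply: (feq_trans g0 e); apply/feq_sym/kofP.
Qed.

Lemma kfrK x : kof (kfr x) = x.
Proof. by apply: krat_eq; apply: kofP; apply: kfr_gt0. Qed.

Definition kadd x y := kof (fadd (kfr x) (kfr y)).
Definition kopp x := kof (fopp (kfr x)).
Definition kmul x y := kof (fmul (kfr x) (kfr y)).
Definition kzero := kof (Fr 0 0 1).
Definition kone := kof (Fr 1 0 1).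

Lemma kadd_of f g : 0 ≺ fd f -> 0 ≺ fd g -> kadd (kof f) (kof g) = kof (fadd f g).
Proof.
move=> f0 g0; have kf0 := kfr_gt0 (kof f); have kg0 := kfr_gt0 (kof g).
apply/kof_eq; try exact: nmul_gt0.
apply: (feq_trans (g := fadd f (kfr (kof g)))); first exact: nmul_gt0.
  by apply: feq_add; apply: kofP.
have comm a b : fadd a b = fadd b a by rewrite /fadd; congr Fr; ring.
by rewrite comm [fadd f g]comm; apply: feq_add; apply: kofP.
Qed.

Lemma kmul_of f g : 0 ≺ fd f -> 0 ≺ fd g -> kmul (kof f) (kof g) = kof (fmul f g).
Proof.
move=> f0 g0; have kf0 := kfr_gt0 (kof f); have kg0 := kfr_gt0 (kof g).
apply/kof_eq; try exact: nmul_gt0.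
apply: (feq_trans (g := fmul f (kfr (kof g)))); first exact: nmul_gt0.
  by apply: feq_mul; apply: kofP.
have comm a b : fmul a b = fmul b a by rewrite /fmul; congr Fr; ring.
by rewrite comm [fmul f g]comm; apply: feq_mul; apply: kofP.
Qed.

Lemma kopp_of f : 0 ≺ fd f -> kopp (kof f) = kof (fopp f).
Proof.
by move=> f0; apply/kof_eq => //; [apply: kfr_gt0|apply: feq_opp; apply: kofP].
Qed.

Lemma krat_rep x : exists2 f, 0 ≺ fd f & x = kof f.
Proof. by exists (kfr x); [apply: kfr_gt0|rewrite kfrK]. Qed.

Ltac kpos := solve [assumption | exact: one_gt0 | apply: nmul_gt0 => /=; kpos].

Ltac kring := rewrite /kzero /kone ?(kadd_of, kmul_of, kopp_of) /=; try kpos;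
  apply/kof_eq => /=; try kpos; rewrite /feq /=; ring.

Lemma kaddA : associative kadd.
Proof.
move=> x y z; have [f f0 ->] := krat_rep x; have [g g0 ->] := krat_rep y.
by have [h h0 ->] := krat_rep z; kring.
Qed.

Lemma kaddC : commutative kadd.
Proof. by move=> x y; have [f f0 ->] := krat_rep x; have [g g0 ->] := krat_rep y; kring. Qed.

Lemma kadd0 : left_id kzero kadd.
Proof.
by move=> x; have [f f0 ->] := krat_rep x; kring.
Qed.

Lemma kaddN : left_inverse kzero kopp kadd.
Proof. by move=> x; have [f f0 ->] := krat_rep x; kring. Qed.

Lemma kmulA : associative kmul.
Proof.
move=> x y z; have [f f0 ->] := krat_rep x; have [g g0 ->] := krat_rep y.
by have [h h0 ->] := krat_rep z; kring.
Qed.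

Lemma kmulC : commutative kmul.
Proof. by move=> x y; have [f f0 ->] := krat_rep x; have [g g0 ->] := krat_rep y; kring. Qed.

Lemma kmul1 : left_id kone kmul.
Proof. by move=> x; have [f f0 ->] := krat_rep x; kring. Qed.

Lemma kmulDl : left_distributive kmul kadd.
Proof.
move=> x y z; have [f f0 ->] := krat_rep x; have [g g0 ->] := krat_rep y.
by have [h h0 ->] := krat_rep z; kring.
Qed.

Lemma kone_neq0 : kone <> kzero.
Proof.
move/kof_eq => /=; rewrite /feq /= => h; have := h one_gt0 one_gt0.
by rewrite !mul0r !mul1r !addr0; apply/eqP; apply: oner_neq0.
Qed.

Definition kge0 x := fm (kfr x) ≼ fp (kfr x).

Lemma feq_ge0 f g : 0 ≺ fd f -> feq f g -> fm f ≼ fp f -> fm g ≼ fp g.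
Proof.
move=> /nlt_neq0 f0 e /nleP [v vE]; apply/nlt_nle => /nltP [w wE].
move: e; rewrite /feq vE wE => e.
have /naddn0 [_ /nmul_eq0 [/addn1_neq0//|//]] : v * fd g + (w + 1) * fd f = 0.
apply: (@naddI _ (fm f * fd g + fp g * fd f)); rewrite add0r [RHS]addrC -e; ring.
Qed.

Lemma kge0_of f : 0 ≺ fd f -> (kge0 (kof f) <-> fm f ≼ fp f).
Proof.
move=> f0; split; first exact: feq_ge0 (kfr_gt0 _) (kofP f0).
by apply: feq_ge0 f0 (feq_sym (kofP f0)).
Qed.

Lemma kinv_exists x : exists y, (x <> kzero -> kmul y x = kone) /\ (x = kzero -> y = x).
Proof.
case: (pselect (x = kzero)) => [->|x0]; first by exists kzero.
have [f f0 E] := krat_rep x; rewrite E in x0 *.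
case: (ntotal (fm f) (fp f)) => [/nltP [w wE]|[/nltP [w wE]|e]].
- have w0 : 0 ≺ w + 1 by apply/nlt_neq0/addn1_neq0.
  exists (kof (Fr (fd f) 0 (w + 1))); split=> // _; rewrite kmul_of //.
  apply/kof_eq => /=; [exact: nmul_gt0|exact: one_gt0|].
  by rewrite /feq /= wE; ring.
- have w0 : 0 ≺ w + 1 by apply/nlt_neq0/addn1_neq0.
  exists (kof (Fr 0 (fd f) (w + 1))); split=> // _; rewrite kmul_of //.
  apply/kof_eq => /=; [exact: nmul_gt0|exact: one_gt0|].
  by rewrite /feq /= wE; ring.
case: x0; apply/kof_eq => //; first exact: one_gt0.
by rewrite /feq /= e; ring.
Qed.

Definition kinv x := sval (cid (kinv_exists x)).

End Rationals.

HB.instance Definition _ (M : rca) := gen_eqMixin (krat M).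
HB.instance Definition _ (M : rca) := gen_choiceMixin (krat M).
HB.instance Definition _ (M : rca) :=
  GRing.isZmodule.Build (krat M) (@kaddA M) (@kaddC M) (@kadd0 M) (@kaddN M).

Lemma krat_one_neq0 (M : rca) : kone M != 0 :> krat M.
Proof. by apply/eqP; apply: kone_neq0. Qed.

HB.instance Definition _ (M : rca) :=
  GRing.Zmodule_isComNzRing.Build (krat M) (@kmulA M) (@kmulC M) (@kmul1 M)
    (@kmulDl M) (@krat_one_neq0 M).

Section Field.
Variable M : rca.
Local Notation K := (krat M).
Implicit Types x y z : K.

Lemma kmulVf x : x != 0 -> kinv x * x = 1.
Proof. by move/eqP => x0; rewrite /kinv; case: cid => y /= [/(_ x0)]. Qed.

Lemma kinv0 : kinv (0 : K) = 0.
Proof. by rewrite /kinv; case: cid => y /= [_ h]; apply: h. Qed.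

End Field.

HB.instance Definition _ (M : rca) :=
  GRing.ComNzRing_isField.Build (krat M) (@kmulVf M) (@kinv0 M).

Section FieldOrder.
Variable M : rca.
Local Notation K := (krat M).
Implicit Types x y z : K.

Definition kle x y : bool := `[< kge0 (y - x) >].
Definition klt x y : bool := (y != x) && kle x y.
Definition kabs x : K := if kle 0 x then x else - x.

Lemma kge0_add x y : kge0 x -> kge0 y -> kge0 (x + y).
Proof.
have [f f0 ->] := krat_rep x; have [g g0 ->] := krat_rep y.
have -> : kof f + kof g = kof (fadd f g) by exact: kadd_of.
move=> /(kge0_of f0) /nleP [u uE] /(kge0_of g0) /nleP [v vE].
apply/kge0_of; first exact: nmul_gt0.
by apply/nleP; exists (u * fd g + v * fd f); rewrite /= uE vE; ring.
Qed.

Lemma kge0_mul x y : kge0 x -> kge0 y -> kge0 (x * y).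
Proof.
have [f f0 ->] := krat_rep x; have [g g0 ->] := krat_rep y.
have -> : kof f * kof g = kof (fmul f g) by exact: kmul_of.
move=> /(kge0_of f0) /nleP [u uE] /(kge0_of g0) /nleP [v vE].
apply/kge0_of; first exact: nmul_gt0.
by apply/nleP; exists (u * v); rewrite /= uE vE; ring.
Qed.

Lemma kge0_opp x : kge0 (- x) <-> fp (kfr x) ≼ fm (kfr x).
Proof. by apply: (kge0_of (f := fopp (kfr x))); apply: kfr_gt0. Qed.

Lemma kge0_anti x : kge0 x -> kge0 (- x) -> x = 0.
Proof.
move=> h /kge0_opp h'; rewrite -[x]kfrK; apply/kof_eq; rewrite /feq /=.
- exact: kfr_gt0.
- exact: one_gt0.
by rewrite (nle_anti h h'); ring.
Qed.

Lemma kge0_total x : kge0 x \/ kge0 (- x).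
Proof.
rewrite kge0_opp /kge0; case: (ntotal (fm (kfr x)) (fp (kfr x))); last by right.
by move=> ?; left; left.
Qed.

Lemma kle0E x : kle 0 x = `[< kge0 x >]. Proof. by rewrite /kle subr0. Qed.
Lemma kleN x : kle x 0 = `[< kge0 (- x) >]. Proof. by rewrite /kle sub0r. Qed.

Lemma kle0_add x y : kle 0 x -> kle 0 y -> kle 0 (x + y).
Proof. by rewrite !kle0E => /asboolP ? /asboolP ?; apply/asboolP/kge0_add. Qed.

Lemma kle0_mul x y : kle 0 x -> kle 0 y -> kle 0 (x * y).
Proof. by rewrite !kle0E => /asboolP ? /asboolP ?; apply/asboolP/kge0_mul. Qed.

Lemma kle0_anti x : kle 0 x -> kle x 0 -> x = 0.
Proof. by rewrite kle0E kleN => /asboolP ? /asboolP ?; apply: kge0_anti. Qed.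

Lemma ksub_ge0 x y : kle 0 (y - x) = kle x y.
Proof. by rewrite kle0E. Qed.

Lemma kle0_total x : kle 0 x || kle x 0.
Proof. by rewrite kle0E kleN; apply/orP; case: (kge0_total x) => ?; [left|right]; apply/asboolP. Qed.

Lemma kabsN x : kabs (- x) = kabs x.
Proof.
rewrite /kabs !kle0E; case: asboolP => [a|a]; case: asboolP => [b|b] //; last first.
- by case: (kge0_total x).
- by rewrite opprK.
by rewrite (kge0_anti b a) oppr0.
Qed.

Lemma kge0_abs x : kle 0 x -> kabs x = x.
Proof. by rewrite /kabs => ->. Qed.

End FieldOrder.

HB.instance Definition _ (M : rca) :=
  Num.IntegralDomain_isLeReal.Build (krat M) (@kle0_add M) (@kle0_mul M)
    (@kle0_anti M) (@ksub_ge0 M) (@kle0_total M) (@kabsN M) (@kge0_abs M)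
    (fun x y => erefl (klt x y)).

(** * Embedding of the numbers and definability of rational operations *)

Definition ite T (P : Prop) (x y : T) : T := if `[< P >] then x else y.

Lemma iteT T (P : Prop) (x y : T) : P -> ite P x y = x.
Proof. by rewrite /ite; case: asboolP. Qed.

Lemma iteF T (P : Prop) (x y : T) : ~ P -> ite P x y = y.
Proof. by rewrite /ite; case: asboolP. Qed.

Section Embedding.
Variable M : rca.
Local Notation N := (num M).
Local Notation K := (krat M).
Implicit Types (x y : K) (f g : fr M) (n m : N).

Definition inj n : K := kof (Fr n 0 1).

Lemma inj0 : inj 0 = 0. Proof. by []. Qed.

Lemma inj1 : inj 1 = 1. Proof. by []. Qed.

Lemma injD n m : inj (n + m) = inj n + inj m.
Proof.
have h := one_gt0 M; symmetry; rewrite /inj.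
transitivity (kof (fadd (Fr n 0 1) (Fr m 0 1))); first exact: kadd_of.
by congr kof; rewrite /fadd /=; congr Fr; ring.
Qed.

Lemma injM n m : inj (n * m) = inj n * inj m.
Proof.
have h := one_gt0 M; symmetry; rewrite /inj.
transitivity (kof (fmul (Fr n 0 1) (Fr m 0 1))); first exact: kmul_of.
by congr kof; rewrite /fmul /=; congr Fr; ring.
Qed.

Lemma kge0E x : (0 <= x) = `[< kge0 x >].
Proof. exact: kle0E. Qed.

Lemma inj_ge0 n : 0 <= inj n.
Proof.
by rewrite kge0E; apply/asboolP/kge0_of; [apply: one_gt0|apply: nle0].
Qed.

Lemma inj_lt n m : inj n < inj m <-> n ≺ m.
Proof.
have imp a b : a ≺ b -> inj a < inj b.
  move=> /nltP [w ->]; rewrite !injD inj1; have := inj_ge0 w; lra.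
split; last exact: imp.
case: (ntotal n m) => // -[/imp|->]; lra.
Qed.

Lemma inj_le n m : inj n <= inj m <-> n ≼ m.
Proof.
split=> [h|/nleP [w ->]]; last by rewrite injD; have := inj_ge0 w; lra.
by apply/nlt_nle => /inj_lt; lra.
Qed.

Lemma kofE f : 0 ≺ fd f -> kof f = (inj (fp f) - inj (fm f)) / inj (fd f).
Proof.
move=> f0; have d0 : inj (fd f) != 0.
  by have := inj_lt 0 (fd f); rewrite inj0 => -[_ /(_ f0)]; lra.
apply: (mulIf d0); rewrite mulfVK //; apply: (@addIr _ (inj (fm f))); rewrite subrK.
have h := one_gt0 M; have h' := nmul_gt0 f0 h.
transitivity (kof (fadd (fmul f (Fr (fd f) 0 1)) (Fr (fm f) 0 1))).
  rewrite -kadd_of // -kmul_of //.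
apply/kof_eq => //=; first exact: nmul_gt0.
by rewrite /feq /=; ring.
Qed.

Lemma kratE x : x = (inj (fp (kfr x)) - inj (fm (kfr x))) / inj (fd (kfr x)).
Proof. by rewrite -{1}[x]kfrK kofE //; apply: kfr_gt0. Qed.

Lemma inj_gt0 n : 0 ≺ n -> 0 < inj n.
Proof. by move/inj_lt; rewrite inj0. Qed.

Lemma kof_lt f g : 0 ≺ fd f -> 0 ≺ fd g ->
  (kof f < kof g <-> fp f * fd g + fm g * fd f ≺ fp g * fd f + fm f * fd g).
Proof.
move=> f0 g0; rewrite !kofE // -inj_lt !injD !injM.
rewrite ltr_pdivrMr ?inj_gt0 // mulrAC ltr_pdivlMr ?inj_gt0 //.
by split=> h; lra.
Qed.

(** The denominator is at least one, so the positive part of the numerator plus one is large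
    enough. *)
Lemma archimedean x : exists n, x < inj n.
Proof.
have d0 := kfr_gt0 x; exists (fp (kfr x) + 1); rewrite injD inj1.
have D1 : 1 <= inj (fd (kfr x)).
  rewrite -inj1; apply/inj_le; case: (ncase (fd (kfr x))) d0 => [->/nlt0//|[w ->]] _.
  exact: nle_addl.
rewrite {1}(kratE x) ltr_pdivrMr; last by lra.
have := inj_ge0 (fm (kfr x)); have := inj_ge0 (fp (kfr x)).
move: (inj _) (inj _) (inj _) D1 => a b c; nra.
Qed.

Definition kcode x : N := fcode (kfr x).

Lemma kcode_inj x y : kcode x = kcode y -> x = y.
Proof. by move/fcode_inj => e; apply: krat_eq; rewrite /feq e. Qed.

Lemma fcanon_kof f : fcanon f -> kfr (kof f) = f.
Proof.
move=> cf; apply: fcanon_unique => //; first exact: kcanon.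
by apply: kofP; case: cf.
Qed.

Lemma fcode_lel f : npr (fp f) (fm f) ≼ fcode f.
Proof. exact: npr_lel. Qed.

(** A competitor of smaller code has its components below that code. Bounding the quantifiers in
    this way makes canonicity Delta_1. *)
Lemma fcanon_bounded f : fcanon f <->
  0 ≺ fd f /\ forall p, p ≼ fcode f -> forall m, m ≼ fcode f -> forall d, d ≼ fcode f ->
    0 ≺ d -> feq (Fr p m d) f -> fcode f ≼ fcode (Fr p m d).
Proof.
split=> -[f0 hf]; split=> //; first by move=> *; apply: hf.
move=> p m d [d0 e]; apply/nlt_nle => lt.
suff : fcode f ≼ fcode (Fr p m d) by move/nlt_nle.
apply: hf => //.
- apply: (nle_trans (npr_lel p m)); apply: nle_trans (fcode_lel (Fr p m d)) _; by left.
- apply: (nle_trans (npr_ler p m)); apply: nle_trans (fcode_lel (Fr p m d)) _; by left.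
- apply: (nle_trans (npr_ler (npr p m) d)); by left.
Qed.

(* Rationals are represented by their codes; other numbers are read as 0. *)
Definition kdec n : K :=
  if pselect (exists x, n = kcode x) is left h then sval (cid h) else 0.

Lemma kcodeK x : kdec (kcode x) = x.
Proof.
rewrite /kdec; case: pselect => [h|[]]; last by exists x.
by case: cid => y /= /kcode_inj.
Qed.

Lemma kdecK n : (exists x, n = kcode x) -> kcode (kdec n) = n.
Proof. by move=> [x ->]; rewrite kcodeK. Qed.

Definition RK (f : (nat -> N) -> K) := R1 (fun e => kcode (f e)).

Definition is_code n := exists p, p ≼ n /\ exists m, m ≼ n /\ exists d, d ≼ n /\
  (n = npr (npr p m) d /\ fcanon (Fr p m d)).

Lemma is_codeP n : is_code n <-> exists x, n = kcode x.
Proof.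
split=> [[p [_ [m [_ [d [_ [-> c]]]]]]]|[x ->]].
  by exists (kof (Fr p m d)); rewrite /kcode fcanon_kof.
have c := kcanon x; case E : (kfr x) c => [p m d] c; rewrite /kcode E.
exists p; split; first exact: nle_trans (npr_lel p m) (npr_lel _ d).
exists m; split; first exact: nle_trans (npr_ler p m) (npr_lel _ d).
by exists d; split=> //; apply: npr_ler.
Qed.

Lemma R1_npr (f g : (nat -> N) -> N) : R1 f -> R1 g -> R1 (fun e => npr (f e) (g e)).
Proof. by move=> rf rg; rewrite /npr; df. Qed.

Lemma D1_fcanon (p m d : (nat -> N) -> N) :
  R1 p -> R1 m -> R1 d -> D1 (fun e => fcanon (Fr (p e) (m e) (d e))).
Proof.
apply: (@D1_rel3 M (fun p m d => fcanon (Fr p m d))).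
apply: D1_ext (fun e => iff_sym (fcanon_bounded _)) _.
by rewrite /fcode /feq /npr /=; df.
Qed.

Lemma D1_is_code (f : (nat -> N) -> N) : R1 f -> D1 (fun e => is_code (f e)).
Proof.
apply: (@D1_rel1 M is_code); apply: D1_bexe; first by df.
apply: D1_bexe; first by df.
apply: D1_bexe; first by df.
by apply: D1_and; [rewrite /npr; df|apply: D1_fcanon; df].
Qed.

Lemma RK_const x : RK (fun=> x).
Proof. exact: R1_const. Qed.

Lemma RK_kdec (f : (nat -> N) -> N) : R1 f -> RK (fun e => kdec (f e)).
Proof.
apply: (@R1_fun1 M (fun n => kcode (kdec n))).
apply: (R1_graph (G := fun e (v : N) =>
  is_code (e 0%N) /\ v = e 0%N \/ ~ is_code (e 0%N) /\ v = kcode 0)); last first.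
  apply: S1_D1; apply: D1_or; apply: D1_and; try by df.
    by apply: D1_is_code; df.
  by apply: D1_not; apply: D1_is_code; df.
move=> e v; case: (pselect (is_code (e 0%N))) => c.
  by rewrite kdecK; [tauto|apply/is_codeP].
suff -> : kdec (e 0%N) = 0 by tauto.
by rewrite /kdec; case: pselect => // h; case: c; apply/is_codeP.
Qed.

Lemma R1_fp (f : (nat -> N) -> K) : RK f -> R1 (fun e => fp (kfr (f e))).
Proof.
move=> rf; apply: (R1_graph (G := fun e (v : N) => exists m d, kcode (f e) = npr (npr v m) d)).
  move=> e y; split=> [->|[m [d h]]]; last by have [h1 _] := npr_inj h; have [-> _] := npr_inj h1.
  by exists (fm (kfr (f e))), (fd (kfr (f e))).
apply: S1_ex; apply: S1_ex; apply: S1_D1; apply: D1_eq; last by rewrite /npr; df.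
exact: (R1_ren (fun i => i.+3) rf).
Qed.

Lemma R1_fm (f : (nat -> N) -> K) : RK f -> R1 (fun e => fm (kfr (f e))).
Proof.
move=> rf; apply: (R1_graph (G := fun e (v : N) => exists p d, kcode (f e) = npr (npr p v) d)).
  move=> e y; split=> [->|[m [d h]]]; last by have [h1 _] := npr_inj h; have [_ ->] := npr_inj h1.
  by exists (fp (kfr (f e))), (fd (kfr (f e))).
apply: S1_ex; apply: S1_ex; apply: S1_D1; apply: D1_eq; last by rewrite /npr; df.
exact: (R1_ren (fun i => i.+3) rf).
Qed.

Lemma R1_fd (f : (nat -> N) -> K) : RK f -> R1 (fun e => fd (kfr (f e))).
Proof.
move=> rf; apply: (R1_graph (G := fun e (v : N) => exists p m, kcode (f e) = npr (npr p m) v)).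
  move=> e y; split=> [->|[m [d h]]]; last by have [_ ->] := npr_inj h.
  by exists (fp (kfr (f e))), (fm (kfr (f e))).
apply: S1_ex; apply: S1_ex; apply: S1_D1; apply: D1_eq; last by rewrite /npr; df.
exact: (R1_ren (fun i => i.+3) rf).
Qed.

Lemma RK_kof (p m d : (nat -> N) -> N) : (forall e, 0 ≺ d e) ->
  R1 p -> R1 m -> R1 d -> RK (fun e => kof (Fr (p e) (m e) (d e))).
Proof.
move=> d0 rp rm rd.
apply: (R1_graph (G := fun e (v : N) => exists p' m' d', v = npr (npr p' m') d' /\
  (fcanon (Fr p' m' d') /\ p' * d e + m e * d' = p e * d' + m' * d e))).
  move=> e y; split=> [->|[p' [m' [d' [-> [c h]]]]]].
    have c := kcanon (kof (Fr (p e) (m e) (d e))).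
    have h := @kofP M (Fr (p e) (m e) (d e)) (d0 e).
    rewrite /kcode; case: (kfr _) c h => [p' m' d'] c h.
    by exists p', m', d'; split=> //; split=> //; rewrite [LHS]h.
  have d'0 : 0 ≺ d' by case: c.
  have -> : npr (npr p' m') d' = kcode (kof (Fr p' m' d')) by rewrite /kcode fcanon_kof.
  by congr kcode; apply/kof_eq => //; apply: d0.
have r (t : (nat -> N) -> N) : R1 t -> R1 (fun e => t (fun i => e i.+4)) by apply: (R1_ren (fun i => i.+4)).
apply: S1_ex; apply: S1_ex; apply: S1_ex; apply: S1_and; first by rewrite /npr; df.
apply: S1_and; first by apply: S1_D1; apply: D1_fcanon; df.
have := r _ rp; have := r _ rm; have := r _ rd => rd' rm' rp'.
by apply: S1_D1; apply: D1_eq; apply: R1_add; apply: R1_mul => //; df.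
Qed.

Lemma RK_inj (f : (nat -> N) -> N) : R1 f -> RK (fun e => inj (f e)).
Proof. by move=> rf; apply: RK_kof => [e|||]; [apply: one_gt0|df..]. Qed.

Lemma RK_add (f g : (nat -> N) -> K) : RK f -> RK g -> RK (fun e => f e + g e).
Proof.
move=> rf rg; apply: RK_kof => [e|||]; first by apply: nmul_gt0; apply: kfr_gt0.
all: by do ?[apply: R1_add|apply: R1_mul]; try apply: R1_fp; try apply: R1_fm; try apply: R1_fd.
Qed.

Lemma RK_mul (f g : (nat -> N) -> K) : RK f -> RK g -> RK (fun e => f e * g e).
Proof.
move=> rf rg; apply: RK_kof => [e|||]; first by apply: nmul_gt0; apply: kfr_gt0.
all: by do ?[apply: R1_add|apply: R1_mul]; try apply: R1_fp; try apply: R1_fm; try apply: R1_fd.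
Qed.

Lemma RK_opp (f : (nat -> N) -> K) : RK f -> RK (fun e => - f e).
Proof.
move=> rf; apply: RK_kof => [e|||]; first exact: kfr_gt0.
all: by try apply: R1_fp; try apply: R1_fm; try apply: R1_fd.
Qed.

Lemma D1_klt (f g : (nat -> N) -> K) : RK f -> RK g -> D1 (fun e => f e < g e).
Proof.
move=> rf rg; apply: (D1_ext (P := fun e =>
  fp (kfr (f e)) * fd (kfr (g e)) + fm (kfr (g e)) * fd (kfr (f e)) ≺
  fp (kfr (g e)) * fd (kfr (f e)) + fm (kfr (f e)) * fd (kfr (g e)))).
  move=> e; rewrite -[f e in X in _ <-> X]kfrK -[g e in X in _ <-> X]kfrK.
  by rewrite kof_lt //; apply: kfr_gt0.
by apply: D1_lt; do ?[apply: R1_add|apply: R1_mul]; try apply: R1_fp; try apply: R1_fm;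
  try apply: R1_fd.
Qed.

Lemma D1_kle (f g : (nat -> N) -> K) : RK f -> RK g -> D1 (fun e => f e <= g e).
Proof.
move=> rf rg; apply: (D1_ext (P := fun e => ~ (g e < f e))).
  by move=> e; rewrite leNgt; split=> [/negP|/negP].
by apply: D1_not; apply: D1_klt.
Qed.

Lemma D1_keq (f g : (nat -> N) -> K) : RK f -> RK g -> D1 (fun e => f e = g e).
Proof.
move=> rf rg; apply: (D1_ext (P := fun e => kcode (f e) = kcode (g e))).
  by move=> e; split=> [/kcode_inj|->].
by apply: D1_eq.
Qed.

Lemma RK_ren (r : nat -> nat) (f : (nat -> N) -> K) :
  RK f -> RK (fun e => f (fun i => e (r i))).
Proof. exact: (R1_ren r (f := fun e => kcode (f e))). Qed.

(** The graph is read off the equation that defines an inverse, with the convention that the inverse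
    of zero is zero. *)
Lemma RK_inv (f : (nat -> N) -> K) : RK f -> RK (fun e => (f e)^-1).
Proof.
move=> rf; apply: (R1_graph (G := fun e (v : N) => is_code v /\
   (kdec v * f e = 1 \/ f e = 0 /\ kdec v = 0))).
  move=> e y; split=> [->|[/is_codeP [x ->]]]; rewrite kcodeK.
    split; first by apply/is_codeP; exists (f e)^-1.
    case: (eqVneq (f e) 0) => [->|/mulVf]; last by left.
    by right; rewrite invr0.
  case=> [h|[-> ->]]; last by rewrite invr0.
  have f0 : f e != 0 by apply/eqP => f0; move: h; rewrite f0 mulr0 => /esym/eqP; rewrite oner_eq0.
  by congr kcode; apply: (mulIf f0); rewrite mulVf.
have := RK_ren (fun i => i.+1) rf => rf'.
have ry : RK (fun e : nat -> N => kdec (e 0%N)) by apply: RK_kdec; apply: R1_var.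
apply: S1_D1; apply: D1_and; first by apply: D1_is_code; df.
apply: D1_or; first by apply: D1_keq; [apply: RK_mul|apply: RK_const].
by apply: D1_and; apply: D1_keq => //; apply: RK_const.
Qed.

Lemma R1_if (P : (nat -> N) -> Prop) (f g : (nat -> N) -> N) :
  D1 P -> R1 f -> R1 g -> R1 (fun e => ite (P e) (f e) (g e)).
Proof.
move=> dP rf rg; apply: (R1_graph (G := fun e (v : N) => P e /\ v = f e \/ ~ P e /\ v = g e)).
  by move=> e y; rewrite /ite; case: asboolP => h; tauto.
have dP' : D1 (fun e => P (fun i => e i.+1)) by apply: (D1_ren (fun i => i.+1)).
have rf' : R1 (fun e => f (fun i => e i.+1)) by apply: (R1_ren (fun i => i.+1)).
have rg' : R1 (fun e => g (fun i => e i.+1)) by apply: (R1_ren (fun i => i.+1)).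
have r0 : R1 (fun e : nat -> N => e 0%N) by df.
by apply: S1_D1; apply: D1_or; apply: D1_and => //;
  [exact: D1_eq|exact: D1_not|exact: D1_eq].
Qed.

Lemma RK_if (P : (nat -> N) -> Prop) (f g : (nat -> N) -> K) :
  D1 P -> RK f -> RK g -> RK (fun e => ite (P e) (f e) (g e)).
Proof.
move=> dP rf rg.
have := R1_if dP rf rg; congr R1; apply: funext => e.
by rewrite /ite; case: ifP.
Qed.

End Embedding.

(** * Decoding of pairs *)

Section Projections.
Variable M : rca.
Local Notation N := (num M).
Implicit Types z i j : N.

Lemma npr1_exists z : exists i, (exists j, z = npr i j) \/ ~ (exists i j, z = npr i j) /\ i = 0.
Proof.
case: (pselect (exists i j, z = npr i j)) => [[i h]|n]; first by exists i; left.
by exists 0; right.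
Qed.

Lemma npr2_exists z : exists j, (exists i, z = npr i j) \/ ~ (exists i j, z = npr i j) /\ j = 0.
Proof.
case: (pselect (exists i j, z = npr i j)) => [[i [j h]]|n]; first by exists j; left; exists i.
by exists 0; right.
Qed.

Definition npr1 z : N := sval (cid (npr1_exists z)).
Definition npr2 z : N := sval (cid (npr2_exists z)).

Lemma npr1K i j : npr1 (npr i j) = i.
Proof.
rewrite /npr1; case: cid => i' /= [[j' /npr_inj []//]|[n _]].
by case: n; exists i, j.
Qed.

Lemma npr2K i j : npr2 (npr i j) = j.
Proof.
rewrite /npr2; case: cid => j' /= [[i' /npr_inj []//]|[n _]].
by case: n; exists i, j.
Qed.

Lemma npr_bounded z :
  (exists i j, z = npr i j) <-> exists i, i ≼ z /\ exists j, j ≼ z /\ z = npr i j.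
Proof.
split=> [[i [j ->]]|[i [_ [j [_ ->]]]]]; last by exists i, j.
by exists i; split; [apply: npr_lel|exists j; split; first exact: npr_ler].
Qed.

Lemma R1_npr1 (f : (nat -> N) -> N) : R1 f -> R1 (fun e => npr1 (f e)).
Proof.
apply: R1_fun1; apply: (R1_graph (G := fun e (i : N) => (exists j, e 0%N = npr i j) \/
  ~ (exists i, i ≼ e 0%N /\ exists j, j ≼ e 0%N /\ e 0%N = npr i j) /\ i = 0)).
  move=> e i; rewrite -npr_bounded /npr1; case: cid => k /= h; split=> [->//|].
  case: h => [[j ->]|[n ->]] [[j' h']|[n' ->]] //; first by have [] := npr_inj h'.
    by case: n'; exists k, j.
  by case: n; exists i, j'.
by rewrite /npr; df.
Qed.

Lemma R1_npr2 (f : (nat -> N) -> N) : R1 f -> R1 (fun e => npr2 (f e)).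
Proof.
apply: R1_fun1; apply: (R1_graph (G := fun e (j : N) => (exists i, e 0%N = npr i j) \/
  ~ (exists i, i ≼ e 0%N /\ exists j, j ≼ e 0%N /\ e 0%N = npr i j) /\ j = 0)).
  move=> e j; rewrite -npr_bounded /npr2; case: cid => k /= h; split=> [->//|].
  case: h => [[i ->]|[n ->]] [[i' h']|[n' ->]] //; first by have [] := npr_inj h'.
    by case: n'; exists i, k.
  by case: n; exists i', j.
by rewrite /npr; df.
Qed.

End Projections.

Lemma RK_fun1 (M : rca) (x : num M -> krat M) (f : (nat -> num M) -> num M) :
  RK (fun e => x (e 0%N)) -> R1 f -> RK (fun e => x (f e)).
Proof. exact: (@R1_fun1 M (fun n => kcode (x n))). Qed.

Lemma RK_fun2 (M : rca) (x : num M -> num M -> krat M) (f g : (nat -> num M) -> num M) :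
  RK (fun e => x (e 0%N) (e 1%N)) -> R1 f -> R1 g -> RK (fun e => x (f e) (g e)).
Proof. exact: (@R1_fun2 M (fun n m => kcode (x n m))). Qed.

Ltac df_hook ::=
  lazymatch goal with
  | |- D1 (fun e => is_true ((@?f e) < (@?g e))) => apply: D1_klt; df
  | |- D1 (fun e => is_true ((@?f e) <= (@?g e))) => apply: D1_kle; df
  | |- D1 (fun e => @eq _ (@?f e) (@?g e)) => apply: D1_keq; df
  | |- R1 (fun e => npr (@?f e) (@?g e)) => apply: R1_npr; df
  | |- R1 (fun e => npr1 (@?f e)) => apply: R1_npr1; df
  | |- R1 (fun e => npr2 (@?f e)) => apply: R1_npr2; df
  | |- R1 (fun e => kcode (@?f e)) => change (RK f); df
  | |- R1 (fun e => ite (@?P e) (@?f e) (@?g e)) => apply: R1_if; df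
  | |- RK (fun e => @GRing.add _ (@?f e) (@?g e)) => apply: RK_add; df
  | |- RK (fun e => @GRing.mul _ (@?f e) (@?g e)) => apply: RK_mul; df
  | |- RK (fun e => @GRing.opp _ (@?f e)) => apply: RK_opp; df
  | |- RK (fun e => @GRing.inv _ (@?f e)) => apply: RK_inv; df
  | |- RK (fun e => inj (@?f e)) => apply: RK_inj; df
  | |- RK (fun e => kdec (@?f e)) => apply: RK_kdec; df
  | |- RK (fun e => ite (@?P e) (@?f e) (@?g e)) => apply: RK_if; df
  | |- RK _ => first
      [ apply: RK_const
      | apply: RK_fun2; [df_known|df|df]
      | apply: RK_fun1; [df_known|df] ]
  end.
(** * Primitive recursion *)

Section Recursion.
Variable M : rca.
Local Notation N := (num M).
Implicit Types a b i j k m n q r y : N.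

Lemma division m a : m <> 0 -> exists q, q ≼ a /\ exists r, r ≺ m /\ a = q * m + r.
Proof.
move=> m0.
have [w mE] : exists w, m = w + 1 by case: (ncase m).
suff [q [r [rm ->]]] : exists q r, r ≺ m /\ a = q * m + r.
  exists q; split; last by exists r.
  by apply/nleP; exists (q * w + r); rewrite mE; ring.
elim/nind: a => [||a [q [r [rm ->]]]]; first by df.
  by exists 0, 0; split; [apply/nlt_neq0|ring].
case: (pselect (r = w)) => [->|rw].
  by exists (q + 1), 0; split; [apply/nlt_neq0|rewrite mE; ring].
exists q, (r + 1); split; last by ring.
move: rm; rewrite mE => /nltS [/nltP [v ->]|//].
by apply/nltP; exists v; ring.
Qed.

Lemma division_unique m q q' r r' :
  r ≺ m -> r' ≺ m -> q * m + r = q' * m + r' -> q = q' /\ r = r'.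
Proof.
have lt u v s t : s ≺ m -> u ≺ v -> u * m + s <> v * m + t.
  move=> /nltP [w ->] /nltP [z ->] e; have := @nltxx M (u * (s + w + 1) + s).
  by apply; rewrite {2}e; apply/nltP; exists (z * (s + w + 1) + w + t); ring.
move=> rm r'm e; have qq : q = q'.
  by case: (ntotal q q') => [/(lt _ _ _ r' rm)/(_ e)|[/(lt _ _ _ r r'm)/(_ (esym e))|]].
by split=> //; move: e; rewrite qq addrC [RHS]addrC => /naddI.
Qed.

Lemma remainder_exists a m : exists r, m <> 0 -> r ≺ m /\ exists q, q ≼ a /\ a = q * m + r.
Proof.
case: (pselect (m = 0)) => [->|m0]; first by exists 0.
have [q [qa [r [rm e]]]] := division a m0.
by exists r => _; split=> //; exists q.
Qed.

Definition remainder a m := sval (cid (remainder_exists a m)).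

Lemma remainderP a m : m <> 0 ->
  remainder a m ≺ m /\ exists q, q ≼ a /\ a = q * m + remainder a m.
Proof. by move=> m0; rewrite /remainder; case: cid => r /= /(_ m0). Qed.

Lemma remainder_unique a m q r : r ≺ m -> a = q * m + r -> remainder a m = r.
Proof.
move=> rm e; have m0 : m <> 0 by move=> m0; move: rm; rewrite m0 => /nlt0.
have [lt [q' [_ e']]] := remainderP a m0.
by rewrite e' in e; have [_] := division_unique lt rm e.
Qed.

Definition beta a b i := remainder a ((i + 1) * b + 1).

Lemma R1_beta : R1 (fun e : nat -> N => beta (e 0%N) (e 1%N) (e 2%N)).
Proof.
apply: (R1_graph (G := fun e (r : N) => r ≺ (e 2%N + 1) * e 1%N + 1 /\
  exists q, q ≼ e 0%N /\ e 0%N = q * ((e 2%N + 1) * e 1%N + 1) + r)); last by df.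
move=> e r; split=> [->|[lt [q [_ E]]]].
  exact/remainderP/addn1_neq0.
by rewrite /beta (remainder_unique lt E).
Qed.

(** Stands in for the factorial, whose definition would already require primitive recursion. *)
Lemma common_multiple n : exists b, b <> 0 /\ forall j, j ≼ n -> j <> 0 -> exists c, b = c * j.
Proof.
elim/nind: n => [||n [b [b0 hb]]]; first by df.
  by exists 1; split=> [|j [/nlt0//|->//]]; apply/eqP/oner_neq0.
exists (b * (n + 1)); split; first by move/nmul_eq0 => [//|/addn1_neq0].
move=> j [/nltS jn j0|-> _]; last by exists b.
by have [c ->] := hb j jn j0; exists (c * (n + 1)); ring.
Qed.

(* Goedel's beta function: the moduli (i + 1) b + 1 are pairwise coprime as soon
   as b is divisible by all the differences of indices. *)
Lemma beta_complete (f : N -> N) n : R1 (fun e => f (e 0%N)) ->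
  exists a b, forall i, i ≺ n -> beta a b i = f i.
Proof.
move=> rf.
have [|B hB] := @collection _ (fun i y => y = f i) n _ (fun i _ => ex_intro _ (f i) erefl).
  by df.
(* Divisibility by [B] makes each modulus exceed the value to be coded; divisibility by the numbers
   up to [n] makes the moduli coprime. *)
have [b [b0 hb]] := common_multiple (n + B).
pose md i := (i + 1) * b + 1.
have md_lt i : i ≺ n -> f i ≺ md i.
  move=> /hB [y [yB <-]]; case: (ncase B) => [B0|[w BE]]; first by move: yB; rewrite B0 => /nlt0.
  have [||c bE] := hb B; first by apply: nle_addl.
    by rewrite BE; apply: addn1_neq0.
  have [v cE] : exists v, c = v + 1 by case: (ncase c) => // c0; case: b0; rewrite bE c0 mul0r.
  apply: (nlt_le_trans yB); apply/nleP; rewrite /md bE cE.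
  by exists (i * (v + 1) * B + v * B + 1); ring.
have coprime i j : i ≺ j -> j ≺ n -> exists u v, md i * u = md j * v + 1.
  move=> /nltP [w jE] jn.
  have [||c bE] := hb (w + 1).
  - apply: (nle_trans (y := n)); last exact: nle_addr.
    by left; apply: nle_lt_trans jn; apply/nleP; exists i; rewrite jE; ring.
  - exact: addn1_neq0.
  (* From [(j + 1) * md i = (i + 1) * md j + (w + 1)], multiplied by [(j + 1) * c], it follows that
     [md i * X] is [-1] modulo [md j]. *)
  pose X := (j + 1) * (j + 1) * c.
  have zE : exists z, md i * X = z + 1.
    case: (ncase (md i * X)) => // /nmul_eq0 [/addn1_neq0//|/nmul_eq0 [|c0]].
      by case/nmul_eq0 => /addn1_neq0.
    by case: b0; rewrite bE c0 mul0r.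
  have [z zz] := zE.
  have YE : md i * X + 1 = md j * ((i + 1) * (j + 1) * c + 1).
    by rewrite /md /X bE jE; ring.
  (* The square of [md i * X] is [1] modulo [md j]. *)
  exists (X * (md i * X)), (((i + 1) * (j + 1) * c + 1) * z).
  have -> : md i * (X * (md i * X)) = z * (md i * X + 1) + 1.
    by rewrite mulrA zz; ring.
  by rewrite YE; ring.
(* Chinese remaindering for an initial segment of the moduli: [P] is divisible by these and coprime
   to the later ones. Coprimality is a Bezout equation free of subtraction. *)
have [|a [P [_ [_ ha]]]] : n ≼ n -> exists a P,
    (forall i, i ≺ n -> exists c, P = c * md i) /\
    (forall j, j ≺ n -> n ≼ j -> exists u v, P * u = md j * v + 1) /\
    forall i, i ≺ n -> exists q, a = q * md i + f i; last first.
- exists a, b => i i_n; have [q e] := ha i i_n.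
  by apply: remainder_unique e; apply: md_lt.
- exact: nle_refl.
move: {1 3 5 6}n => k; elim/nind: k => [||k IH kn]; first by rewrite /md; df.
  move=> _; exists 0, 1; split; first by move=> i /nlt0.
  by split=> [j _ _|i /nlt0//]; exists 1, 0; ring.
have k_n : k ≺ n by apply: nlt_le_trans kn; apply: nltSn.
have [|a [P [hP [cP ha]]]] := IH; first by left.
have [u [v uv]] := cP k k_n (nle_refl k).
(* Modulo [md k] the number [(k + 1) * b] is [-1], so the bracket is [f k - a]; the factor [P * u]
   is [1] modulo [md k] and [0] modulo the earlier moduli. *)
exists (a + P * u * (f k + a * ((k + 1) * b))), (P * md k); split; [|split].
- move=> i /nltS [ik|->]; last by exists P.
  by have [c ->] := hP i ik; exists (c * md k); ring.
- move=> j jn kj; have [u1 [v1 e1]] : exists u v, P * u = md j * v + 1.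
    by apply: cP => //; apply: nle_trans kj; left; apply: nltSn.
  have [u2 [v2 e2]] : exists u v, md k * u = md j * v + 1.
    by apply: coprime => //; apply: nlt_le_trans kj; apply: nltSn.
  exists (u1 * u2), (md j * v1 * v2 + v1 + v2).
  transitivity ((P * u1) * (md k * u2)); first by ring.
  by rewrite e1 e2; ring.
- move=> i /nltS [ik|->].
    have [q qE] := ha i ik; have [c cE] := hP i ik.
    exists (q + c * u * (f k + a * ((k + 1) * b))).
    by rewrite {1}qE {1}cE; ring.
  exists (v * (f k + a * ((k + 1) * b)) + a).
  by rewrite uv /md; ring.
Qed.

(* The value of the recursion is read off a beta-code of its course of values. *)
Definition rec_code (g0 : N -> N) (G : N -> N -> N -> N) p k y :=
  exists a b, beta a b 0 = g0 p /\
    ((forall i, i ≺ k -> beta a b (i + 1) = G p i (beta a b i)) /\ beta a b k = y).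

Section Definition_by_recursion.
Variables (g0 : N -> N) (G : N -> N -> N -> N).
Hypothesis rg0 : R1 (fun e => g0 (e 0%N)).
Hypothesis rG : R1 (fun e => G (e 0%N) (e 1%N) (e 2%N)).

Local Notation code := (rec_code g0 G).

Lemma rec_code_S1 : S1 (fun e => code (e 0%N) (e 1%N) (e 2%N)).
Proof. have rb := R1_beta; rewrite /rec_code; df. Qed.

Lemma rec_code_unique p k y y' : code p k y -> code p k y' -> y = y'.
Proof.
move=> [a [b [e0 [eS <-]]]] [a' [b' [e0' [eS' <-]]]].
have rb := R1_beta.
have : k ≼ k by apply: nle_refl.
move: {1 3 4}k => i; elim/nind: i => [||i IH ik]; first by df.
  by rewrite e0 e0'.
have i_k : i ≺ k by apply: nlt_le_trans ik; apply: nltSn.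
by rewrite eS // eS' // IH //; left.
Qed.

Lemma rec_code_exists p k : exists y, code p k y.
Proof.
have rb := R1_beta.
elim/nind: k => [||k [y [a [b [e0 [eS ky]]]]]].
- apply: S1_ex; pose s (l : nat) : nat + N :=
    match l with 0%N => inr p | 1%N => inl 1%N | _ => inl 0%N end.
  exact: (S1_val s rec_code_S1).
- have [a [b ab]] := @beta_complete (fun=> g0 p) 1 (R1_const _).
  have ab0 := ab 0 (one_gt0 M).
  by exists (g0 p), a, b; split=> //; split=> // i /nlt0.
(* A beta code cannot be extended in place; the values up to [k] and the new one are coded
   afresh. *)
pose f i := ite (i ≼ k) (beta a b i) (G p k (beta a b k)).
have rf : R1 (fun e => f (e 0%N)) by rewrite /f; df.
have [a' [b' ab]] := @beta_complete f (k + 1 + 1) rf.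
have lek i : i ≼ k -> beta a' b' i = beta a b i.
  by move=> ik; rewrite ab ?/f ?iteT //; apply/nltS; left; apply/nltS.
have eSk : beta a' b' (k + 1) = G p k (beta a b k).
  rewrite ab; last exact: nltSn.
  by rewrite /f iteF // => /nlt_nle; apply; apply: nltSn.
exists (beta a' b' (k + 1)), a', b'; split; first by rewrite lek //; apply: nle0.
split=> // i /nltS [ik|->]; last by rewrite eSk lek //; apply: nle_refl.
rewrite lek; last first.
  by move: ik => /nltP [w ->]; apply/nleP; exists w; ring.
by rewrite eS // lek //; left.
Qed.

Lemma recursion_exists : exists F : N -> N -> N,
  R1 (fun e => F (e 0%N) (e 1%N)) /\
  forall p, F p 0 = g0 p /\ forall k, F p (k + 1) = G p k (F p k).
Proof.
pose F p k := sval (cid (rec_code_exists p k)).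
have FP p k : code p k (F p k) by apply: (svalP (cid (rec_code_exists p k))).
exists F; split.
  apply: (R1_graph (G := fun e y => code (e 0%N) (e 1%N) y)).
    by move=> e y; split=> [->|/rec_code_unique]; [|apply].
  exact: (S1_ren (fun l : nat => match l with 0 => 1 | 1 => 2 | _ => 0 end)%N rec_code_S1).
move=> p; split=> [|k]; first by have [a [b [<- [_ ->]]]] := FP p 0.
have [a [b [e0 [eS <-]]]] := FP p (k + 1).
rewrite eS; last exact: nltSn.
congr G; apply: (@rec_code_unique p k) => //; exists a, b; split=> //; split=> // i ik.
by apply: eS; apply: (nlt_trans ik); apply: nltSn.
Qed.

End Definition_by_recursion.
End Recursion.
(** * The pigeonhole principle implies connectedness *)

Section Reals.
Variable M : rca.
Local Notation N := (num M).
Local Notation K := (krat M).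

Definition eventually (P : N -> Prop) := exists m, forall n, m ≼ n -> P n.

Definition cauchy (x : N -> K) :=
  forall eps, 0 < eps -> exists l, forall m n, l ≼ m -> l ≼ n -> `|x m - x n| < eps.

Definition real (x : N -> K) := RK (fun e => x (e 0%N)) /\ cauchy x.

(** Strict inequality of reals is replaced by a margin that holds from some place on; [set_ball_iff]
    shows the equivalence for Cauchy sequences. *)
Definition in_rball (x : N -> K) (a r : K) :=
  exists2 eps, 0 < eps & eventually (fun n => `|a - x n| + eps < r).

(* The code of an open set is read as a relation between a number and the codes of
   the centre and the radius of a ball. *)
Definition rec3 (U : N -> N -> N -> Prop) := D1 (fun e => U (e 0%N) (e 1%N) (e 2%N)).

Definition in_ropen (x : N -> K) (U : N -> N -> N -> Prop) :=
  exists a r, [/\ 0 < r, in_rball x a r & eventually (fun n => U n (kcode a) (kcode r))].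

Definition in_ropenq (q : K) (U : N -> N -> N -> Prop) :=
  exists a r, `|a - q| < r /\ eventually (fun n => U n (kcode a) (kcode r)).

Definition pigeonhole := forall b (c : N -> N),
  R1 (fun e => c (e 0%N)) -> (forall i, c i ≼ b) ->
  exists2 n, n ≼ b & forall m, exists2 i, m ≺ i & c i = n.

Lemma eventually_and P Q :
  eventually P -> eventually Q -> eventually (fun n => P n /\ Q n).
Proof.
move=> [m hP] [l hQ]; exists (m + l) => n h; split.
  by apply: hP; apply: nle_trans h; apply: nle_addr.
by apply: hQ; apply: nle_trans h; apply: nle_addl.
Qed.

Lemma eventually_imp P Q : (forall n, P n -> Q n) -> eventually P -> eventually Q.
Proof. by move=> h [m hP]; exists m => n /hP /h. Qed.

Lemma eventually_ge l : eventually (fun n => l ≼ n).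
Proof. by exists l. Qed.

Lemma eventually_ex P : eventually P -> exists n, P n.
Proof. by move=> [m h]; exists m; apply: h; apply: nle_refl. Qed.

Lemma real_const q : real (fun=> q).
Proof. by split=> [|eps e0]; [apply: RK_const|exists 0 => *; rewrite subrr normr0]. Qed.

Lemma in_ropen_const q U : in_ropen (fun=> q) U <-> in_ropenq q U.
Proof.
split=> [[a [r [r0 [eps e0 /eventually_ex [_ h]] hU]]]|[a [r [h hU]]]].
  by exists a, r; split=> //; lra.
exists a, r; split=> //; first by have := normr_ge0 (a - q); lra.
by exists ((r - `|a - q|) / 2); [lra|exists 0 => *; lra].
Qed.

Lemma in_ropen_rational x U : in_ropen x U -> exists q, in_ropenq q U.
Proof.
move=> [a [r [r0 [eps e0 /eventually_ex [n h]] hU]]].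
by exists (x n), a, r; split=> //; lra.
Qed.

(** Unbounded search; taking the least witness makes the choice definable. *)
Lemma search (good : N -> N -> Prop) :
  D1 (fun e => good (e 0%N) (e 1%N)) -> (forall s, exists z, good s z) ->
  exists2 f : N -> N, R1 (fun e => f (e 0%N)) & forall s, good s (f s).
Proof.
move=> dg h.
have least s : exists z, good s z /\ forall y, y ≺ z -> ~ good s y.
  apply: least_sigma; last exact: h.
  pose r (i : nat) : nat + N := if i is 0%N then inr s else inl 0%N.
  exact: (S1_val r (S1_D1 dg)).
pose f s := sval (cid (least s)).
have fP s : good s (f s) /\ forall y, y ≺ f s -> ~ good s y := svalP (cid (least s)).
exists f => [|s]; last by case: (fP s).
apply: (R1_graph (G := fun e v => good (e 0%N) v /\ forall y, y ≺ v -> ~ good (e 0%N) y)).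
  move=> e v; split=> [->//|[gv hv]]; have [gf hf] := fP (e 0%N).
  case: (ntotal v (f (e 0%N))) => [/hf//|[/hv//|->//]].
df.
Qed.

Lemma krecursion_exists (g0 : N -> K) (G : N -> N -> K -> K) :
  RK (fun e => g0 (e 0%N)) -> RK (fun e => G (e 0%N) (e 1%N) (kdec (e 2%N))) ->
  exists2 F : N -> N -> K, RK (fun e => F (e 0%N) (e 1%N)) &
    forall p, F p 0 = g0 p /\ forall k, F p (k + 1) = G p k (F p k).
Proof.
move=> rg0 rG; have [F [rF hF]] := @recursion_exists M (fun p => kcode (g0 p))
  (fun p k v => kcode (G p k (kdec v))) rg0 rG.
exists (fun p k => kdec (F p k)); first by df.
by move=> p; have [h0 hS] := hF p; split=> [|k]; rewrite ?h0 ?hS kcodeK.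
Qed.

End Reals.

(** * Bisection guided by guesses *)

Section Connectedness.
Variable M : rca.
Local Notation N := (num M).
Local Notation K := (krat M).
Hypothesis php : pigeonhole M.

Section Cut.
Variables (U0 U1 : N -> N -> N -> Prop) (q0 q1 : K).
Hypotheses (rU0 : rec3 U0) (rU1 : rec3 U1).
Hypothesis cover : forall x : N -> K, real x -> in_ropen x U0 \/ in_ropen x U1.
Hypothesis disjoint : forall q, in_ropenq q U0 -> in_ropenq q U1 -> False.
Hypotheses (q0U : in_ropenq q0 U0) (q1U : in_ropenq q1 U1) (q01 : q0 < q1).

Lemma coverq q : in_ropenq q U0 \/ in_ropenq q U1.
Proof. by case: (cover (real_const q)) => /in_ropen_const; [left|right]. Qed.

(* [w] codes an index from which on a ball around [q] is in [U], as far as can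
   be seen at stage [s]. *)
Definition unrefuted (U : N -> N -> N -> Prop) (q : K) (w s : N) :=
  let a := kdec (npr1 (npr2 w)) in let r := kdec (npr2 (npr2 w)) in
  (a - q < r /\ q - a < r) /\
  forall n, n ≼ s -> npr1 w ≼ n -> U n (kcode a) (kcode r).

Lemma unrefuted_mono U q w s s' : s ≼ s' -> unrefuted U q w s' -> unrefuted U q w s.
Proof. by move=> ss' [h h']; split=> // n ns; apply: h'; apply: nle_trans ss'. Qed.

Lemma unrefutedP U q : in_ropenq q U <-> exists w, forall s, unrefuted U q w s.
Proof.
split=> [[a [r [h [m hU]]]]|[w h]].
  exists (npr m (npr (kcode a) (kcode r))) => s.
  rewrite /unrefuted !(npr1K, npr2K, kcodeK); split=> [|n _]; last exact: hU.
  by move: h; rewrite ltr_norml => /andP [? ?]; split; lra.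
exists (kdec (npr1 (npr2 w))), (kdec (npr2 (npr2 w))); split.
  by have [[? ?] _] := h 0; rewrite ltr_norml; apply/andP; split; lra.
by exists (npr1 w) => n wn; have [_] := h n; apply=> //; apply: nle_refl.
Qed.

Lemma unrefuted_D1 U : rec3 U ->
  D1 (fun e => unrefuted U (kdec (e 0%N)) (e 1%N) (e 2%N)).
Proof. by rewrite /rec3 => rU; rewrite /unrefuted; df. Qed.

(** Outside [U] every candidate fails at some stage. Collection yields one stage for all candidates
    below [w], and a failure persists. *)
Lemma refuted U q w : rec3 U -> ~ in_ropenq q U ->
  eventually (fun s => forall v, v ≺ w -> ~ unrefuted U q v s).
Proof.
move=> rU nU.
have [|v _|z hz] := @collection M (fun v s => ~ unrefuted U q v s) w.
- have dU := unrefuted_D1 rU; pose r (i : nat) : nat + N :=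
    match i with 0%N => inr (kcode q) | j.+1 => inl j end.
  have := S1_val r (S1_D1 (D1_not dU)); apply: S1_ext => e.
  by rewrite /val /= kcodeK.
- apply: contrapT => h; apply: nU; apply/unrefutedP; exists v => s.
  by apply: contrapT => h'; apply: h; exists s.
exists z => s zs v /hz [y [yz ny]] h; apply: ny; apply: unrefuted_mono h.
by apply: nle_trans zs; left.
Qed.

(** Compares the least surviving candidates for the two sets: a correct candidate survives for ever,
    while each incorrect one is refuted in time. Ties go to [U0], and the bound [w ≼ s] keeps the
    guess decidable. *)
Definition guess0 q s :=
  exists w, w ≼ s /\ (unrefuted U0 q w s /\ forall v, v ≺ w -> ~ unrefuted U1 q v s).

Lemma guess0_true q : in_ropenq q U0 -> eventually (guess0 q).
Proof.
move=> qU; have /unrefutedP [w hw] := qU.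
have := refuted w rU1 (fun qU1 => disjoint qU qU1).
move/(eventually_and (eventually_ge w)); apply: eventually_imp => s [ws h].
by exists w; split=> //; split.
Qed.

Lemma guess0_false q : in_ropenq q U1 -> eventually (fun s => ~ guess0 q s).
Proof.
move=> qU; have /unrefutedP [w hw] := qU.
(* The candidate [w] itself must be refuted for [U0] too, because a tie would be decided in favour
   of [U0]. *)
have := refuted (w + 1) rU0 (fun qU0 => disjoint qU0 qU).
apply: eventually_imp => s h [v [_ [hv hv']]].
case: (ntotal w v) => [/hv'|/nltS /h]; last exact.
by apply; apply: hw.
Qed.

Lemma guess0_D1 : D1 (fun e => guess0 (kdec (e 0%N)) (e 1%N)).
Proof.
have dec U (f : (nat -> N) -> K) (g h : (nat -> N) -> N) : rec3 U -> RK f -> R1 g -> R1 h ->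
    D1 (fun e => unrefuted U (f e) (g e) (h e)).
  move=> rU rf rg rh.
  have := D1_rel3 (R := fun q w s => unrefuted U (kdec q) w s) (unrefuted_D1 rU) rf rg rh.
  by apply: D1_ext => e; rewrite kcodeK.
apply: D1_bexe; first by df.
apply: D1_and; first by apply: dec => //; df.
apply: D1_ball; first by df.
by apply: D1_not; apply: dec => //; df.
Qed.

(** The guesses at the two end points are overruled by the truth, so that the bisection has a
    correct start even at early stages. *)
Definition left_of (q : K) (s : N) := q = q0 \/ q <> q1 /\ guess0 q s.

Lemma left_of_true q : in_ropenq q U0 -> eventually (left_of q).
Proof.
move=> qU; apply: eventually_imp (guess0_true qU) => s h; right; split=> // qq1.
by apply: (disjoint qU); rewrite qq1.
Qed.

Lemma left_of_false q : in_ropenq q U1 -> eventually (fun s => ~ left_of q s).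
Proof.
move=> qU; apply: eventually_imp (guess0_false qU) => s h [qq0|[]//].
by apply: (disjoint q0U); rewrite -qq0.
Qed.

Lemma left_of_D1 (f : (nat -> N) -> K) (g : (nat -> N) -> N) :
  RK f -> R1 g -> D1 (fun e => left_of (f e) (g e)).
Proof.
move=> rf rg; apply: (D1_ext (P := fun e => left_of (kdec (kcode (f e))) (g e))).
  by move=> e; rewrite kcodeK.
apply: (D1_rel2 (R := fun q s => left_of (kdec q) s)) rf rg.
have dg := guess0_D1.
by apply: D1_or; [df|apply: D1_and; [df|]].
Qed.

Lemma step_exists : exists2 h : N -> K, RK (fun e => h (e 0%N)) &
  h 0 = q1 - q0 /\ forall k, h (k + 1) = h k / 2.
Proof.
have [||F rF hF] := @krecursion_exists M (fun=> q1 - q0) (fun _ _ v => v / 2); try by df.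
have [h0 hS] := hF 0; exists (F 0) => //.
by apply: (RK_fun2 rF); df.
Qed.

Definition step : N -> K := sval (cid2 step_exists).

Lemma step_RK : RK (fun e => step (e 0%N)).
Proof. by rewrite /step; case: cid2. Qed.

Lemma step0 : step 0 = q1 - q0.
Proof. by rewrite /step; case: cid2 => h /= _ []. Qed.

Lemma stepS k : step (k + 1) = step k / 2.
Proof. by rewrite /step; case: cid2 => h /= _ []. Qed.

Lemma low_exists : exists2 l : N -> N -> K, RK (fun e => l (e 0%N) (e 1%N)) &
  forall s, l s 0 = q0 /\ forall k, l s (k + 1) =
    ite (left_of (l s k + step (k + 1)) s) (l s k + step (k + 1)) (l s k).
Proof.
have rs := step_RK.
apply: (@krecursion_exists M (fun=> q0)
  (fun s k v => ite (left_of (v + step (k + 1)) s) (v + step (k + 1)) v)); first by df.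
by apply: RK_if; [apply: left_of_D1|..]; df.
Qed.

(* [low s k] is the left end of the interval of length [step k] reached after [k]
   bisections, when the decisions are taken with the guesses of stage [s]. *)
Definition low : N -> N -> K := sval (cid2 low_exists).

Lemma low_RK : RK (fun e => low (e 0%N) (e 1%N)).
Proof. by rewrite /low; case: cid2. Qed.

Lemma low0 s : low s 0 = q0.
Proof. by rewrite /low; case: cid2 => l /= _ /(_ s) []. Qed.

Lemma lowS s k : low s (k + 1) =
  ite (left_of (low s k + step (k + 1)) s) (low s k + step (k + 1)) (low s k).
Proof. by rewrite /low; case: cid2 => l /= _ /(_ s) []. Qed.

Lemma step_gt0 k : 0 < step k.
Proof.
have rs := step_RK.
elim/nind: k => [||k IH]; first by df.
  by rewrite step0 subr_gt0.
by rewrite stepS; lra.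
Qed.

Lemma step_small eps : 0 < eps -> exists k, step k < eps.
Proof.
move=> e0; have [k hk] := archimedean ((q1 - q0) / eps); exists k.
(* A linear estimate for the growth of the powers of two is sufficient. *)
suff h : (inj k + 1) * step k <= q1 - q0.
  have s0 := step_gt0 k; move: hk; rewrite ltr_pdivrMr // => hk.
  have := inj_ge0 k; nra.
have rs := step_RK.
elim/nind: k {hk} => [||k IH]; first by df.
  by rewrite inj0 step0; lra.
by rewrite injD inj1 stepS; have := step_gt0 k; have := inj_ge0 k; nra.
Qed.

Lemma step_divides i k : i ≼ k -> exists c, step i = inj c * step k.
Proof.
move=> /nleP [d ->]; have rs := step_RK.
elim/nind: d => [||d [c ->]]; first by df.
  by exists 1; rewrite addr0 inj1 mul1r.
by exists (c + c); rewrite addrA stepS injD; field.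
Qed.

Lemma low_grid s k : exists c, low s k = q0 + inj c * step k /\ low s k + step k <= q1.
Proof.
have rs := step_RK; have rl := low_RK.
elim/nind: k => [||k [c [lE le]]]; first by df.
  by exists 0; rewrite inj0 low0 step0; split; lra.
rewrite lowS /ite stepS; have := step_gt0 k => s0; case: ifP => _.
  by exists (c + c + 1); rewrite !injD inj1; split; [rewrite lE; field|lra].
by exists (c + c); rewrite !injD; split; [rewrite lE; field|lra].
Qed.

(** The invariant mentions only the guesses of the one stage [s]; it is decidable, hence open to
    induction, whether or not these guesses are correct. *)
Lemma low_left_of s k : left_of (low s k) s /\ ~ left_of (low s k + step k) s.
Proof.
have rs := step_RK; have rl := low_RK.
elim/nind: k => [||k [hl hr]].
- apply: S1_D1; apply: D1_and; first by apply: left_of_D1; df.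
  by apply: D1_not; apply: left_of_D1; df.
- rewrite low0 step0 (_ : q0 + (q1 - q0) = q1); last by ring.
  split; first by left.
  by case=> [h|[]//]; move: q01; rewrite h ltxx.
rewrite lowS /ite; case: asboolP => h; split=> //.
rewrite (_ : low s k + step (k + 1) + step (k + 1) = low s k + step k) //.
by rewrite stepS; field.
Qed.

Lemma low_nested s k d :
  low s k <= low s (k + d) /\ low s (k + d) + step (k + d) <= low s k + step k.
Proof.
have rs := step_RK; have rl := low_RK.
elim/nind: d => [||d [h1 h2]]; first by df.
  by rewrite addr0; split; lra.
rewrite addrA lowS /ite stepS; have := step_gt0 (k + d) => s0.
by case: ifP => _; split; lra.
Qed.

Definition grid k j : K := q0 + inj j * step k.

(* Every guess is eventually constant; the pigeonhole principle makes this uniform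
   in the finitely many grid points of a level. *)
Lemma grid_stable k P : exists s0, forall t, s0 ≼ t -> forall j, j ≼ P ->
  (left_of (grid k j) t <-> left_of (grid k j) s0).
Proof.
pose changes t j := ~ (left_of (grid k j) t <-> left_of (grid k j) (t + 1)).
have rg : RK (fun e => grid k (e 0%N)) by rewrite /grid; df.
have dl (f g : (nat -> N) -> N) : R1 f -> R1 g -> D1 (fun e => left_of (grid k (f e)) (g e)).
  by move=> rf rg'; apply: left_of_D1 => //; apply: RK_fun1.
have dch (f g : (nat -> N) -> N) : R1 f -> R1 g -> D1 (fun e => changes (f e) (g e)).
  by move=> rf rg'; apply: D1_not; apply: D1_iff; apply: dl => //; df.
suff [s0 hs0] : exists s0, forall t, s0 ≼ t -> forall j, j ≼ P -> ~ changes t j.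
  exists s0 => t /nleP [d ->] j jP; elim/nind: d => [||d IH].
  - by apply: S1_D1; apply: D1_iff; apply: dl; df.
  - by rewrite addr0.
  rewrite -IH addrA; apply: iff_sym; apply: contrapT.
  by apply: hs0 => //; apply: nle_addr.
apply: contrapT => nstable.
(* If changes never stop, a later change can be searched for from every [s]; its grid point is the
   colour of [s]. *)
have [||f rf hf] := @search M (fun s z =>
  s ≼ npr1 z /\ (npr2 z ≼ P /\ changes (npr1 z) (npr2 z))).
- by apply: D1_and; [df|apply: D1_and; [df|apply: dch; df]].
- move=> s; apply: contrapT => n; apply: nstable; exists s => t st j jP ch.
  by apply: n; exists (npr t j); rewrite npr1K npr2K.
have [||j jP hj] := php (b := P) (c := fun s => npr2 (f s)); first by df.
  by move=> s; have [_ []] := hf s.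
have often m : exists2 t, m ≼ t & changes t j.
  have [s ms <-] := hj m; have [st [_ ch]] := hf s.
  by exists (npr1 (f s)) => //; apply: nle_trans st; left.
case: (coverq (grid k j)) => [/left_of_true|/left_of_false] [s0 h];
  have [t st] := often s0; apply; split=> //; move=> h'; try exact: h;
  by [apply: h; apply: nle_trans (nle_addr t 1)|
      case: (h (t + 1)) => //; apply: nle_trans (nle_addr t 1)|case: (h t)].
Qed.

(** The first [k] bisections test only points of the grid of level [k], and the guesses there are
    constant from [s0] on. *)
Lemma low_stable k : exists s0, forall t, s0 ≼ t -> low t k = low s0 k.
Proof.
have [P PE] := step_divides (nle0 k); rewrite step0 in PE.
have [s0 h] := grid_stable k P; exists s0 => t st.
have rs := step_RK; have rl := low_RK.
have : k ≼ k by apply: nle_refl.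
move: {1 3 4}k => i; elim/nind: i => [||i IH ik]; first by df.
  by rewrite !low0.
have {}IH : low t i = low s0 i.
  by apply: IH; apply: nle_trans ik; left; apply: nltSn.
rewrite !lowS IH.
have [c [lE le]] := low_grid s0 i; have [d dE] := step_divides ik.
(* The midpoint lies [2c + 1] half-steps to the right of [q0], and each of these is [d] units of
   [step k]. *)
have mE : low s0 i + step (i + 1) = grid k ((c + c + 1) * d).
  by rewrite /grid injM !injD inj1 -mulrA -dE lE stepS; field.
have jP : (c + c + 1) * d ≼ P.
  apply/inj_le; rewrite -(ler_pM2r (step_gt0 k)) -PE.
  by move: mE; rewrite /grid stepS; have := step_gt0 i; lra.
have [h1 h2] := h t st _ jP; rewrite mE /ite.
by case: asboolP => a; case: asboolP => b //; exfalso; [case: b; exact: h1|case: a; exact: h2].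
Qed.

(** Once the interval of level [k] is constant, its ends are guessed left and right at all later
    stages, and these guesses are eventually correct. Waiting until [s0 + k] ensures [k ≼ t], so the
    diagonal entry falls into this interval. *)
Lemma low_separates k : exists s0 l, in_ropenq l U0 /\ in_ropenq (l + step k) U1 /\
  forall t, s0 ≼ t -> l <= low t t /\ low t t < l + step k.
Proof.
have [s0 h] := low_stable k; exists (s0 + k), (low s0 k); split; [|split].
- case: (coverq (low s0 k)) => // /left_of_false [s1 h1].
  case: (h1 (s0 + s1)); first exact: nle_addl.
  by rewrite -(h (s0 + s1)); [have [] := low_left_of (s0 + s1) k|apply: nle_addr].
- case: (coverq (low s0 k + step k)) => // /left_of_true [s1 h1].
  have : left_of (low s0 k + step k) (s0 + s1) by apply: h1; apply: nle_addl.
  by rewrite -(h (s0 + s1)) ?(low_left_of _ _).2 //; [have [] := low_left_of (s0 + s1) k|apply: nle_addr].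
move=> t st; rewrite -(h t); last by apply: nle_trans st; apply: nle_addr.
have /nleP [d tE] : k ≼ t by apply: nle_trans st; apply: nle_addl.
have [h1 h2] := low_nested t k d; have := step_gt0 (k + d).
by move: h1 h2; rewrite -tE; split; lra.
Qed.

Lemma limit_real : real (fun t => low t t).
Proof.
have rl := low_RK; split; first by df.
move=> eps /step_small [k hk]; have [s0 [l [_ [_ h]]]] := low_separates k.
exists s0 => m n /h [h1 h2] /h [h3 h4].
by rewrite ltr_norml; apply/andP; split; lra.
Qed.

Lemma cut_contradiction : False.
Proof.
(* With an interval shorter than the margin [eps], the ball around the limit swallows the end that
   belongs to the other set: the right end for [U0], the left end for [U1]. *)
case: (cover limit_real) => -[a [r [r0 [eps e0 hx] hU]]];
  have [k hk] := step_small e0;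
  have [s0 [l [l0 [l1 hl]]]] := low_separates k;
  have [t [h [h1 h2]]] := eventually_ex (eventually_and hx (ex_intro _ s0 hl)).
- have : in_ropenq (l + step k) U0.
    exists a, r; split=> //.
    have : `|a - low t t| < r - eps by lra.
    by rewrite !ltr_norml => /andP [? ?]; apply/andP; split; lra.
  by move/disjoint; apply.
have : in_ropenq l U1.
  exists a, r; split=> //.
  have : `|a - low t t| < r - eps by lra.
  by rewrite !ltr_norml => /andP [? ?]; apply/andP; split; lra.
by move/(disjoint l0).
Qed.

End Cut.

Theorem pigeonhole_connected U0 U1 (x y : N -> K) : rec3 U0 -> rec3 U1 ->
  in_ropen x U0 -> in_ropen y U1 ->
  (forall z : N -> K, real z -> in_ropen z U0 \/ in_ropen z U1) ->
  exists2 z : N -> K, real z & in_ropen z U0 /\ in_ropen z U1.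
Proof.
move=> rU0 rU1 /in_ropen_rational [q0 h0] /in_ropen_rational [q1 h1] cover.
apply: contrapT => n.
have disjoint q : in_ropenq q U0 -> in_ropenq q U1 -> False.
  move=> /in_ropen_const a /in_ropen_const b; apply: n.
  by exists (fun=> q) => //; apply: real_const.
case: (ltgtP q0 q1) => [lt|gt|e]; last by apply: (disjoint q0) => //; rewrite e.
  exact: (cut_contradiction rU0 rU1 cover disjoint h0 h1 lt).
have cover' z : real z -> in_ropen z U1 \/ in_ropen z U0 by move/cover; tauto.
apply: (cut_contradiction rU1 rU0 cover' _ h1 h0 gt).
by move=> q a b; apply: (disjoint q).
Qed.

End Connectedness.
(** * Failure of the pigeonhole principle disconnects the reals *)

Section Disconnection.
Variable M : rca.
Local Notation N := (num M).
Local Notation K := (krat M).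

Section Colouring.
Variables (n : N) (d : N -> N).
Hypotheses (rd : R1 (fun e => d (e 0%N))) (dn : forall i, d i ≼ n).
Hypothesis d_id : forall i, i ≼ n -> d i = i.
Hypothesis dies : forall i, i ≼ n -> eventually (fun t => d t <> i).

Let b : N := n + 1.

Definition last (u t : N) := forall v, v ≺ t -> u ≺ v -> d v <> d u.

Lemma last_D1 (f g : (nat -> N) -> N) : R1 f -> R1 g -> D1 (fun e => last (f e) (g e)).
Proof. by apply: (D1_rel2 (R := last)); rewrite /last; df. Qed.

Lemma last_mono u t t' : t ≼ t' -> last u t' -> last u t.
Proof. by move=> tt h v vt; apply: h; apply: nlt_le_trans tt. Qed.

Lemma count_exists : exists F : N -> N -> N, R1 (fun e => F (e 0%N) (e 1%N)) /\
  forall t, F t 0 = 0 /\ forall u, F t (u + 1) = ite (last u t) (F t u + 1) (F t u).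
Proof.
apply: (@recursion_exists M (fun=> 0) (fun t u y => ite (last u t) (y + 1) y)); first by df.
by apply: R1_if; [apply: last_D1|..]; df.
Qed.

Definition count : N -> N -> N := sval (cid count_exists).

Lemma count_R1 : R1 (fun e => count (e 0%N) (e 1%N)).
Proof. by rewrite /count; case: cid => F /= []. Qed.

Lemma count0 t : count t 0 = 0.
Proof. by rewrite /count; case: cid => F /= [_ /(_ t) []]. Qed.

Lemma countS t u : count t (u + 1) = ite (last u t) (count t u + 1) (count t u).
Proof. by rewrite /count; case: cid => F /= [_ /(_ t) []]. Qed.

Lemma digits_exists : exists F : N -> N -> N, R1 (fun e => F (e 0%N) (e 1%N)) /\
  forall t, F t 0 = 0 /\ forall u, F t (u + 1) = ite (last u t) (F t u * b + d u) (F t u).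
Proof.
apply: (@recursion_exists M (fun=> 0) (fun t u y => ite (last u t) (y * b + d u) y)); first by df.
by apply: R1_if; [apply: last_D1|..]; df.
Qed.

(* [digits t u] has as its digits in base [b] the colours of the positions below
   [u] that are the last of their colour as far as can be seen at stage [t]. *)
Definition digits : N -> N -> N := sval (cid digits_exists).

Lemma digits_R1 : R1 (fun e => digits (e 0%N) (e 1%N)).
Proof. by rewrite /digits; case: cid => F /= []. Qed.

Lemma digits0 t : digits t 0 = 0.
Proof. by rewrite /digits; case: cid => F /= [_ /(_ t) []]. Qed.

Lemma digitsS t u : digits t (u + 1) = ite (last u t) (digits t u * b + d u) (digits t u).
Proof. by rewrite /digits; case: cid => F /= [_ /(_ t) []]. Qed.

Lemma power_exists : exists2 F : N -> N, R1 (fun e => F (e 0%N)) &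
  F 0 = 1 /\ forall k, F (k + 1) = F k * b.
Proof.
have [||F [rF hF]] := @recursion_exists M (fun=> 1) (fun _ _ y => y * b); try by df.
by exists (F 0); [apply: (R1_fun2 rF); df|apply: hF].
Qed.

Definition power : N -> N := sval (cid2 power_exists).

Lemma power_R1 : R1 (fun e => power (e 0%N)).
Proof. by rewrite /power; case: cid2. Qed.

Lemma power0 : power 0 = 1.
Proof. by rewrite /power; case: cid2 => F /= _ []. Qed.

Lemma powerS k : power (k + 1) = power k * b.
Proof. by rewrite /power; case: cid2 => F /= _ []. Qed.

Lemma power_neq0 k : power k <> 0.
Proof.
have rp := power_R1; elim/nind: k => [||k IH]; first by df.
  by rewrite power0; apply/eqP/oner_neq0.
by rewrite powerS => /nmul_eq0 [//|/addn1_neq0].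
Qed.

Lemma last_self t : last t (t + 1).
Proof. by move=> v /nltS vt /nlt_le_trans/(_ vt)/nltxx. Qed.

Lemma last_succ u t : u ≺ t -> (last u (t + 1) <-> last u t /\ d t <> d u).
Proof.
move=> ut; split=> [h|[h dt] v /nltS [|-> //]]; last exact: h.
by split; [apply: last_mono h; left; apply: nltSn|apply: h => //; apply: nltSn].
Qed.

(** From one stage to the next a single exchange happens: the new position [t] is the last of its
    colour, and the former last position [u0] of that colour is lost. At stage [n + 1] all positions
    count, by [d_id]. *)
Lemma count_total k : count (n + 1 + k) (n + 1 + k) = n + 1.
Proof.
have rc := count_R1.
elim/nind: k => [||k IH]; first by df.
  rewrite addr0.
  have : n + 1 ≼ n + 1 by apply: nle_refl.
  move: {1 4 5}(n + 1) => u; elim/nind: u => [||u IH un]; first by df.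
    by rewrite count0.
  have u_n : u ≺ n + 1 by apply: nlt_le_trans un; apply: nltSn.
  rewrite countS iteT; first by rewrite IH //; left.
  move=> v vn uv; rewrite !d_id; try exact/nltS.
  by move=> e; move: uv; rewrite e => /nltxx.
rewrite addrA; set t := n + 1 + k in IH *.
have nt : n ≺ t by apply: (nlt_le_trans (nltSn n)); apply: nle_addr.
have [|||u0 [[u0t du0] hu0]] := @greatest M (fun u => u ≺ t /\ d u = d t) t; first by df.
- exists (d t); split; last by rewrite d_id.
  exact: nle_lt_trans (dn t) nt.
- by move=> u [ut _]; left.
have last0 : last u0 t.
  by move=> v vt u0v e; have /hu0/nlt_nle : v ≺ t /\ d v = d t by rewrite e.
have key v : v ≼ t -> (v ≼ u0 -> count (t + 1) v = count t v) /\
                      (u0 ≺ v -> count (t + 1) v + 1 = count t v).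
  elim/nind: v => [||v IHv vt].
  - by df.
  - by move=> _; split=> [_|/nlt0//]; rewrite !count0.
  have v_t : v ≺ t by apply: nlt_le_trans vt; apply: nltSn.
  have [IH1 IH2] : (v ≼ u0 -> count (t + 1) v = count t v) /\
                   (u0 ≺ v -> count (t + 1) v + 1 = count t v) by apply: IHv; left.
  rewrite !countS; case: (pselect (v = u0)) => [vu0|vu0].
    subst v.
    split=> [/nlt_nle|_]; first by case; apply: nltSn.
    rewrite iteF; last by rewrite last_succ // du0 => -[].
    by rewrite iteT // IH1 //; apply: nle_refl.
  have -> : last v (t + 1) = last v t.
    apply: propext; rewrite last_succ //; split=> [[]//|lv]; split=> // e.
    case: (ntotal v u0) => [/(lv _ u0t)|[/(last0 _ v_t)|/esym //]]; by rewrite du0 e.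
  rewrite /ite; case: ifP => _; split.
  - by move=> h; rewrite IH1 //; apply: nle_trans h; left; apply: nltSn.
  - by move=> /nltS [h|/esym//]; rewrite -IH2.
  - by move=> h; rewrite IH1 //; apply: nle_trans h; left; apply: nltSn.
  - by move=> /nltS [h|/esym//]; rewrite -IH2.
rewrite countS iteT; last exact: last_self.
by have [_ ->] := key t (nle_refl t).
Qed.

Lemma count_total_ge t : n + 1 ≼ t -> count t t = n + 1.
Proof. by move=> /nleP [k ->]; apply: count_total. Qed.

(** Each counted position from [u] on appends one digit, so [digits t u] survives as the leading
    part, followed by a block of [j] digits. *)
Lemma horner t u k : exists j, count t (u + k) = count t u + j /\
  (digits t u * power j ≼ digits t (u + k) /\
   digits t (u + k) ≺ (digits t u + 1) * power j).
Proof.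
have rc := count_R1; have rg := digits_R1; have rp := power_R1.
elim/nind: k => [||k [j [cE [h1 h2]]]]; first by df.
  exists 0; rewrite !addr0 power0 !mulr1; split=> //; split; first exact: nle_refl.
  exact: nltSn.
rewrite addrA countS digitsS /ite; case: ifP => _; last by exists j.
exists (j + 1); rewrite cE addrA powerS; split=> //.
have /nleP [e nE] := dn (u + k).
case/nleP: h1 => w wE; case/nltP: h2 => y yE; split.
  by apply/nleP; exists (w * b + d (u + k)); rewrite wE; ring.
apply/nltP; exists (y * b + e); rewrite mulrA yE /b nE; ring.
Qed.

Lemma count_le t u u' : u ≼ u' -> count t u ≼ count t u'.
Proof. by move=> /nleP [k ->]; have [j [-> _]] := horner t u k; apply: nle_addr. Qed.

Lemma count_antitone t t' u : t ≼ t' -> count t' u ≼ count t u.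
Proof.
move=> tt; have rc := count_R1; elim/nind: u => [||u IH]; first by df.
  by rewrite !count0; apply: nle_refl.
rewrite !countS /ite; case: asboolP => [/(last_mono tt) h|h]; case: asboolP => h' //.
  by case/nleP: IH => w ->; apply/nleP; exists w; ring.
by apply: nle_trans IH _; apply: nle_addr.
Qed.

Lemma count_drop t t' u v : t ≼ t' -> v ≺ u -> last v t -> ~ last v t' ->
  count t' u ≺ count t u.
Proof.
move=> tt /nltP [k ->] h h'.
have rc := count_R1; elim/nind: k => [||k IH]; first by df.
  rewrite addr0 !countS iteF // iteT //.
  by apply: nle_lt_trans (nltSn _); apply: count_antitone.
have -> : v + (k + 1) + 1 = (v + k + 1) + 1 by ring.
rewrite (countS t) (countS t') /ite; case: asboolP => [/(last_mono tt) l|l];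
  case: asboolP => l' //.
  by case/nltP: IH => w ->; apply/nltP; exists w; ring.
by apply: nlt_trans IH _; apply: nltSn.
Qed.

Definition final (u : N) := forall v, u ≺ v -> d v <> d u.

Definition agrees (u t : N) := forall v, v ≺ u -> (last v t <-> final v).

Lemma agrees_le u u' t : u ≼ u' -> agrees u' t -> agrees u t.
Proof. by move=> uu h v vu; apply: h; apply: nlt_le_trans uu. Qed.

(* A stage minimizing the number of apparently last positions below [u] shows
   which of them are really last. *)
Lemma agrees_eventually u : eventually (agrees u).
Proof.
have rc := count_R1.
have [||k [[t0 tk] hk]] := @least_sigma M (fun k => exists t, count t u = k); first by df.
  by exists (count 0 u), 0.
have stable t v : t0 ≼ t -> v ≺ u -> last v t0 -> last v t.
  move=> tt vu h; apply: contrapT => h'.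
  apply: (hk (count t u)); last by exists t.
  by rewrite -tk; apply: count_drop vu h h'.
exists t0 => t tt v vu; split=> [h w vw|h w _]; last exact: h.
have h0 : last v t0 by apply: last_mono h.
have := stable (t0 + w + 1) v _ vu h0; apply=> //.
- by rewrite -addrA; apply: nle_addr.
- by apply/nltS; apply: nle_addl.
Qed.

Lemma agrees_count u t t' : agrees u t -> agrees u t' ->
  count t u = count t' u /\ digits t u = digits t' u.
Proof.
move=> h h'; have rc := count_R1; have rg := digits_R1.
have : u ≼ u by apply: nle_refl.
move: {1 3 4 5 6}u => v; elim/nind: v => [||v IH vu]; first by df.
  by rewrite !count0 !digits0.
have v_u : v ≺ u by apply: nlt_le_trans vu; apply: nltSn.
have [E1 E2] : count t v = count t' v /\ digits t v = digits t' v by apply: IH; left.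
have E : last v t = last v t' by apply: propext; rewrite h // h'.
by rewrite !countS !digitsS E1 E2 E.
Qed.

Lemma stage_exists u : exists t, agrees u t.
Proof. exact: eventually_ex (agrees_eventually u). Qed.

(** Because [final] is Pi_1, its positions are not counted by a recursion; the count is read off a
    stage that shows the truth below [u]. *)
Definition stage u := sval (cid (stage_exists u)).
Definition fcount u := count (stage u) u.
Definition fdigits u := digits (stage u) u.

Lemma stageP u : agrees u (stage u).
Proof. exact: (svalP (cid (stage_exists u))). Qed.
Arguments stageP : clear implicits.

Lemma fcountE u t : agrees u t -> count t u = fcount u.
Proof. by move=> h; have [] := agrees_count h (stageP u). Qed.

Lemma fdigitsE u t : agrees u t -> digits t u = fdigits u.
Proof. by move=> h; have [] := agrees_count h (stageP u). Qed.

Lemma fcount_le u u' : u ≼ u' -> fcount u ≼ fcount u'.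
Proof.
move=> uu; have h := stageP u'.
by rewrite -(fcountE h) -(fcountE (agrees_le uu h)); apply: count_le.
Qed.

Lemma fcount_max u : fcount u ≼ n + 1.
Proof.
have [t [h [ut nt]]] := eventually_ex (eventually_and (agrees_eventually u)
  (eventually_and (eventually_ge u) (eventually_ge (n + 1)))).
by rewrite -(fcountE h) -(count_total_ge nt); apply: count_le.
Qed.

Lemma final_fcount u : final u ->
  fcount (u + 1) = fcount u + 1 /\ fdigits (u + 1) = fdigits u * b + d u.
Proof.
move=> Fu; have h := stageP (u + 1).
have h' : agrees u (stage (u + 1)) by apply: agrees_le h; left; apply: nltSn.
rewrite -(fcountE h') -(fdigitsE h') /fcount /fdigits countS digitsS !iteT //.
  by apply/h => //; apply: nltSn.
by apply/h => //; apply: nltSn.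
Qed.

Definition value t := digits t t.

(** For large [t] the total number of digits is [n + 1], so exactly [k] digits follow those of the
    final positions below [u]. *)
Lemma value_bounds u k : fcount u + k = n + 1 ->
  eventually (fun t => fdigits u * power k ≼ value t /\
                       value t ≺ (fdigits u + 1) * power k).
Proof.
move=> uk; apply: eventually_imp (eventually_and (agrees_eventually u)
  (eventually_and (eventually_ge u) (eventually_ge (n + 1)))) => t [h [/nleP [l tE] nt]].
have [j [cE hj]] := horner t u l.
move: cE hj; rewrite -tE count_total_ge // (fcountE h) (fdigitsE h) -uk.
by rewrite ![fcount u + _]addrC => /naddI <-.
Qed.

(** The least bound from which on the colour [d u] is absent is the successor of its last
    occurrence. *)
Lemma final_after u : exists v, u ≼ v /\ final v /\ d v = d u.
Proof.
have [s [hs hmin]] : exists s, (forall t, s ≼ t -> d t <> d u) /\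
    forall y, y ≺ s -> ~ (forall t, y ≼ t -> d t <> d u).
  apply: (@least_pi M (fun s => forall t, s ≼ t -> d t <> d u)); last exact: dies.
  apply: (S1_ext (P := fun e => exists t, e 0%N ≼ t /\ d t = d u)); last by df.
  move=> e; rewrite -existsNE; split=> -[t h]; exists t; first by case: h => h1 h2 /(_ h1).
  by move/not_implyP: h => [h1 /contrapT].
have us : u ≺ s by apply: contrapT => /nlt_nle /hs.
case: (ncase s) us hs hmin => [->/nlt0//|[v ->]] /nltS uv hs hmin.
have dv : d v = d u.
  apply: contrapT => ne; apply: (hmin v); first exact: nltSn.
  move=> t [vt|<-//]; apply: hs; case/nltP: vt => w ->; apply/nleP; exists w; ring.
exists v; split=> //; split=> // w vw; rewrite dv; apply: hs.
by case/nltP: vw => y ->; apply/nleP; exists y; ring.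
Qed.

(** The induction concerns [count] at the fixed stage [t], where everything is Delta_1; agreement at
    [t] turns the result into one about [final]. *)
Lemma final_below u j : 0 ≺ j -> j ≼ fcount u ->
  exists v, v ≺ u /\ final v /\ fcount v + 1 = j.
Proof.
move=> j0 ju; have h := stageP u; have rc := count_R1.
set t := stage u in h.
suff [v [vu [lv vj]]] : exists v, v ≺ u /\ last v t /\ count t v + 1 = j.
  exists v; split=> //; split; first exact/h.
  by rewrite -vj (fcountE (u := v)) //; apply: agrees_le h; left.
have := ju; rewrite /fcount -/t; move: (u) => w; elim/nind: w => [||w IH].
- apply: S1_imp; first by df.
  apply: S1_ex; apply: S1_D1; apply: D1_and; first by df.
  by apply: D1_and; [apply: last_D1|]; df.
- by rewrite count0 => j0'; move: (nlt_le_trans j0 j0') => /nlt0.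
rewrite countS /ite; case: asboolP => lw.
  move=> [/nltS /IH [v [vw hv]]|->]; last first.
    by exists w; split; [apply: nltSn|].
  by exists v; split=> //; apply: nlt_trans vw (nltSn w).
move=> /IH [v [vw hv]].
by exists v; split=> //; apply: nlt_trans vw (nltSn w).
Qed.

(* The [j]-th digit of [m], counted from the most significant one of [n + 1]. *)
Definition digit (m j i : N) := exists k, k ≼ n + 1 /\ (j + k = n + 1 /\
  exists x, x ≼ m /\ exists y, y ≼ m /\ (y ≺ power k /\ m = (x * b + i) * power k + y)).

Lemma digit_unique m j i i' : i ≼ n -> i' ≼ n -> digit m j i -> digit m j i' -> i = i'.
Proof.
move=> /nltS hi /nltS hi' [k [_ [jk [x [_ [y [_ [yk ->]]]]]]]].
move=> [k' [_ [jk' [x' [_ [y' [_ [yk' E]]]]]]]].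
have kk : k' = k by apply: (@naddI _ j); rewrite ![_ + j]addrC jk jk'.
rewrite kk in E yk'; have [E' _] := division_unique yk yk' E.
by have [] := division_unique hi hi' E'.
Qed.

Lemma digit_exists m j : j ≼ n + 1 -> exists2 i, i ≼ n & digit m j i.
Proof.
move=> /nleP [k E].
have [q [qm [y [yk mE]]]] := division m (@power_neq0 k).
have [x [xq [i [ib qE]]]] := division q (@addn1_neq0 M n).
exists i; first exact/nltS.
exists k; split; first by rewrite E; apply: nle_addl.
split=> //; exists x; split; first exact: nle_trans xq qm.
by exists y; split; [rewrite mE; apply: nle_addl|rewrite -qE].
Qed.

Lemma value_avoids m : exists u k, fcount u + k = n + 1 /\
  ~ (fdigits u * power k ≼ m /\ m ≺ (fdigits u + 1) * power k).
Proof.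
apply: contrapT => nex.
have hm u k : fcount u + k = n + 1 ->
    fdigits u * power k ≼ m /\ m ≺ (fdigits u + 1) * power k.
  by move=> uk; apply: contrapT => h; apply: nex; exists u, k.
(* The places of the digits are numbered from one, whence [fcount u + 1]. *)
have digit_final u : final u -> digit m (fcount u + 1) (d u).
  move=> /final_fcount [cE dE]; have /nleP [k kE] := fcount_max (u + 1).
  have [/nleP [y mE] lt] := hm (u + 1) k (esym kE); exists k.
  split; first by rewrite kE; apply: nle_addl.
  split; first by rewrite -cE.
  rewrite dE in mE lt; exists (fdigits u); split.
    have [w pE] : exists w, power k = w + 1 by case: (ncase (power k)) => // /power_neq0.
    by apply/nleP; exists (fdigits u * (n * (w + 1) + w) + d u * (w + 1) + y);
      rewrite mE pE /b; ring.
  exists y; split; first by rewrite mE; apply: nle_addl.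
  split=> //; move: lt; rewrite mE => /nltP [w E]; apply/nltP; exists w.
  apply: (@naddI _ ((fdigits u * b + d u) * power k)).
  by transitivity ((fdigits u * b + d u + 1) * power k); [ring|rewrite E; ring].
pose distinct k := forall j', j' ≼ k -> forall j, j ≺ j' -> 0 ≺ j ->
  forall i, i ≼ n -> digit m j i -> ~ digit m j' i.
have distinct_fcount u k : k ≼ fcount u -> distinct k.
  move=> ku j' j'k j jj j0 i hi h1 h2.
  have [|v [_ [Fv vE]]] := @final_below u j j0.
    by left; apply: nlt_le_trans jj _; apply: nle_trans j'k ku.
  have [||v' [_ [Fv' vE']]] := @final_below u j'; first exact: nlt_trans jj.
    exact: nle_trans j'k ku.
  have iv : i = d v by apply: (digit_unique hi (dn v) h1); rewrite -vE; apply: digit_final.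
  have iv' : i = d v' by apply: (digit_unique hi (dn v') h2); rewrite -vE'; apply: digit_final.
  case: (ntotal v v') => [/Fv|[/Fv'|vv]]; rewrite -?iv -?iv' //.
  by move: jj; rewrite -vE -vE' vv => /nltxx.
have rp := power_R1.
(* This maximum takes the part of overspill: distinctness of the first [k] digits is Delta_1,
   although the set of places reached by [fcount] need not be. *)
have [|||k [[Dk kn] kmax]] := @greatest M (fun k => distinct k /\ k ≼ n + 1) (n + 1).
- by rewrite /distinct /digit; df.
- exists 0; split; last exact: nle0.
  by move=> j' [/nlt0//|->] j /nlt0.
- by move=> ? [].
case: (pselect (exists u, k ≼ fcount u)) => [[u ku]|nu].
  (* A place reached by [fcount] cannot be the greatest, since one more final position always
     follows. *)
  have [v [uv [Fv _]]] := final_after u.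
  have kv : k + 1 ≼ fcount (v + 1).
    have [-> _] := final_fcount Fv.
    have /nleP [w ->] : k ≼ fcount v by apply: nle_trans ku (fcount_le uv).
    by apply/nleP; exists w; ring.
  have /kmax/nlt_nle : distinct (k + 1) /\ k + 1 ≼ n + 1.
    by split; [apply: distinct_fcount kv|apply: nle_trans kv (fcount_max _)].
  by apply; apply: nltSn.
(* Now [k] exceeds every [fcount u]. The digit at place [k] is a colour, and the final occurrence of
   that colour has put the same digit at a smaller place. *)
have [i hi Di] := digit_exists m kn.
have [v [_ [Fv dv]]] := final_after i.
rewrite (d_id hi) in dv.
have lt : fcount v + 1 ≺ k.
  by have [<- _] := final_fcount Fv; apply: contrapT => /nlt_nle h; apply: nu; exists (v + 1).
apply: (Dk k (nle_refl k) _ lt _ i hi) Di; first exact/nlt_neq0/addn1_neq0.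
by rewrite -dv; apply: digit_final.
Qed.

Lemma value_decided m :
  eventually (fun t => m ≺ value t) \/ eventually (fun t => value t ≺ m).
Proof.
have [u [k [uk nm]]] := value_avoids m; have hv := value_bounds uk.
case: (ntotal m (fdigits u * power k)) => [lt|ge].
  by left; apply: eventually_imp hv => t [h _]; apply: nlt_le_trans h.
right; apply: eventually_imp hv => t [_ h]; apply: (nlt_le_trans h).
by apply/nlt_nle => lt; apply: nm.
Qed.

Lemma value_bounded : exists m, eventually (fun t => value t ≺ m).
Proof.
have /nleP [k kE] := fcount_max 0.
exists ((fdigits 0 + 1) * power k).
by apply: eventually_imp (value_bounds (esym kE)) => t [].
Qed.

(** With integer values, [value t ≺ l + 1] excludes that [l] is eventually exceeded, and
    [value_decided] leaves only the other case. *)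
Lemma value_pred m : eventually (fun t => value t ≺ m) ->
  exists2 l, m = l + 1 & eventually (fun t => value t ≺ l).
Proof.
move=> h; have [t] := eventually_ex h; case: (ncase m) h => [->|[l ->]] h.
  by move/nlt0.
move=> _; exists l => //; case: (value_decided l) => // h'.
have [s [h1 /nltS h2]] := eventually_ex (eventually_and h' h).
by case: (nltxx (nlt_le_trans h1 h2)).
Qed.

Lemma value_gap (q : K) : eventually (fun t => q + 1 <= inj (value t)) \/
  eventually (fun t => inj (value t) <= q - 1).
Proof.
case: (lerP (q + 1) 0) => q0.
  by left; exists 0 => t _; have := inj_ge0 (value t); lra.
have [|m [hm mmin]] := @least_sigma M (fun m => q + 1 < inj m) _ (archimedean _); first by df.
case: (value_decided m) => h.
  by left; apply: eventually_imp h => t /inj_lt; lra.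
(* Three steps down: by minimality [m - 1] is at most [q + 1], so [m - 3] is at most [q - 1]. *)
have [m1 mE h1] := value_pred h; have [m2 mE1 h2] := value_pred h1.
have [m3 mE2 h3] := value_pred h2.
right; apply: eventually_imp h3 => t /inj_lt.
have : ~ (q + 1 < inj m1) by apply: mmin; rewrite mE; apply: nltSn.
move/negP; rewrite -leNgt mE1 mE2 !injD inj1; lra.
Qed.

(** Stage [t] lists the balls wholly to the left of [value t], and [above] those to the right, so a
    point in both sets is refuted at a single common stage. *)
Definition below (t ca cr : N) := 0 < kdec cr /\ kdec ca + kdec cr <= inj (value t).
Definition above (t ca cr : N) := 0 < kdec cr /\ inj (value t) <= kdec ca - kdec cr.

Lemma below_rec : rec3 below.
Proof. by have rg := digits_R1; rewrite /rec3 /below /value; df. Qed.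

Lemma above_rec : rec3 above.
Proof. by have rg := digits_R1; rewrite /rec3 /above /value; df. Qed.

Lemma in_below (x : N -> K) a r : in_rball x a r -> 0 < r ->
  eventually (fun t => a + r <= inj (value t)) -> in_ropen x below.
Proof.
move=> hx r0 h; exists a, r; split=> //.
by apply: eventually_imp h => t; rewrite /below !kcodeK.
Qed.

Lemma in_above (x : N -> K) a r : in_rball x a r -> 0 < r ->
  eventually (fun t => inj (value t) <= a - r) -> in_ropen x above.
Proof.
move=> hx r0 h; exists a, r; split=> //.
by apply: eventually_imp h => t; rewrite /above !kcodeK.
Qed.

Lemma in_rball_center (q r : K) : 0 < r -> in_rball (fun=> q) q r.
Proof. by move=> r0; exists (r / 2); [lra|exists 0 => t _; rewrite subrr normr0; lra]. Qed.

Lemma below_nonempty : exists2 x : N -> K, real x & in_ropen x below.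
Proof.
exists (fun=> -1); first exact: real_const.
apply: (in_below (a := -1) (r := 1)); [exact: in_rball_center|exact: ltr01|].
by exists 0 => t _; rewrite addNr; apply: inj_ge0.
Qed.

Lemma above_nonempty : exists2 x : N -> K, real x & in_ropen x above.
Proof.
have [m hm] := value_bounded.
exists (fun=> inj m + 1); first exact: real_const.
apply: (in_above (a := inj m + 1) (r := 1)); [exact: in_rball_center|exact: ltr01|].
by apply: eventually_imp hm => t /inj_lt; lra.
Qed.

Lemma below_above_cover (x : N -> K) : real x -> in_ropen x below \/ in_ropen x above.
Proof.
(* The radius one matches the gap in [value_gap]; a Cauchy bound of one half leaves the margin that
   [in_rball] asks for. *)
move=> [_ /(_ (1 / 2))]; case; first by lra.
move=> l hl.
have hx : in_rball x (x l) 1.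
  exists (1 / 2); first by lra.
  by exists l => t lt; have := hl l t (nle_refl l) lt; lra.
case: (value_gap (x l)) => h; [left; apply: in_below hx _ h|right; apply: in_above hx _ h];
  exact: ltr01.
Qed.

Lemma below_above_disjoint (x : N -> K) : in_ropen x below -> in_ropen x above -> False.
Proof.
move=> [a [r [r0 [eps e0 hx] hU]]] [a' [r' [r0' [eps' e0' hx'] hU']]].
have [t [[h1 h2] [h3 h4]]] := eventually_ex (eventually_and
  (eventually_and hx hU) (eventually_and hx' hU')).
move: h2 h4; rewrite /below /above !kcodeK => -[_ h2] [_ h4].
have : `|a - x t| < r by lra.
have : `|a' - x t| < r' by lra.
by rewrite !ltr_norml => /andP [? ?] /andP [? ?]; lra.
Qed.

End Colouring.

Theorem disconnected : ~ pigeonhole M -> exists U0 U1,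
  [/\ rec3 U0, rec3 U1,
      (exists2 x : N -> K, real x & in_ropen x U0) /\
      (exists2 x : N -> K, real x & in_ropen x U1),
      (forall x : N -> K, real x -> in_ropen x U0 \/ in_ropen x U1) &
      forall x : N -> K, in_ropen x U0 -> in_ropen x U1 -> False].
Proof.
move=> nphp; have [n [c [rc cn dies]]] : exists n (c : N -> N),
    [/\ R1 (fun e => c (e 0%N)), forall i, c i ≼ n &
        forall i, i ≼ n -> eventually (fun t => c t <> i)].
  apply: contrapT => h; apply: nphp => n c rc cn; apply: contrapT => h'.
  apply: h; exists n, c; split=> // i hi; apply: contrapT => h''.
  apply: h'; exists i => // m; apply: contrapT => h'; apply: h''.
  exists (m + 1) => t mt ct; apply: h'; exists t => //.
  by apply: nlt_le_trans mt; apply: nltSn.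
(* Recolouring the first [n + 1] positions by the identity makes every colour occur, each exactly
   once before stage [n + 1]. *)
pose d i := ite (i ≼ n) i (c i).
have rd : R1 (fun e => d (e 0%N)) by rewrite /d; df.
have dn i : d i ≼ n by rewrite /d /ite; case: asboolP.
have d_id i : i ≼ n -> d i = i by move=> h; rewrite /d iteT.
have ddies i : i ≼ n -> eventually (fun t => d t <> i).
  move=> /dies /(eventually_and (eventually_ge (n + 1))).
  apply: eventually_imp => t [nt]; rewrite /d iteF // => tn.
  by apply: (nltxx (x := n)); apply: nlt_le_trans (nle_trans nt tn); apply: nltSn.
exists (below n rd), (above n rd); split.
- exact: below_rec.
- exact: above_rec.
- by split; [apply: below_nonempty|apply: above_nonempty].
- exact: below_above_cover.
- exact: below_above_disjoint.
Qed.

End Disconnection.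
(** * Meaning of the formalized statements in a model *)

Section Denotation.
Variable M : rca.
Local Notation N := (num M).
Local Notation K := (krat M).

(* The environments in which an expression with named variables is evaluated,
   together with the numbers of binders they account for. *)
Record world := World {
  wdepthN : nat; wnum : nat -> N; wdepthS : nat; wset : nat -> sets M }.

Definition wle w w' :=
  (exists k, wdepthN w' = (k + wdepthN w)%N /\ forall i, wnum w' (k + i)%N = wnum w i) /\
  (exists k, wdepthS w' = (k + wdepthS w)%N /\ forall i, wset w' (k + i)%N = wset w i).

Lemma wle_refl w : wle w w.
Proof. by split; exists 0%N. Qed.

Lemma wle_trans w1 w2 w3 : wle w1 w2 -> wle w2 w3 -> wle w1 w3.
Proof.
move=> [[k [ek hk]] [l [el hl]]] [[k' [ek' hk']] [l' [el' hl']]]; split.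
  by exists (k' + k)%N; split=> [|i]; [rewrite ek' ek addnA|rewrite -addnA hk' hk].
by exists (l' + l)%N; split=> [|i]; [rewrite el' el addnA|rewrite -addnA hl' hl].
Qed.

(** Quantifying over all later worlds makes denotations persistent, so that they can be carried
    below further binders. *)
Definition denN w (a : nexp) (x : N) :=
  forall w', wle w w' -> eval (M := M) (wnum w') (a (wdepthN w')) = x.

Definition denS w (X : sexp) (V : sets M) :=
  forall w', wle w w' -> wset w' (X (wdepthS w')) = V.

Definition denF w (F : fexp) (P : Prop) :=
  forall w', wle w w' ->
    (sat (M := M) (wnum w') (wset w') (F (wdepthN w') (wdepthS w')) <-> P).

Lemma denN_le w w' a x : wle w w' -> denN w a x -> denN w' a x.
Proof. by move=> ww h w2 /(wle_trans ww) /h. Qed.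

Lemma denS_le w w' X V : wle w w' -> denS w X V -> denS w' X V.
Proof. by move=> ww h w2 /(wle_trans ww) /h. Qed.

Lemma denN_add w a b x y : denN w a x -> denN w b y -> denN w (nAdd a b) (x + y).
Proof. by move=> ha hb w' ww; rewrite /= ha // hb. Qed.

Lemma denN_mul w a b x y : denN w a x -> denN w b y -> denN w (nMul a b) (x * y).
Proof. by move=> ha hb w' ww; rewrite /= ha // hb. Qed.

Lemma denF_eq w a b x y : denN w a x -> denN w b y -> denF w (xEq a b) (x = y).
Proof. by move=> ha hb w' ww; rewrite /= ha // hb. Qed.

Lemma denF_lt w a b x y : denN w a x -> denN w b y -> denF w (xLt a b) (x ≺ y).
Proof. by move=> ha hb w' ww; rewrite /= ha // hb. Qed.

Lemma denF_in w a X x V : denN w a x -> denS w X V -> denF w (xIn a X) (sin x V).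
Proof. by move=> ha hX w' ww; rewrite /= ha // hX. Qed.

Lemma denF_not w A P : denF w A P -> denF w (xNot A) (~ P).
Proof. by move=> hA w' ww; rewrite /= hA. Qed.

Lemma denF_imp w A B P Q : denF w A P -> denF w B Q -> denF w (xImp A B) (P -> Q).
Proof. by move=> hA hB w' ww; rewrite /= hA // hB. Qed.

Lemma denF_and w A B P Q : denF w A P -> denF w B Q -> denF w (xAnd A B) (P /\ Q).
Proof. by move=> hA hB w' ww; rewrite sat_and hA // hB. Qed.

Lemma denF_or w A B P Q : denF w A P -> denF w B Q -> denF w (xOr A B) (P \/ Q).
Proof. by move=> hA hB w' ww; rewrite sat_or hA // hB. Qed.

Lemma denF_iff w A B P Q : denF w A P -> denF w B Q -> denF w (xIff A B) (P <-> Q).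
Proof. by move=> hA hB w' ww; rewrite sat_iff hA // hB. Qed.

Lemma denF_ext w A P Q : (P <-> Q) -> denF w A P -> denF w A Q.
Proof. by move=> PQ h w' /h ->. Qed.

Lemma world_consN w (x : N) :
  let w' := World (wdepthN w).+1 (scons x (wnum w)) (wdepthS w) (wset w) in
  wle w w' /\ denN w' (fun d => tVar (d - (wdepthN w).+1)) x.
Proof.
split; first by split; [exists 1%N|exists 0%N].
move=> w2 [[k [-> hk]] _] /=.
by have := hk 0%N; rewrite addn0 addnK.
Qed.

Lemma world_consS w (X : sets M) :
  let w' := World (wdepthN w) (wnum w) (wdepthS w).+1 (scons X (wset w)) in
  wle w w' /\ denS w' (fun d => (d - (wdepthS w).+1)%N) X.
Proof.
split; first by split; [exists 0%N|exists 1%N].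
move=> w2 [_ [k [-> hk]]] /=.
by have := hk 0%N; rewrite addn0 addnK.
Qed.

Lemma denF_allN w F (P : N -> Prop) :
  (forall x w' v, wle w w' -> denN w' v x -> denF w' (F v) (P x)) ->
  denF w (allN F) (forall x, P x).
Proof.
move=> h w1 ww; split=> hx x; have [le dv] := world_consN w1 x.
  exact/(h x _ _ (wle_trans ww le) dv _ (wle_refl _))/hx.
exact/(h x _ _ (wle_trans ww le) dv _ (wle_refl _))/hx.
Qed.

Lemma denF_allS w F (P : sets M -> Prop) :
  (forall X w' v, wle w w' -> denS w' v X -> denF w' (F v) (P X)) ->
  denF w (allS F) (forall X, P X).
Proof.
move=> h w1 ww; split=> hX X; have [le dv] := world_consS w1 X.
  exact/(h X _ _ (wle_trans ww le) dv _ (wle_refl _))/hX.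
exact/(h X _ _ (wle_trans ww le) dv _ (wle_refl _))/hX.
Qed.

Lemma denF_exN w F (P : N -> Prop) :
  (forall x w' v, wle w w' -> denN w' v x -> denF w' (F v) (P x)) ->
  denF w (exN F) (exists x, P x).
Proof.
move=> h; apply: (denF_ext (not_forall_not P)).
apply: (denF_not (A := allN (fun x => xNot (F x)))).
by apply: denF_allN => x w' v ww hv; apply: denF_not; apply: h.
Qed.

Lemma denF_exS w F (P : sets M -> Prop) :
  (forall X w' v, wle w w' -> denS w' v X -> denF w' (F v) (P X)) ->
  denF w (exS F) (exists X, P X).
Proof.
move=> h; apply: (denF_ext (not_forall_not P)).
apply: (denF_not (A := allS (fun x => xNot (F x)))).
by apply: denF_allS => x w' v ww hv; apply: denF_not; apply: h.
Qed.

Lemma denF_le w a b x y : denN w a x -> denN w b y ->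
  denF w (xOr (xLt a b) (xEq a b)) (x ≼ y).
Proof. by move=> ha hb; apply: denF_or; [apply: denF_lt|apply: denF_eq]. Qed.

Lemma denN_npair w a b x y : denN w a x -> denN w b y -> denN w (npair a b) (npr x y).
Proof.
by move=> ha hb; apply: denN_add => //; apply: denN_mul; apply: denN_add.
Qed.

(* A fraction denotes the rational [k]; a rational variable denotes [k] if its
   components are those of the canonical representative of [k]. *)
Definition denfr w (x : frac) (f : fr M) :=
  [/\ denN w (fpos x) (fp f), denN w (fneg x) (fm f) & denN w (fden x) (fd f)].

Definition denK w x (k : K) := denfr w x (kfr k).

Definition denR w x (k : K) := exists2 f, 0 ≺ fd f & denfr w x f /\ k = kof f.

Lemma denfr_le w w' x f : wle w w' -> denfr w x f -> denfr w' x f.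
Proof. by move=> ww [h1 h2 h3]; split; apply: denN_le ww _. Qed.

Lemma denK_le w w' x k : wle w w' -> denK w x k -> denK w' x k.
Proof. exact: denfr_le. Qed.

Lemma denK_R w x k : denK w x k -> denR w x k.
Proof. by move=> h; exists (kfr k); [apply: kfr_gt0|rewrite kfrK]. Qed.

Lemma denN_code w x k : denK w x k -> denN w (code x) (kcode k).
Proof. by move=> [h1 h2 h3]; do ?apply: denN_npair. Qed.

Lemma denR_zero w : denR w qzero 0.
Proof. by exists (Fr 0 0 1); [apply: one_gt0|split]. Qed.

Lemma denR_opp w x k : denR w x k -> denR w (qopp x) (- k).
Proof. by move=> [f f0 [[h1 h2 h3] ->]]; exists (fopp f) => //; split=> //; apply: kopp_of. Qed.

Lemma denR_add w x y k l : denR w x k -> denR w y l -> denR w (qadd x y) (k + l).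
Proof.
move=> [f f0 [[f1 f2 f3] ->]] [g g0 [[g1 g2 g3] ->]]; exists (fadd f g).
  exact: nmul_gt0.
split; last exact: kadd_of.
by split; do ?[apply: denN_add|apply: denN_mul].
Qed.

Lemma denR_sub w x y k l : denR w x k -> denR w y l -> denR w (qsub x y) (k - l).
Proof. by move=> hx /denR_opp; apply: denR_add. Qed.

Lemma denF_qlt w x y k l : denR w x k -> denR w y l -> denF w (qlt x y) (k < l).
Proof.
move=> [f f0 [[f1 f2 f3] ->]] [g g0 [[g1 g2 g3] ->]].
apply: denF_ext (iff_sym (kof_lt f0 g0)) _.
by apply: denF_lt; apply: denN_add; apply: denN_mul.
Qed.

Lemma denF_qeq w x y k l : denR w x k -> denR w y l -> denF w (qeq x y) (k = l).
Proof.
move=> [f f0 [[f1 f2 f3] ->]] [g g0 [[g1 g2 g3] ->]].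
apply: denF_ext (iff_sym (kof_eq f0 g0)) _.
by apply: denF_eq; apply: denN_add; apply: denN_mul.
Qed.

Lemma denF_qle w x y k l : denR w x k -> denR w y l -> denF w (qle x y) (k <= l).
Proof.
move=> hx hy; apply: (denF_ext (P := k < l \/ k = l)); last first.
  by apply: denF_or; [apply: denF_qlt|apply: denF_qeq].
by rewrite le_eqVlt; split=> [[->|->]|/orP [/eqP|]]; rewrite ?eqxx ?orbT //; [right|left].
Qed.

Lemma denF_qabs w x y k l : denR w x k -> denR w y l -> denF w (qabs x y) (l = `|k|).
Proof.
move=> hx hy; have h0 := denR_zero w.
apply: (denF_ext (P := (0 <= k /\ l = k) \/ (k < 0 /\ l = - k))).
  case: (lerP 0 k) => k0; first by rewrite ger0_norm //; split=> [[[]|[]]|] //; left.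
  by rewrite ltr0_norm //; split=> [[[]|[]]|] //; right.
apply: denF_or; apply: denF_and; first exact: denF_qle.
- exact: denF_qeq.
- exact: denF_qlt.
by apply: denF_qeq => //; apply: denR_opp.
Qed.

Lemma denF_canonical w x f : denfr w x f -> denF w (canonical x) (fcanon f).
Proof.
move=> [h1 h2 h3]; apply: denF_and; first by apply: denF_lt.
apply: denF_allN => p w1 vp ww1 hp; apply: denF_allN => m w2 vm ww2 hm.
apply: denF_allN => d w3 vd ww3 hd.
have {}hp := denN_le (wle_trans ww2 ww3) hp; have {}hm := denN_le ww3 hm.
have ww := wle_trans ww1 (wle_trans ww2 ww3).
have {}h1 := denN_le ww h1; have {}h2 := denN_le ww h2; have {}h3 := denN_le ww h3.
apply: denF_imp; first apply: denF_and.
- by apply: denF_lt.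
- by apply: denF_eq; apply: denN_add; apply: denN_mul.
by apply: denF_le; do ?apply: denN_npair.
Qed.

Lemma denF_allQ w F (P : K -> Prop) :
  (forall k w' x, wle w w' -> denK w' x k -> denF w' (F x) (P k)) ->
  denF w (allQ F) (forall k, P k).
Proof.
move=> h; apply: (denF_ext (P := forall p m d, fcanon (Fr p m d) -> P (kof (Fr p m d)))).
  split=> [hP k|hP p m d _ //].
  rewrite -[k]kfrK; have := kcanon k; case: (kfr k) => p m d; exact: hP.
apply: denF_allN => p w1 vp ww1 hp; apply: denF_allN => m w2 vm ww2 hm.
apply: denF_allN => d w3 vd ww3 hd.
have {}hp := denN_le (wle_trans ww2 ww3) hp; have {}hm := denN_le ww3 hm.
have ww := wle_trans ww1 (wle_trans ww2 ww3).
have hf : denfr w3 (Frac vp vm vd) (Fr p m d) by [].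
case: (pselect (fcanon (Fr p m d))) => c.
  apply: denF_imp; first exact: denF_canonical.
  by apply: h => //; rewrite /denK fcanon_kof.
(* A noncanonical triple denotes no rational; the guard of the quantifier is then false. *)
have hc := denF_canonical hf.
by move=> w4 ww4; split=> [_ /c//|_ h4]; case: c; apply/(hc w4 ww4).
Qed.

Lemma denF_exQ w F (P : K -> Prop) :
  (forall k w' x, wle w w' -> denK w' x k -> denF w' (F x) (P k)) ->
  denF w (exQ F) (exists k, P k).
Proof.
move=> h; apply: (denF_ext (P := exists p m d, fcanon (Fr p m d) /\ P (kof (Fr p m d)))).
  split=> [[p [m [d [_ Pk]]]]|[k]]; first by exists (kof (Fr p m d)).
  rewrite -[k]kfrK; have := kcanon k; case: (kfr k) => p m d c Pk; by exists p, m, d.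
apply: denF_exN => p w1 vp ww1 hp; apply: denF_exN => m w2 vm ww2 hm.
apply: denF_exN => d w3 vd ww3 hd.
have {}hp := denN_le (wle_trans ww2 ww3) hp; have {}hm := denN_le ww3 hm.
have ww := wle_trans ww1 (wle_trans ww2 ww3).
have hf : denfr w3 (Frac vp vm vd) (Fr p m d) by [].
case: (pselect (fcanon (Fr p m d))) => c.
  apply: denF_and; first exact: denF_canonical.
  by apply: h => //; rewrite /denK fcanon_kof.
have hc := denF_canonical hf.
by move=> w4 ww4; rewrite sat_and; split=> [[/(hc w4 ww4)]|[]].
Qed.

(** * Reals and open sets *)

Definition is_fun (V : sets M) (P : N -> Prop) :=
  (forall m, sin m V -> exists i k, P k /\ m = npr i k) /\
  (forall i, exists k, sin (npr i k) V /\ forall l, sin (npr i l) V -> l = k).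

Lemma denF_is_function w X V F P : denS w X V ->
  (forall w' v x, wle w w' -> denN w' v x -> denF w' (F v) (P x)) ->
  denF w (is_function X F) (is_fun V P).
Proof.
move=> hX hF; apply: denF_and.
  apply: denF_allN => m w1 vm ww1 hm; apply: denF_imp.
    by apply: denF_in => //; apply: denS_le hX.
  apply: denF_exN => i w2 vi ww2 hi; apply: denF_exN => k w3 vk ww3 hk.
  have ww := wle_trans ww1 (wle_trans ww2 ww3).
  have {}hm := denN_le (wle_trans ww2 ww3) hm; have {}hi := denN_le ww3 hi.
  apply: denF_and; first exact: hF.
  by apply: denF_eq => //; apply: denN_npair.
apply: denF_allN => i w1 vi ww1 hi; apply: denF_exN => k w2 vk ww2 hk.
have {}hi := denN_le ww2 hi.
apply: denF_and.
  apply: denF_in; first exact: denN_npair.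
  by apply: denS_le hX; apply: wle_trans ww2.
apply: denF_allN => l w3 vl ww3 hl; apply: denF_imp.
  apply: denF_in; first by apply: denN_npair => //; apply: denN_le hi.
  by apply: denS_le hX; apply: wle_trans ww3; apply: wle_trans ww2.
by apply: denF_eq => //; apply: denN_le hk.
Qed.

Definition set_real (V : sets M) :=
  is_fun V (fun v => exists k : K, v = kcode k) /\
  forall eps : K, 0 < eps -> exists l, forall m n, l ≼ m /\ l ≼ n ->
    forall x y : K, sin (npr m (kcode x)) V /\ sin (npr n (kcode y)) V ->
      exists z : K, z = `|x - y| /\ z < eps.

Lemma denF_is_real w X V : denS w X V -> denF w (is_real X) (set_real V).
Proof.
move=> hX; apply: denF_and.
  apply: denF_is_function => // w1 v x ww1 hv; apply: denF_exQ => k w2 q ww2 hq.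
  by apply: denF_eq; [apply: denN_le hv|apply: denN_code].
apply: denF_allQ => eps w1 ve ww1 he; apply: denF_imp.
  by apply: denF_qlt; [apply: denR_zero|apply: denK_R].
apply: denF_exN => l w2 vl ww2 hl; apply: denF_allN => m w3 vm ww3 hm.
apply: denF_allN => n w4 vn ww4 hn.
have {}hl := denN_le (wle_trans ww3 ww4) hl; have {}hm := denN_le ww4 hm.
apply: denF_imp; first by apply: denF_and; apply: denF_le.
apply: denF_allQ => x w5 vx ww5 hx; apply: denF_allQ => y w6 vy ww6 hy.
have {}hm := denN_le (wle_trans ww5 ww6) hm; have {}hn := denN_le (wle_trans ww5 ww6) hn.
have {}hx := denK_le ww6 hx.
have ww := wle_trans ww1 (wle_trans ww2 (wle_trans ww3 (wle_trans ww4 (wle_trans ww5 ww6)))).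
have {}hX := denS_le ww hX.
apply: denF_imp.
  by apply: denF_and; apply: denF_in => //; apply: denN_npair => //; apply: denN_code.
apply: denF_exQ => z w7 vz ww7 hz.
have {}hx := denK_le ww7 hx; have {}hy := denK_le ww7 hy.
have {}he : denK w7 ve eps.
  by apply: denK_le he; do ?[apply: wle_trans ww7]; do ?[apply: wle_trans ww6];
    apply: wle_trans ww2 (wle_trans ww3 (wle_trans ww4 ww5)).
apply: denF_and; first by apply: denF_qabs; [apply: denR_sub|]; apply: denK_R.
by apply: denF_qlt; apply: denK_R.
Qed.

Definition denseq w (x : qseq) (R : N -> K -> Prop) :=
  forall w' v n p k, wle w w' -> denN w' v n -> denK w' p k -> denF w' (x v p) (R n k).

Lemma denseq_of w X V : denS w X V ->
  denseq w (seq_of X) (fun n k => sin (npr n (kcode k)) V).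
Proof.
move=> hX w1 v n p k ww hv hp; apply: denF_in; last exact: denS_le hX.
by apply: denN_npair => //; apply: denN_code.
Qed.

Lemma denseq_const w a k : denK w a k -> denseq w (seq_const a) (fun _ l => l = k).
Proof.
move=> ha w1 v n p l ww hv hp; apply: denF_qeq; first exact: denK_R.
by apply: denK_R; apply: denK_le ha.
Qed.

Lemma denseq_sub w x y R R' : denseq w x R -> denseq w y R' ->
  denseq w (seq_sub x y) (fun n p => exists k l, R n k /\ R' n l /\ p = k - l).
Proof.
move=> hx hy w1 v n p m ww hv hp.
apply: denF_exQ => k w2 vk ww2 hk; apply: denF_exQ => l w3 vl ww3 hl.
have {}hk := denK_le ww3 hk; have {}hv := denN_le (wle_trans ww2 ww3) hv.
have {}hp := denK_le (wle_trans ww2 ww3) hp.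
have {}ww := wle_trans ww (wle_trans ww2 ww3).
apply: denF_and; first by apply: hx.
apply: denF_and; first by apply: hy.
by apply: denF_qeq; [apply: denK_R|apply: denR_sub; apply: denK_R].
Qed.

Lemma denseq_abs w x R : denseq w x R ->
  denseq w (seq_abs x) (fun n p => exists k, R n k /\ p = `|k|).
Proof.
move=> hx w1 v n p m ww hv hp.
apply: denF_exQ => k w2 vk ww2 hk.
apply: denF_and; first by apply: hx => //; [apply: wle_trans ww ww2|apply: denN_le hv].
by apply: denF_qabs; apply: denK_R => //; apply: denK_le hp.
Qed.

Definition seq_le (R R' : N -> K -> Prop) := forall eps : K, 0 < eps -> exists l,
  forall n, l ≼ n -> forall p q, R n p /\ R' n q -> p <= q + eps.

Lemma denF_real_le w x y R R' : denseq w x R -> denseq w y R' ->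
  denF w (real_le x y) (seq_le R R').
Proof.
move=> hx hy; apply: denF_allQ => eps w1 ve ww1 he; apply: denF_imp.
  by apply: denF_qlt; [apply: denR_zero|apply: denK_R].
apply: denF_exN => l w2 vl ww2 hl; apply: denF_allN => n w3 vn ww3 hn.
apply: denF_imp; first by apply: denF_le => //; apply: denN_le hl.
apply: denF_allQ => p w4 vp ww4 hp; apply: denF_allQ => q w5 vq ww5 hq.
have {}hn := denN_le (wle_trans ww4 ww5) hn; have {}hp := denK_le ww5 hp.
have ww := wle_trans ww2 (wle_trans ww3 (wle_trans ww4 ww5)).
have {}he := denK_le ww he; have {}ww := wle_trans ww1 ww.
apply: denF_imp; first by apply: denF_and; [apply: hx|apply: hy].
by apply: denF_qle; [|apply: denR_add]; apply: denK_R.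
Qed.

Definition seq_lt (R R' : N -> K -> Prop) :=
  seq_le R R' /\ ~ (seq_le R R' /\ seq_le R' R).

Lemma denF_real_lt w x y R R' : denseq w x R -> denseq w y R' ->
  denF w (real_lt x y) (seq_lt R R').
Proof.
move=> hx hy; apply: denF_and; first exact: denF_real_le.
by apply: denF_not; apply: denF_and; apply: denF_real_le.
Qed.

Definition set_ball (V : sets M) (a r : K) :=
  seq_lt (fun n p => exists k, (exists u v, u = a /\ sin (npr n (kcode v)) V /\ k = u - v) /\
                       p = `|k|)
         (fun _ q => q = r).

Lemma denF_in_ball w X V a r k l : denS w X V -> denK w a k -> denK w r l ->
  denF w (in_ball (seq_of X) a r) (set_ball V k l).
Proof.
move=> hX ha hr; apply: denF_real_lt; last exact: denseq_const.
by apply: denseq_abs; apply: denseq_sub; [apply: denseq_const|apply: denseq_of].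
Qed.

Definition triple_code n (a r : K) : N := npr n (npr (kcode a) (kcode r)).

Lemma denN_triple w v n a r k l : denN w v n -> denK w a k -> denK w r l ->
  denN w (triple v a r) (triple_code n k l).
Proof. by move=> hv ha hr; apply: denN_npair => //; apply: denN_npair; apply: denN_code. Qed.

Definition set_open (U : sets M) := forall m, sin m U ->
  exists n, exists a r : K, 0 < r /\ m = triple_code n a r.

Lemma denF_is_open_code w X U : denS w X U -> denF w (is_open_code X) (set_open U).
Proof.
move=> hX; apply: denF_allN => m w1 vm ww1 hm; apply: denF_imp.
  by apply: denF_in => //; apply: denS_le hX.
apply: denF_exN => n w2 vn ww2 hn; apply: denF_exQ => a w3 va ww3 ha.
apply: denF_exQ => r w4 vr ww4 hr.
apply: denF_and; first by apply: denF_qlt; [apply: denR_zero|apply: denK_R].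
apply: denF_eq; first by apply: denN_le hm; apply: wle_trans ww2 (wle_trans ww3 ww4).
by apply: denN_triple => //; [apply: denN_le (wle_trans ww3 ww4) hn|apply: denK_le ha].
Qed.

Definition set_in (V U : sets M) := exists l, exists a r : K,
  0 < r /\ set_ball V a r /\ forall n, l ≼ n -> sin (triple_code n a r) U.

Lemma denF_in_open w X Y V U : denS w X V -> denS w Y U ->
  denF w (in_open X Y) (set_in V U).
Proof.
move=> hX hY; apply: denF_exN => l w1 vl ww1 hl; apply: denF_exQ => a w2 va ww2 ha.
apply: denF_exQ => r w3 vr ww3 hr.
have {}hl := denN_le (wle_trans ww2 ww3) hl; have {}ha := denK_le ww3 ha.
have ww := wle_trans ww1 (wle_trans ww2 ww3).
apply: denF_and; first by apply: denF_qlt; [apply: denR_zero|apply: denK_R].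
apply: denF_and; first by apply: denF_in_ball => //; apply: denS_le hX.
apply: denF_allN => n w4 vn ww4 hn; apply: denF_imp.
  by apply: denF_le => //; apply: denN_le hl.
apply: denF_in; last by apply: denS_le hY; apply: wle_trans ww ww4.
by apply: denN_triple => //; [apply: denK_le ha|apply: denK_le hr].
Qed.

Definition set_nonempty (U : sets M) := exists V, set_real V /\ set_in V U.

Lemma denF_nonempty w X U : denS w X U -> denF w (nonempty X) (set_nonempty U).
Proof.
move=> hX; apply: denF_exS => V w1 vV ww1 hV; apply: denF_and; first exact: denF_is_real.
by apply: denF_in_open => //; apply: denS_le hX.
Qed.

Definition sets_connected := ~ exists U0 U1,
  set_open U0 /\ set_open U1 /\ set_nonempty U0 /\ set_nonempty U1 /\
  (forall V, set_real V -> set_in V U0 \/ set_in V U1) /\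
  ~ exists V, set_real V /\ set_in V U0 /\ set_in V U1.

Lemma denF_reals_connected w : denF w reals_connected sets_connected.
Proof.
apply: denF_not; apply: denF_exS => U0 w1 v0 ww1 h0; apply: denF_exS => U1 w2 v1 ww2 h1.
have {}h0 := denS_le ww2 h0.
apply: denF_and; first exact: denF_is_open_code.
apply: denF_and; first exact: denF_is_open_code.
apply: denF_and; first exact: denF_nonempty.
apply: denF_and; first exact: denF_nonempty.
apply: denF_and.
  apply: denF_allS => V w3 vV ww3 hV; apply: denF_imp; first exact: denF_is_real.
  have {}h0 := denS_le ww3 h0; have {}h1 := denS_le ww3 h1.
  by apply: denF_or; apply: denF_in_open.
apply: denF_not; apply: denF_exS => V w3 vV ww3 hV.
have {}h0 := denS_le ww3 h0; have {}h1 := denS_le ww3 h1.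
apply: denF_and; first exact: denF_is_real.
by apply: denF_and; apply: denF_in_open.
Qed.

Definition sets_IPP := forall b C, is_fun C (fun k => k ≼ b) ->
  exists n, n ≼ b /\ forall m, exists i, m ≺ i /\ sin (npr i n) C.

Lemma denF_IPP w : denF w IPP sets_IPP.
Proof.
apply: denF_allN => b w1 vb ww1 hb; apply: denF_allS => C w2 vC ww2 hC.
have {}hb := denN_le ww2 hb.
apply: denF_imp.
  apply: denF_is_function => // w3 v x ww3 hv.
  by apply: denF_le => //; apply: denN_le hb.
apply: denF_exN => n w3 vn ww3 hn.
apply: denF_and; first by apply: denF_le => //; apply: denN_le hb.
apply: denF_allN => m w4 vm ww4 hm; apply: denF_exN => i w5 vi ww5 hi.
apply: denF_and; first by apply: denF_lt => //; apply: denN_le hm.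
apply: denF_in; last by apply: denS_le hC; apply: wle_trans ww3 (wle_trans ww4 ww5).
by apply: denN_npair => //; apply: denN_le hn; apply: wle_trans ww4 ww5.
Qed.

End Denotation.

(** * The equivalence in a model, and provability *)

Section Equivalence.
Variable M : rca.
Local Notation N := (num M).
Local Notation K := (krat M).

Definition graph_of (V : sets M) (f : N -> N) := forall i v, sin (npr i v) V <-> v = f i.

Lemma is_fun_graph V (P : N -> Prop) : is_fun V P ->
  exists f : N -> N, [/\ R1 (fun e => f (e 0%N)), graph_of V f & forall i, P (f i)].
Proof.
move=> [h1 h2]; pose f i := sval (cid (h2 i)).
have fP i : sin (npr i (f i)) V /\ forall l, sin (npr i l) V -> l = f i := svalP (cid (h2 i)).
have gf : graph_of V f.
  by move=> i v; have [hf hl] := fP i; split=> [/hl|->].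
exists f; split=> // [|i].
  by apply: (R1_graph (G := fun e v => sin (npr (e 0%N) v) V)); [move=> e v; rewrite gf|df].
have [i' [k [Pk /npr_inj [_ fk]]]] := h1 _ (proj1 (fP i)).
by rewrite fk.
Qed.

Lemma graph_exists (f : N -> N) (P : N -> Prop) : R1 (fun e => f (e 0%N)) ->
  (forall i, P (f i)) -> exists2 V, is_fun V P & graph_of V f.
Proof.
move=> rf Pf.
have [||V hV] := @comprehension M (fun z => exists i, i ≼ z /\ z = npr i (f i)).
- by df.
- by apply: S1_D1; apply: D1_not; df.
have gV : graph_of V f.
  move=> i v; rewrite hV; split=> [[j [_ /npr_inj [-> ->]]]//|->].
  by exists i; split=> //; apply: npr_lel.
exists V => //; split=> [m /hV [i [_ ->]]|i]; first by exists i, (f i).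
by exists (f i); split=> [|l]; rewrite gV.
Qed.

Lemma sets_IPP_iff : sets_IPP M <-> pigeonhole M.
Proof.
split=> [ipp b c rc cb|php b C /is_fun_graph [f [rf gf fb]]].
  have [C fC gC] := graph_exists (P := fun k => k ≼ b) rc cb.
  have [n [nb hn]] := ipp b C fC; exists n => // m.
  by have [i [mi /gC ->]] := hn m; exists i.
have [n nb hn] := php b f rf fb; exists n; split=> // m.
by have [i mi fi] := hn m; exists i; split=> //; rewrite gf.
Qed.

Definition codes_real (V : sets M) (x : N -> K) :=
  forall n k, sin (npr n (kcode k)) V <-> k = x n.

Lemma set_real_real V : set_real V -> exists2 x, real x & codes_real V x.
Proof.
move=> [/is_fun_graph [f [rf gf fk]] cau].
have cV : codes_real V (fun n => kdec (f n)).
  move=> n k; rewrite gf; split=> [<-|->]; rewrite ?kcodeK // kdecK //.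
exists (fun n => kdec (f n)) => //; split; first by df.
move=> eps /cau [l hl]; exists l => m n lm ln.
have [|z [-> //]] := hl m n (conj lm ln) (kdec (f m)) (kdec (f n)).
by rewrite !cV.
Qed.

Lemma real_set_real (x : N -> K) : real x -> exists2 V, set_real V & codes_real V x.
Proof.
move=> [rx cx].
have [|V fV gV] := @graph_exists (fun n => kcode (x n)) (fun v => exists k : K, v = kcode k) rx.
  by move=> i; exists (x i).
have cV : codes_real V x by move=> n k; rewrite gV; split=> [/kcode_inj|->].
exists V => //; split=> // eps /cx [l hl]; exists l => m n [lm ln] a b [/cV -> /cV ->].
by exists `|x m - x n|; split=> //; apply: hl.
Qed.

(** Failure of equality only yields a margin [eps] at arbitrarily late places; the Cauchy property
    spreads half of it to all sufficiently late ones. *)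
Lemma set_ball_iff V (x : N -> K) a r : cauchy x -> codes_real V x ->
  (set_ball V a r <-> in_rball x a r).
Proof.
move=> cx cV; rewrite /set_ball; set R := fun n p => _; set R' := fun _ q => _.
have RE n p : R n p <-> p = `|a - x n|.
  split=> [[_ [[_ [v [-> [/cV -> ->]]]] ->]] //|->].
  exists (a - x n); split=> //; exists a, (x n); split=> //; split=> //.
  exact/cV.
have leE : seq_le R R' <-> forall eps, 0 < eps -> eventually (fun n => `|a - x n| <= r + eps).
  split=> h eps /h [l hl]; exists l => n ln; first by apply: hl ln _ _ _; rewrite RE.
  by move=> p q [/RE -> ->]; apply: hl.
have geE : seq_le R' R <-> forall eps, 0 < eps -> eventually (fun n => r <= `|a - x n| + eps).
  split=> h eps /h [l hl]; exists l => n ln; first by apply: hl ln _ _ _; rewrite RE.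
  by move=> p q [-> /RE ->]; apply: hl.
rewrite /seq_lt leE geE; split=> [[le nge]|[eps e0 h]]; last first.
  have le : forall e, 0 < e -> eventually (fun n => `|a - x n| <= r + e).
    by move=> e e1; apply: eventually_imp h => n; lra.
  split=> // -[_ /(_ _ e0) h']; have [n [h1 h2]] := eventually_ex (eventually_and h h').
  lra.
have [eps [e0 heps]] : exists eps, 0 < eps /\ ~ eventually (fun n => r <= `|a - x n| + eps).
  apply: contrapT => n; apply: nge; split=> // eps e0; apply: contrapT => n'.
  by apply: n; exists eps.
have e2 : 0 < eps / 2 by lra.
have [l hl] := cx _ e2.
have [m [lm hm]] : exists m, l ≼ m /\ `|a - x m| + eps < r.
  apply: contrapT => n; apply: heps; exists l => m lm; rewrite leNgt; apply/negP => lt.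
  by apply: n; exists m.
exists (eps / 2) => //; exists l => n ln.
have := hl m n lm ln; have := ler_distD (x m) a (x n); lra.
Qed.

Lemma set_in_iff V U (x : N -> K) (U' : N -> N -> N -> Prop) : cauchy x -> codes_real V x ->
  (forall t (a r : K), 0 < r -> (sin (triple_code t a r) U <-> U' t (kcode a) (kcode r))) ->
  (set_in V U <-> in_ropen x U').
Proof.
move=> cx cV hU; split=> [[l [a [r [r0 [hb h]]]]]|[a [r [r0 hb [l h]]]]].
  exists a, r; split=> //; first exact/(set_ball_iff a r cx cV).
  by exists l => n ln; apply/hU => //; apply: h.
exists l, a, r; split=> //; split; first exact/(set_ball_iff a r cx cV).
by move=> n ln; apply/hU => //; apply: h.
Qed.

(** The relation [U] may hold of numbers that code no rational or no positive radius; the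
    comprehension keeps genuine triples only, as [set_open] demands. *)
Lemma open_set_exists (U : N -> N -> N -> Prop) : rec3 U -> exists2 W, set_open W &
  forall t (a r : K), 0 < r -> (sin (triple_code t a r) W <-> U t (kcode a) (kcode r)).
Proof.
rewrite /rec3 => rU.
pose P z := exists t, t ≼ z /\ exists a, a ≼ z /\ exists r, r ≼ z /\
  ((z = npr t (npr a r) /\ (a = kcode (kdec a) /\ r = kcode (kdec r))) /\
   (0 < kdec r /\ U t a r)).
have dP : D1 (fun e => P (e 0%N)) by rewrite /P; df.
have [W hW] := comprehension (S1_D1 dP) (S1_D1 (D1_not dP)).
exists W => [z /hW [t [_ [a [_ [r [_ [[-> [aE rE]] [r0 _]]]]]]]]|t a r r0].
  by exists t, (kdec a), (kdec r); rewrite /triple_code -aE -rE.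
rewrite hW /triple_code; split=> [[t' [_ [a' [_ [r' [_ [[E _] [_ h]]]]]]]]|h].
  by have [-> /npr_inj [-> ->]] := npr_inj E.
exists t; split; first exact: npr_lel.
have le := npr_ler t (npr (kcode a) (kcode r)).
exists (kcode a); split; first exact: nle_trans (npr_lel _ _) le.
exists (kcode r); split; first exact: nle_trans (npr_ler _ _) le.
by rewrite !kcodeK.
Qed.

Lemma sets_connected_iff : sets_connected M <-> sets_IPP M.
Proof.
rewrite sets_IPP_iff; split=> [conn|php]; last first.
  move=> [S0 [S1 [o0 [o1 [[V0 [/set_real_real [x rx cx] xS]] [
    [V1 [/set_real_real [y ry cy] yS]] [cover disj]]]]]]].
  pose U S (t a r : N) := sin (s := M) (npr t (npr a r)) S.
  have rU S : rec3 (U S) by rewrite /rec3 /U; df.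
  have inE S V z : real z -> codes_real V z -> (set_in V S <-> in_ropen z (U S)).
    by move=> [_ cz] hz; apply: set_in_iff.
  have [|||z rz [z0 z1]] := @pigeonhole_connected M php (U S0) (U S1) x y (rU S0) (rU S1).
  - exact/(inE _ _ _ rx cx).
  - exact/(inE _ _ _ ry cy).
  - move=> z rz; have [V rV cV] := real_set_real rz.
    by case: (cover V rV) => /(inE _ _ _ rz cV); [left|right].
  apply: disj; have [V rV cV] := real_set_real rz.
  by exists V; split=> //; split; apply/(inE _ _ _ rz cV).
apply: contrapT => /disconnected [U0 [U1 [r0 r1 [[x rx hx] [y ry hy]] cover disj]]].
apply: conn; have [W0 o0 W0E] := open_set_exists r0; have [W1 o1 W1E] := open_set_exists r1.
exists W0, W1; split=> //; split=> //; split; [|split; [|split]].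
- have [V rV cV] := real_set_real rx; exists V; split=> //.
  by apply/(set_in_iff (proj2 rx) cV W0E).
- have [V rV cV] := real_set_real ry; exists V; split=> //.
  by apply/(set_in_iff (proj2 ry) cV W1E).
- move=> V /set_real_real [z rz cV].
  case: (cover z rz) => h; [left|right].
    by apply/(set_in_iff (proj2 rz) cV W0E).
  by apply/(set_in_iff (proj2 rz) cV W1E).
move=> [V [/set_real_real [z rz cV] [/(set_in_iff (proj2 rz) cV W0E) h0]]].
by move=> /(set_in_iff (proj2 rz) cV W1E) h1; apply: (disj z).
Qed.

End Equivalence.

Theorem proposition4p8 : provable RCA0 (sentence (xIff reals_connected IPP)).
Proof.
apply: completeness => M0 theory rho sig.
pose M := Rca theory (sig 0%N).
have den := denF_iff (@denF_reals_connected M _) (@denF_IPP M _).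
(* The world without binders, since [sentence] evaluates its expression at depth zero. *)
by apply/(den (World (M := M) 0 rho 0 sig) _ (wle_refl _)); apply: sets_connected_iff.
Qed.
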